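(* Let $\Lambda$ be a $d$-dimensional lattice, let $\bm x,\bm y\in\mathbb R^d$, and let $\nu\in\mathbb C$ be such that $\nu\neq d$ if $\bm y\in\Lambda^*$. The product $$\frac{(V_\Lambda^{2/d}/\pi)^{\nu/2}}{\Gamma\big((d-\nu)/2\big)}\,e^{\pi i\bm x\cdot\bm y}\,Z_{\Lambda,\nu}(\bm x,\bm y)$$ is invariant under the parameter transformation $(\Lambda,\nu,\bm x,\bm y)\to(\Lambda^*,d-\nu,\bm y,-\bm x)$; that is, $$\frac{(V_\Lambda^{2/d}/\pi)^{\nu/2}}{\Gamma\big((d-\nu)/2\big)}\,e^{\pi i\bm x\cdot\bm y}\,Z_{\Lambda,\nu}(\bm x,\bm y)=\frac{(V_{\Lambda^*}^{2/d}/\pi)^{(d-\nu)/2}}{\Gamma(\nu/2)}\,e^{-\pi i\bm x\cdot\bm y}\,Z_{\Lambda^*,d-\nu}(\bm y,-\bm x).$$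
   Context: A $d$-dimensional lattice is a set $\Lambda=A\mathbb Z^d$ with $A\in\mathbb R^{d\times d}$ regular; $V_\Lambda=|\det A|$, and the reciprocal lattice is $\Lambda^*=A^{-T}\mathbb Z^d$, with $V_{\Lambda^*}=1/V_\Lambda$. For $\bm x,\bm y\in\mathbb R^d$, the Epstein zeta function $Z_{\Lambda,\nu}(\bm x,\bm y)$ is the meromorphic continuation to $\nu\in\mathbb C$ of the lattice sum $\sum'_{\bm z\in\Lambda}e^{-2\pi i\bm y\cdot\bm z}/|\bm x-\bm z|^{\nu}$, $\mathrm{Re}(\nu)>d$, where the primed sum excludes the summand $\bm z=\bm x$ (if $\bm x\in\Lambda$). It is holomorphic in $\nu$ except for a simple pole at $\nu=d$ when $\bm y\in\Lambda^*$. Here $1/\Gamma$ is the entire reciprocal gamma function. When $\nu=0$ and $\bm x\in\Lambda$, $Z_{\Lambda^*,d-\nu}(\bm y,-\bm x)$ has a pole at $\nu=0$ cancelled by the zero of $1/\Gamma(\nu/2)$, and the right-hand product is understood as its limit as $\nu\to0$. *)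

(* Defs.v *)
From HB Require Import structures.
From mathcomp Require Import all_boot all_order all_algebra.
From mathcomp Require Import all_classical all_reals all_analysis.
From mathcomp Require Import complex.
From mathcomp.analysis.showcase Require summability.

Set Implicit Arguments.
Unset Strict Implicit.
Unset Printing Implicit Defensive.

Import Order.TTheory GRing.Theory Num.Theory.
Import numFieldNormedType.Exports.

Local Open Scope classical_set_scope.
Local Open Scope ring_scope.
Local Open Scope complex_scope.

(* [R[i]^o] is [R[i]] seen as a normed space over itself: limits, and
   [derivable _ _ 1], are the complex ones. *)

Definition cexp (R : realType) (z : R[i]) : R[i] :=
  (expR (complex.Re z))%:C *
  (cos (complex.Im z) +i* sin (complex.Im z)).

(* Only meaningful for [0 < a]. *)
Definition cpow (R : realType) (a : R) (s : R[i]) : R[i] :=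
  cexp (s * (ln a)%:C).

(* The entire function 1/Gamma, by Gauss's limit
   Gamma(s) = lim n! n^s / (s (s + 1) ... (s + n)). *)
Definition rGamma (R : realType) (s : R[i]) : R[i] :=
  lim ((fun n : nat => (\prod_(k < n.+1) (s + k%:R)) /
                       (n`!%:R * cpow n%:R s) : R[i]^o) @ \oo).

Definition dotp (R : realType) (d : nat) (x y : 'cV[R]_d) : R :=
  \sum_(i < d) x i 0 * y i 0.

(* The library norm [`|x|] on matrices is the sup norm. *)
Definition enorm (R : realType) (d : nat) (x : 'cV[R]_d) : R :=
  Num.sqrt (dotp x x).

Definition lattice (R : realType) (d : nat) (A : 'M[R]_d) : set 'cV[R]_d :=
  [set A *m map_mx intr n | n in [set: 'cV[int]_d]].

Definition reciprocal (R : realType) (d : nat) (A : 'M[R]_d) : 'M[R]_d :=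
  (invmx A)^T.

Definition covolume (R : realType) (d : nat) (A : 'M[R]_d) : R := `|\det A|.

(* [summability.sum] is the unconditional sum: the limit of the partial sums
   over the finite subsets of the index type. *)
Definition epstein_sum (R : realType) (d : nat) (L : set 'cV[R]_d)
    (x y : 'cV[R]_d) (nu : R[i]) : R[i] :=
  summability.sum (fun z : 'cV[R]_d =>
    (if (z \in L) && (z != x)
     then cexp (0 +i* (- 2 * pi * dotp y z)) / cpow (enorm (x - z)) nu
     else 0) : R[i]^o).

(* The value of a meromorphic function at a pole is irrelevant; at every other
   point the function is required to be holomorphic, so that removable
   singularities do not occur. *)
Definition meromorphic (R : realType) (f : R[i]^o -> R[i]^o) : Prop :=
  forall s : R[i]^o,
    (\forall w \near s^', derivable f w 1) /\
    (derivable f s 1 \/ `|f w| @[w --> s^'] --> +oo).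

(* The meromorphic continuation: by the identity theorem the function chosen
   here is unique away from its poles. *)
Definition epstein_zeta (R : realType) (d : nat) (L : set 'cV[R]_d)
    (nu : R[i]) (x y : 'cV[R]_d) : R[i] :=
  xget (fun=> 0)
    [set f : R[i]^o -> R[i]^o | meromorphic f /\
      forall s : R[i], d%:R < complex.Re s -> f s = epstein_sum L x y s] nu.

(* Main.v *)
(* Riemann's second proof of the functional equation.  Multiplying by
   Gamma(nu/2) turns the lattice sum into the Mellin transform of the theta
   series [sum_z exp (- pi t |z - x|^2) exp (- 2 pi i y.z)] without the term
   [z = x]; splitting the integral at [t = 1] and applying the transformation
   [t -> 1/t] of the theta series gives the meromorphic continuation in a form
   that exchanges (Lambda, nu, x, y) and (Lambda^*, d - nu, y, -x).  By the
   identity theorem it agrees with the chosen continuation away from the pole.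

   The transformation of the theta series on the line is obtained as in Polya:
   the binomial expansions of [(w + 1/w)^(2m)] at the roots of unity of order
   2h+1 give a finite identity, and the de Moivre-Laplace limit with Tannery's
   theorem turns it into the theta identity.  The lattice case follows by
   induction on the dimension, completing the square in one variable.

   The equality of Gauss's limit with Euler's integral comes from the dominated
   limit of [int t^(a-1) (1 - t/n)^n dt = n! n^a / (a (a+1) ... (a+n))]. *)
Require Import Defs.
From HB Require Import structures.
From mathcomp Require Import all_boot all_order all_algebra.
From mathcomp Require Import all_classical all_reals all_analysis.
From mathcomp Require Import complex.
From mathcomp Require Import zify ring lra.
From mathcomp Require Import measurable_realfun.
From mathcomp Require finmap.
From mathcomp.analysis.showcase Require summability.

Set Implicit Arguments.
Unset Strict Implicit.
Unset Printing Implicit Defensive.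

Import Order.TTheory GRing.Theory Num.Theory.
Import numFieldNormedType.Exports.

Local Open Scope classical_set_scope.
Local Open Scope ring_scope.
Local Open Scope complex_scope.
Import Normc.

(** * Complex numbers and complex derivatives *)

(** The obstacle is that [epstein_zeta] is picked from a set of functions about which only
    meromorphy and the values for Re s > d are known. Any formula for it therefore needs a member of
    that set and a uniqueness theorem. Uniqueness rests on Goursat's theorem: a bound by the values
    on a circle, applied to the function multiplied by high powers of a small quotient, plays the
    role of a Taylor expansion. For membership, [meromorphic] asks for holomorphy or a true pole at
    every point. So the singular term at s = 0 is absorbed through 1 / (a Gamma(a)) = 1 / Gamma(a +
    1), and at s = d the residue must be shown nonzero when y is in the reciprocal lattice. The
    substitution t = e^v, used throughout, turns Mellin integrals into Laplace transforms over a
    half-line with continuous integrands; the splitting at t = 1 becomes the splitting at v = 0. Two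
    facts often quoted come out of the theta identities themselves: the constant of the de
    Moivre-Laplace limit, forced by a self-dual case, and the convergence of the lattice sum, which
    follows from the growth of the theta series as t tends to 0. *)

Section ComplexBridge.
Variable R : realType.
Local Notation C := R[i].
Implicit Types (z w : C).

(** The norm of [R[i]] takes its values in [R[i]], where the order is partial. All estimates are
    moved to the real-valued [normc], where [lra] and the real order lemmas apply. *)
Lemma normr_normc z : `|z| = (normc z)%:C.
Proof. by []. Qed.

Lemma ltc_normc z (e : R) : (`|z| < e%:C) = (normc z < e).
Proof. by rewrite normr_normc ltcR. Qed.

Lemma gt0_complexP (e : C) : 0 < e -> exists2 r : R, 0 < r & e = r%:C.
Proof.
case: e => a b; rewrite ltcE /= => /andP[/eqP -> a0]; by exists a.
Qed.

Lemma normc_ge0 z : 0 <= normc z.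
Proof. by case: z => a b; apply: sqrtr_ge0. Qed.

Lemma normcD z w : normc (z + w) <= normc z + normc w.
Proof. exact: le_normcD. Qed.

Lemma normcNE z : normc (- z) = normc z.
Proof. exact: normcN. Qed.

Lemma normcB z w : normc (z - w) <= normc z + normc w.
Proof. by rewrite -(normcNE w) normcD. Qed.

Lemma normc_distC z w : normc (z - w) = normc (w - z).
Proof. by rewrite -normcNE opprB. Qed.

Lemma normc_real (x : R) : normc x%:C = `|x|.
Proof. by rewrite /= expr0n addr0 sqrtr_sqr. Qed.

Lemma normc_eq0 z : (normc z == 0) = (z == 0).
Proof. by apply/eqP/eqP => [/eq0_normc//|->]; exact: normc0. Qed.

Lemma normc_gt0 z : (0 < normc z) = (z != 0).
Proof. by rewrite lt_neqAle normc_ge0 andbT eq_sym normc_eq0. Qed.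

Lemma normcX z n : normc (z ^+ n) = normc z ^+ n.
Proof.
by elim: n => [|n IH]; rewrite ?expr0 ?normc1// !exprS normcM IH.
Qed.

Lemma normr_Re_le z : `|complex.Re z| <= normc z.
Proof. by have := normc_ge_Re z; rewrite normr_normc lecR. Qed.

Lemma normr_Im_le z : `|complex.Im z| <= normc z.
Proof.
by case: z => a b /=; rewrite -sqrtr_sqr ler_wsqrtr// lerDr sqr_ge0.
Qed.

Lemma normc_le_ReIm z : normc z <= `|complex.Re z| + `|complex.Im z|.
Proof.
case: z => a b /=; rewrite -[leRHS]ger0_norm ?addr_ge0// -sqrtr_sqr ler_wsqrtr//.
rewrite sqrrD !real_normK ?num_real// -addrA [_ *+ 2 + _]addrC addrA lerDl.
by rewrite mulrn_wge0// mulr_ge0.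
Qed.

Lemma normc_sum (I : Type) (r : seq I) (P : pred I) (F : I -> C) :
  normc (\sum_(i <- r | P i) F i) <= \sum_(i <- r | P i) normc (F i).
Proof.
elim/big_ind2 : _ => //; first by rewrite normc0.
by move=> ? ? ? ? h1 h2; rewrite (le_trans (normcD _ _))// lerD.
Qed.

Lemma ReM z w : complex.Re (z * w) =
  complex.Re z * complex.Re w - complex.Im z * complex.Im w.
Proof. by case: z w => [? ?] [? ?]. Qed.

Lemma ImM z w : complex.Im (z * w) =
  complex.Re z * complex.Im w + complex.Im z * complex.Re w.
Proof. by case: z w => [? ?] [? ?]. Qed.

Lemma ReD z w : complex.Re (z + w) = complex.Re z + complex.Re w.
Proof. by case: z w => [? ?] [? ?]. Qed.

Lemma ImD z w : complex.Im (z + w) = complex.Im z + complex.Im w.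
Proof. by case: z w => [? ?] [? ?]. Qed.

Lemma ReN z : complex.Re (- z) = - complex.Re z.
Proof. by case: z. Qed.

Lemma ImN z : complex.Im (- z) = - complex.Im z.
Proof. by case: z. Qed.

Lemma eqC z w : complex.Re z = complex.Re w -> complex.Im z = complex.Im w ->
  z = w.
Proof. by case: z w => [? ?] [? ?] /= -> ->. Qed.

Lemma cvgcP (T : Type) (F : set_system T) (FF : Filter F) (f : T -> C^o) (l : C^o) :
  f @ F --> l <-> forall e : R, 0 < e -> \forall t \near F, normc (l - f t) < e.
Proof.
split=> [/cvgrPdist_lt h e e0|h].
  have /h : 0 < e%:C by rewrite ltcR.
  by apply: filterS => t; rewrite ltc_normc.
apply/cvgrPdist_lt => _ /gt0_complexP[r r0 ->].
by apply: filterS (h r r0) => t; rewrite ltc_normc.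
Qed.

Lemma nbhscP (s : C^o) (P : C -> Prop) :
  (\forall w \near s, P w) <->
  exists2 e : R, 0 < e & forall w, normc (w - s) < e -> P w.
Proof.
split=> [/nbhs_ballP[_ /= /gt0_complexP[r r0 ->]] h|[e e0 h]].
  exists r => // w; rewrite -ltc_normc => ws; apply: h.
  by rewrite -ball_normE /= distrC.
apply/nbhs_ballP; exists e%:C => /=; first by rewrite ltcR.
by move=> w; rewrite -ball_normE /= distrC ltc_normc => /h.
Qed.

Lemma dnbhscP (s : C^o) (P : C -> Prop) :
  (\forall w \near s^', P w) <->
  exists2 e : R, 0 < e & forall w, w != s -> normc (w - s) < e -> P w.
Proof.
rewrite (_ : (\forall w \near s^', P w) <->
  \forall w \near s, w != s -> P w)//.
by rewrite nbhscP; split=> -[e e0 h]; exists e => // w h1 h2; exact: h.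
Qed.

(** Free of division, so that [h = 0] is no exception and remainder estimates can be used as they
    stand. *)
Definition cderiv (f : C -> C) (s l : C) :=
  forall e : R, 0 < e -> exists2 d : R, 0 < d &
    forall h, normc h < d -> normc (f (s + h) - f s - l * h) <= e * normc h.

Lemma slope_subl (l h D : C) : h != 0 ->
  l - h^-1 * D = - h^-1 * (D - l * h).
Proof. by move=> h0; field. Qed.

Lemma derivablecP (f : C^o -> C^o) (s : C^o) :
  derivable f s 1 <-> exists l, cderiv f s l.
Proof.
split.
  move=> /cvg_ex[/= l /cvgcP lP]; exists l => e e0.
  have /dnbhscP[d d0 dP] := lP _ e0.
  exists d => // h hd; have [->|h0] := eqVneq h 0.
    by rewrite addr0 mulr0 subrr subr0 normc0 mulr0.
  have := dP h h0; rewrite subr0 => /(_ hd) /ltW.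
  have -> : l - h^-1 *: (f (h *: 1 + s) - f s) =
      - h^-1 * (f (s + h) - f s - l * h).
    by rewrite [h *: 1]mulr1 (addrC h); exact: slope_subl.
  by rewrite normcM normcNE normcV mulrC ler_pdivrMr// normc_gt0.
move=> [l lP]; apply/cvg_ex; exists l; apply/cvgcP => e e0.
have [d d0 dP] := lP _ (divr_gt0 e0 (ltr0n _ 2)).
apply/dnbhscP; exists d => // h h0; rewrite subr0 => hd.
have -> : l - h^-1 *: (f (h *: 1 + s) - f s) =
      - h^-1 * (f (s + h) - f s - l * h).
  by rewrite [h *: 1]mulr1 (addrC h); exact: slope_subl.
rewrite normcM normcNE normcV mulrC ltr_pdivrMr ?normc_gt0//.
apply: (le_lt_trans (dP _ hd)).
by rewrite ltr_pM2r ?normc_gt0// ltr_pdivrMr// ltr_pMr// ltr1n.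
Qed.

Lemma cderiv_derivable (f : C^o -> C^o) (s : C^o) (l : C) :
  cderiv f s l -> derivable f s 1.
Proof. by move=> h; apply/derivablecP; exists l. Qed.

Lemma derivable_ccontinuous (f : C^o -> C^o) (s : C^o) : derivable f s 1 ->
  forall e : R, 0 < e -> exists2 d : R, 0 < d &
    forall w, normc (w - s) < d -> normc (f w - f s) < e.
Proof.
move=> /derivable1_diffP /differentiable_continuous /cvgcP h e /h /nbhscP.
by move=> [d d0 dP]; exists d => // w /dP; rewrite normc_distC.
Qed.

Lemma derivable_near (f g : C^o -> C^o) (s : C^o) :
  (\forall w \near s, f w = g w) -> derivable f s 1 -> derivable g s 1.
Proof.
move=> fg; apply: near_eq_derivable => //; exact: fg.
Qed.

Lemma derivable_comp_c (f g : C^o -> C^o) (s : C^o) :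
  derivable f s 1 -> derivable g (f s) 1 ->
  derivable ((fun w => g (f w)) : C^o -> C^o) s 1.
Proof.
move=> /derivable1_diffP df /derivable1_diffP dg; apply/derivable1_diffP.
exact (@differentiable_comp _ _ _ _ f g s df dg).
Qed.

Lemma derivableM_c (f g : C^o -> C^o) (s : C^o) :
  derivable f s 1 -> derivable g s 1 ->
  derivable ((fun w => f w * g w) : C^o -> C^o) s 1.
Proof. exact (@derivableM _ _ f g s 1). Qed.

Lemma derivableD_c (f g : C^o -> C^o) (s : C^o) :
  derivable f s 1 -> derivable g s 1 ->
  derivable ((fun w => f w + g w) : C^o -> C^o) s 1.
Proof. exact (@derivableD _ _ _ f g s 1). Qed.

Lemma derivableB_c (f g : C^o -> C^o) (s : C^o) :
  derivable f s 1 -> derivable g s 1 ->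
  derivable ((fun w => f w - g w) : C^o -> C^o) s 1.
Proof. exact (@derivableB _ _ _ f g s 1). Qed.

Lemma derivable_cst_c (c : C) (s : C^o) : derivable ((fun=> c) : C^o -> C^o) s 1.
Proof. exact (@derivable_cst _ _ _ (c : C^o) s 1). Qed.

Lemma derivable_id_c (s : C^o) : derivable ((fun w => w) : C^o -> C^o) s 1.
Proof. exact (@derivable_id _ _ s 1). Qed.

Lemma derivable_inv_c (f : C^o -> C^o) (s : C^o) : f s != 0 ->
  derivable f s 1 -> derivable ((fun w => (f w)^-1) : C^o -> C^o) s 1.
Proof. move=> f0 df; exact (@derivableV _ _ f s 1 f0 df). Qed.

Lemma derivableX_c (f : C^o -> C^o) (n : nat) (s : C^o) : derivable f s 1 ->
  derivable ((fun w => f w ^+ n) : C^o -> C^o) s 1.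
Proof.
move=> df; elim: n => [|n IH]; first exact: derivable_cst_c.
have -> : (fun w => f w ^+ n.+1) = (fun w => f w * f w ^+ n).
  by apply/funext => w; rewrite exprS.
exact: derivableM_c.
Qed.

End ComplexBridge.

(** * Elementary inequalities for the exponential, sine and cosine *)

Section RealBounds.
Variable R : realType.
Implicit Types x y : R.

Lemma mvt (f df : R -> R) (a b : R) : (forall x, is_derive x 1 f (df x)) ->
  a <= b -> exists2 c, c \in `[a, b] & f b - f a = df c * (b - a).
Proof.
move=> fdf ab; apply: MVT_segment => //.
by apply: derivable_within_continuous => x _; have [] := fdf x.
Qed.

Lemma lipschitz_bound (f df : R -> R) (M a b : R) :
  (forall x, is_derive x 1 f (df x)) ->
  (forall x, `|x - a| <= `|b - a| -> `|df x| <= M) ->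
  `|f b - f a| <= M * `|b - a|.
Proof.
move=> fdf.
have key u v : u <= v -> (forall x, u <= x <= v -> `|df x| <= M) ->
    `|f v - f u| <= M * `|v - u|.
  move=> uv dM.
  have [c cuv ->] := mvt fdf uv.
  by rewrite normrM ler_wpM2r// dM//; move: cuv; rewrite in_itv.
case: (leP a b) => [ab|/ltW ba] dM.
  apply: key => // x /andP[ax xb]; apply: dM.
  by rewrite !ger0_norm ?subr_ge0// lerB.
rewrite distrC (distrC b); apply: key => // x /andP[bx xa]; apply: dM.
by rewrite distrC (distrC b) !ger0_norm ?subr_ge0// lerB.
Qed.

Lemma normr_sin_le x : `|sin x| <= `|x|.
Proof.
have := @lipschitz_bound sin cos 1 0 x (fun x => is_derive_sin x).
rewrite sin0 !subr0 mul1r; apply => y _; rewrite ler_norml.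
by rewrite cos_geN1 cos_le1.
Qed.

Lemma onem_cosE x : 1 - cos x = 2 * sin (x / 2) ^+ 2.
Proof.
rewrite {1}(splitr x) cosD -!expr2 cos2sin2; ring.
Qed.

Lemma cos_ge x : 1 - x ^+ 2 / 2 <= cos x.
Proof.
rewrite lerBlDr addrC -lerBlDr onem_cosE.
have := normr_sin_le (x / 2).
rewrite -ler_sqr ?nnegrE// !real_normK ?num_real//; lra.
Qed.

Lemma normr_subr_sin_le x : `|x - sin x| <= x ^+ 2.
Proof.
have := @lipschitz_bound (fun x => x - sin x) (fun x => 1 - cos x) `|x| 0 x.
rewrite sin0 !subr0 -expr2 real_normK ?num_real//; apply => y.
rewrite subr0 => yx; apply: le_trans yx.
rewrite ger0_norm ?subr_ge0 ?cos_le1//.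
(* The crude bound 1 - cos y <= |y| is enough: up to 2 it follows from y^2 / 2 <= |y|, and beyond 2
   from 1 - cos y <= 2. *)
have [y2|y2] := leP `|y| 2.
  have := cos_ge y; rewrite -[y ^+ 2]real_normK ?num_real//.
  by have := normr_ge0 y; nra.
by have := cos_geN1 y; lra.
Qed.

Lemma expR_subr1_le x : expR x - 1 <= x * expR x.
Proof.
have := expR_ge1Dx (- x); rewrite -(ler_pM2r (expR_gt0 x)) -expRD addNr expR0.
lra.
Qed.

Lemma normr_expR_subr1_le x : `|expR x - 1| <= `|x| * expR `|x|.
Proof.
have [x0|/ltW x0] := leP 0 x.
  rewrite (ger0_norm x0) ger0_norm ?expR_subr1_le//.
  by rewrite subr_ge0 -expR0 ler_expR.
rewrite ler0_norm; last by rewrite subr_le0 expR_le1.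
rewrite opprB; apply: (@le_trans _ _ `|x|).
  by have := expR_ge1Dx x; rewrite ler0_norm//; lra.
by rewrite ler_peMr// -expR0 ler_expR.
Qed.

Lemma normr_expR_subr1x_le x : `|expR x - 1 - x| <= x ^+ 2 * expR `|x|.
Proof.
rewrite ger0_norm; last by have := expR_ge1Dx x; lra.
apply: (@le_trans _ _ (x * (expR x - 1))); first by have := expR_subr1_le x; lra.
rewrite (le_trans (ler_norm _))// normrM -[x ^+ 2]real_normK ?num_real// expr2.
by rewrite -mulrA ler_wpM2l// normr_expR_subr1_le.
Qed.

Lemma expR_ge_sqr x : 0 <= x -> x ^+ 2 <= 2 * expR x.
Proof. by move=> x0; have := @expR_ge1Dxn R x 1 x0; rewrite (_ : 2`! = 2%N)//; lra. Qed.

(** The derivative of exp (t^2 / 2) cos t has the sign of t cos t - sin t, which is nonpositive on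
    [0, pi / 2] because sin t - t cos t starts at 0 with derivative t sin t >= 0. This yields the
    Gaussian majorant for the powers of the cosine in Polya's identity. *)
Lemma cos_le_expR x : `|x| <= pi / 2 -> cos x <= expR (- (x ^+ 2 / 2)).
Proof.
wlog x0 : x / 0 <= x => [wl|].
  have [/wl//|/ltW x0 h] := leP 0 x.
  by rewrite -cosN -(sqrrN x); apply: wl; rewrite ?oppr_ge0 ?normrN.
rewrite ger0_norm// => xpi.
have dtc (t : R) : is_derive t 1 (fun t => sin t - t * cos t) (t * sin t).
  by apply: is_derive_eq; rewrite /GRing.scale /=; ring.
have dg (t : R) : is_derive t 1 (fun t => expR (t ^+ 2 / 2) * cos t)
    (expR (t ^+ 2 / 2) * (t * cos t - sin t)).
  by apply: is_derive_eq; rewrite /GRing.scale /=; field.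
have pi0 : (0 : R) < pi := pi_gt0 R.
have tcos (t : R) : 0 <= t -> t <= pi / 2 -> t * cos t <= sin t.
  move=> t0 tpi; rewrite -subr_ge0.
  have [c + +] := mvt dtc t0.
  rewrite in_itv /= sin0 mul0r !subr0 => /andP[c0 ct] ->.
  rewrite !mulr_ge0// sin_ge0_pi// c0 /=; lra.
have [c + +] := mvt dg x0.
rewrite in_itv /= cos0 expr0n /= mul0r expR0 mul1r subr0 => /andP[c0 cx] h.
have : expR (x ^+ 2 / 2) * cos x <= 1.
  rewrite -subr_le0 h mulr_le0_ge0// pmulr_rle0 ?expR_gt0// subr_le0.
  by apply: tcos => //; apply: le_trans cx xpi.
by rewrite expRN -ler_pdivlMl ?expR_gt0// mulr1.
Qed.

Lemma normr_cos_le_expR x : `|x| <= pi / 2 -> `|cos x| <= expR (- (x ^+ 2 / 2)).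
Proof.
move=> h; rewrite ger0_norm; first exact: cos_le_expR.
by apply: cos_ge0_pihalf; rewrite -ler_norml.
Qed.

End RealBounds.

(** * The complex exponential and complex powers *)

Section ComplexExp.
Variable R : realType.
Local Notation C := R[i].
Implicit Types (z w : C).

Lemma cexp0 : cexp 0 = 1 :> C.
Proof.
by rewrite /cexp /= expR0 cos0 sin0 mul1r.
Qed.

Lemma cexpD z w : cexp (z + w) = cexp z * cexp w.
Proof.
rewrite /cexp ReD ImD expRD cosD sinD rmorphM /= mulrACA; congr (_ * _).
by apply: eqC; rewrite ?ReM ?ImM /= // addrC (mulrC (cos _)).
Qed.

Lemma normc_cexp z : normc (cexp z) = expR (complex.Re z).
Proof.
rewrite /cexp normcM normc_real ger0_norm ?expR_ge0//.
by rewrite /normc cos2Dsin2 sqrtr1 mulr1.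
Qed.

Lemma cexp_neq0 z : cexp z != 0.
Proof. by rewrite -normc_eq0 normc_cexp gt_eqF// expR_gt0. Qed.

Lemma cexpN z : cexp (- z) = (cexp z)^-1.
Proof.
by apply: (mulfI (cexp_neq0 z)); rewrite -cexpD subrr cexp0 divff// cexp_neq0.
Qed.

Lemma cexp_real (x : R) : cexp x%:C = (expR x)%:C.
Proof. by rewrite /cexp /= cos0 sin0 mulr1. Qed.

(** Real and imaginary part of the remainder decompose into products of one-variable remainders. The
    bound is explicit in [z] because it is used twice: for the derivative of [cexp], and under the
    integral sign in [derivable_laplace]. *)
Lemma normc_cexp_sub1x z :
  normc (cexp z - 1 - z) <= 2 * normc z ^+ 2 * expR (normc z).
Proof.
case: z => x y; set E := expR _.
have n2 : normc (x +i* y) ^+ 2 = x ^+ 2 + y ^+ 2.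
  by rewrite /= sqr_sqrtr// addr_ge0 ?sqr_ge0.
have hx : `|x| <= normc (x +i* y) := normr_Re_le (x +i* y).
have E1 : 1 <= E by rewrite -expR0 ler_expR normc_ge0.
have Ex : expR `|x| <= E by rewrite ler_expR.
have -> : cexp (x +i* y) - 1 - (x +i* y) =
   ((expR x - 1 - x) * cos y - (1 + x) * (1 - cos y)) +i*
   ((expR x - 1) * sin y - (y - sin y)).
  by apply: eqC; rewrite /cexp /=; ring.
apply: (le_trans (normc_le_ReIm _)) => /=.
have a1 : `|(expR x - 1 - x) * cos y| <= x ^+ 2 * E.
  rewrite normrM; apply: (@le_trans _ _ (x ^+ 2 * expR `|x| * 1)).
    by apply: ler_pM => //; [exact: normr_expR_subr1x_le|exact: cos_max].
  by rewrite mulr1 ler_wpM2l// sqr_ge0.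
have a2 : `|(1 + x) * (1 - cos y)| <= E * (y ^+ 2 / 2).
  rewrite normrM; apply: ler_pM => //.
    apply: (le_trans (ler_normD _ _)); rewrite normr1 (le_trans _ Ex)//.
    exact: expR_ge1Dx.
  by rewrite ger0_norm ?subr_ge0 ?cos_le1//; have := cos_ge y; lra.
have a3 : `|(expR x - 1) * sin y| <= (x ^+ 2 + y ^+ 2) / 2 * E.
  rewrite normrM.
  apply: (@le_trans _ _ (`|x| * expR `|x| * `|y|)).
    by apply: ler_pM => //; [exact: normr_expR_subr1_le|exact: normr_sin_le].
  rewrite mulrAC; apply: ler_pM; rewrite ?mulr_ge0 ?expR_ge0//.
  rewrite -(@real_normK _ x) ?num_real// -(@real_normK _ y) ?num_real//.
  by have := sqr_ge0 (`|x| - `|y|); lra.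
have a4 := normr_subr_sin_le y.
have a5 : y ^+ 2 <= y ^+ 2 * E by rewrite ler_peMr// sqr_ge0.
apply: (@le_trans _ _ (2 * (x ^+ 2 + y ^+ 2) * E)).
  apply: (le_trans (lerD (ler_normB _ _) (ler_normB _ _))).
  have : 0 <= x ^+ 2 * E by rewrite mulr_ge0 ?sqr_ge0// expR_ge0.
  have : 0 <= y ^+ 2 * E by rewrite mulr_ge0 ?sqr_ge0// expR_ge0.
  lra.
by rewrite n2.
Qed.

Lemma cderiv_cexp z : cderiv (@cexp R) z (cexp z).
Proof.
move=> e e0; pose K := 2 * expR 1 * normc (cexp z).
have K0 : 0 < K by rewrite !mulr_gt0 ?expR_gt0// normc_gt0 cexp_neq0.
exists (Num.min 1 (e / K)); first by rewrite lt_min ltr01 divr_gt0.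
move=> h; rewrite lt_min => /andP[h1 he].
have -> : cexp (z + h) - cexp z - cexp z * h = cexp z * (cexp h - 1 - h).
  by rewrite cexpD; ring.
rewrite normcM.
apply: (@le_trans _ _ (normc (cexp z) * (2 * normc h ^+ 2 * expR 1))).
  rewrite ler_wpM2l ?normc_ge0//; apply: (le_trans (normc_cexp_sub1x h)).
  apply: ler_wpM2l; last by rewrite ler_expR ltW.
  by rewrite mulr_ge0// sqr_ge0.
have -> : normc (cexp z) * (2 * normc h ^+ 2 * expR 1) = (normc h * K) * normc h.
  by rewrite /K; ring.
by rewrite ler_wpM2r ?normc_ge0// -ler_pdivlMr// ltW.
Qed.

Lemma derivable_cexp (s : C^o) : derivable (@cexp R : C^o -> C^o) s 1.
Proof. exact: cderiv_derivable (cderiv_cexp s). Qed.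

Lemma cpow_neq0 (a : R) s : cpow a s != 0.
Proof. exact: cexp_neq0. Qed.

Lemma cpowD (a : R) s t : cpow a (s + t) = cpow a s * cpow a t.
Proof. by rewrite /cpow mulrDl cexpD. Qed.

Lemma cpowN (a : R) s : cpow a (- s) = (cpow a s)^-1.
Proof. by rewrite /cpow mulNr cexpN. Qed.

Lemma derivable_cpow (a : R) (s : C^o) : derivable (cpow a : C^o -> C^o) s 1.
Proof.
apply: (@derivable_comp_c _ (fun s : C^o => s * (ln a)%:C) (@cexp R)).
  by apply: derivableM_c; [exact: derivable_id_c|exact: derivable_cst_c].
exact: derivable_cexp.
Qed.

Lemma normc_cpow (a : R) s : normc (cpow a s) = expR (complex.Re s * ln a).
Proof. by rewrite /cpow normc_cexp ReM /= mulr0 subr0. Qed.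

(* Locked: otherwise rewriting with the lemmas on products unfolds [cis]. *)
Fact cis_key : unit. Proof. exact: tt. Qed.
Definition cis (t : R) : C := locked_with cis_key (cexp (0 +i* t)).

Lemma cis_cexp t : cis t = cexp (0 +i* t).
Proof. by rewrite /cis unlock. Qed.

Lemma cisE t : cis t = cos t +i* sin t.
Proof. by rewrite cis_cexp /cexp /= expR0 mul1r. Qed.

Lemma cisD t u : cis (t + u) = cis t * cis u.
Proof. by rewrite !cis_cexp -cexpD; congr cexp; apply: eqC; rewrite /= ?addr0. Qed.

Lemma cis0 : cis 0 = 1.
Proof. by rewrite cis_cexp cexp0. Qed.

Lemma cisN t : cis (- t) = (cis t)^-1.
Proof. by rewrite !cis_cexp -cexpN; congr cexp; apply: eqC; rewrite /= ?oppr0. Qed.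

Lemma cis_neq0 t : cis t != 0.
Proof. by rewrite cis_cexp cexp_neq0. Qed.

Lemma normc_cis t : normc (cis t) = 1.
Proof. by rewrite cis_cexp normc_cexp expR0. Qed.

Lemma cis2pi_int (n : int) : cis (2 * pi * n%:~R) = 1.
Proof.
have h (k : nat) : cis (2 * pi * k%:R) = 1.
  elim: k => [|k IH]; first by rewrite mulr0 cis0.
  rewrite -[k.+1%:R]natr1 mulrDr cisD IH mulr1 mul1r cisE.
    by rewrite mulr_natl cos2pi sin2pi.
case: n => k; first exact: h.
by rewrite NegzE mulrNz mulrN cisN h invr1.
Qed.

Lemma cexp_cis z : cexp z = (expR (complex.Re z))%:C * cis (complex.Im z).
Proof. by rewrite cisE. Qed.

End ComplexExp.

(** * Complex-valued integrals *)

Section ComplexIntegral.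
Variable R : realType.
Local Notation C := R[i].
Local Notation mu := (@lebesgue_measure R).
Implicit Types (D E : set (measurableTypeR R)) (f g : R -> C).

Definition cintegrable D f :=
  mu.-integrable D (EFin \o (fun t => complex.Re (f t))) /\
  mu.-integrable D (EFin \o (fun t => complex.Im (f t))).

Definition cint D f : C :=
  (\int[mu]_(t in D) complex.Re (f t)) +i* (\int[mu]_(t in D) complex.Im (f t)).

Lemma eq_cint D f g : (forall t, D t -> f t = g t) -> cint D f = cint D g.
Proof.
by move=> fg; apply: eqC => /=; apply: eq_Rintegral => t; rewrite inE => /fg ->.
Qed.

Lemma eq_cintegrable D f g : measurable D -> (forall t, D t -> f t = g t) ->
  cintegrable D f -> cintegrable D g.
Proof.
move=> mD fg [h1 h2]; split.
  by apply: eq_integrable h1 => // t; rewrite inE /= => /fg ->.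
by apply: eq_integrable h2 => // t; rewrite inE /= => /fg ->.
Qed.

Lemma RintegrableZl D (k : R) (f : R -> R) : measurable D ->
  mu.-integrable D (EFin \o f) -> mu.-integrable D (EFin \o (fun t => k * f t)).
Proof. by move=> mD h; exact: (integrableZl mD k h). Qed.

Lemma RintegrableD D (f g : R -> R) : measurable D ->
  mu.-integrable D (EFin \o f) -> mu.-integrable D (EFin \o g) ->
  mu.-integrable D (EFin \o (fun t => f t + g t)).
Proof. by move=> mD h1 h2; exact: (integrableD mD h1 h2). Qed.

Lemma RintegrableB D (f g : R -> R) : measurable D ->
  mu.-integrable D (EFin \o f) -> mu.-integrable D (EFin \o g) ->
  mu.-integrable D (EFin \o (fun t => f t - g t)).
Proof. by move=> mD h1 h2; exact: (integrableB mD h1 h2). Qed.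

Lemma cintegrableD D f g : measurable D -> cintegrable D f -> cintegrable D g ->
  cintegrable D (fun t => f t + g t).
Proof.
move=> mD [f1 f2] [g1 g2]; split.
  by move: (RintegrableD mD f1 g1); apply: eq_integrable => // t _; rewrite /= ReD.
by move: (RintegrableD mD f2 g2); apply: eq_integrable => // t _; rewrite /= ImD.
Qed.

Lemma cintegrableZ D (c : C) f : measurable D -> cintegrable D f ->
  cintegrable D (fun t => c * f t).
Proof.
move=> mD [f1 f2]; split.
  move: (RintegrableB mD (RintegrableZl (complex.Re c) mD f1)
    (RintegrableZl (complex.Im c) mD f2)).
  by apply: eq_integrable => // t _; rewrite /= ReM.
move: (RintegrableD mD (RintegrableZl (complex.Re c) mD f2)
    (RintegrableZl (complex.Im c) mD f1)).
by apply: eq_integrable => // t _; rewrite /= ImM.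
Qed.

Lemma cintD D f g : measurable D -> cintegrable D f -> cintegrable D g ->
  cint D (fun t => f t + g t) = cint D f + cint D g.
Proof.
move=> mD [f1 f2] [g1 g2]; apply: eqC; rewrite ?ReD ?ImD /= -RintegralD//.
  by apply: eq_Rintegral => t _; rewrite ReD.
by apply: eq_Rintegral => t _; rewrite ImD.
Qed.

Lemma cintZ D (c : C) f : measurable D -> cintegrable D f ->
  cint D (fun t => c * f t) = c * cint D f.
Proof.
move=> mD [f1 f2]; apply: eqC; rewrite ?ReM ?ImM /= -!RintegralZl//.
  rewrite -RintegralB//; try exact: RintegrableZl.
  by apply: eq_Rintegral => t _; rewrite ReM.
rewrite -RintegralD//; try exact: RintegrableZl.
by apply: eq_Rintegral => t _; rewrite ImM.
Qed.

Lemma cintegrableB D f g : measurable D -> cintegrable D f -> cintegrable D g ->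
  cintegrable D (fun t => f t - g t).
Proof.
move=> mD f1 /(cintegrableZ (-1) mD) g1; move: (cintegrableD mD f1 g1).
by apply: eq_cintegrable => // t _; rewrite mulN1r.
Qed.

Lemma cintB D f g : measurable D -> cintegrable D f -> cintegrable D g ->
  cint D (fun t => f t - g t) = cint D f - cint D g.
Proof.
move=> mD f1 g1; rewrite -mulN1r -cintZ// -cintD//; last exact: cintegrableZ.
by apply: eq_cint => t _; rewrite mulN1r.
Qed.

Lemma cintegrable0 D : measurable D -> cintegrable D (fun=> 0).
Proof. by move=> mD; split; apply: integrable0. Qed.

Lemma cintegrable_sum (I : Type) (r : seq I) D (F : I -> R -> C) : measurable D ->
  (forall i, cintegrable D (F i)) -> cintegrable D (fun t => \sum_(i <- r) F i t).
Proof.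
move=> mD h; elim: r => [|i r IH].
  by apply: eq_cintegrable (cintegrable0 mD) => // t _; rewrite big_nil.
apply: eq_cintegrable (cintegrableD mD (h i) IH) => // t _.
by rewrite big_cons.
Qed.

Lemma cint_sum (I : Type) (r : seq I) D (F : I -> R -> C) : measurable D ->
  (forall i, cintegrable D (F i)) ->
  cint D (fun t => \sum_(i <- r) F i t) = \sum_(i <- r) cint D (F i).
Proof.
move=> mD h; elim: r => [|i r IH].
  rewrite big_nil; apply: eqC => /=; rewrite -[RHS](Rintegral_set0 mu (fun=> 0)).
    rewrite Rintegral_set0 -[RHS](mul0r (fine (mu D))) -Rintegral_cst//.
    by apply: eq_Rintegral => t _; rewrite big_nil.
  rewrite Rintegral_set0 -[RHS](mul0r (fine (mu D))) -Rintegral_cst//.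
  by apply: eq_Rintegral => t _; rewrite big_nil.
rewrite big_cons -IH -cintD//; last exact: cintegrable_sum.
by apply: eq_cint => t _; rewrite big_cons.
Qed.

Lemma cintegrable_le D f (g : R -> R) : measurable D ->
  measurable_fun D (fun t : measurableTypeR R => complex.Re (f t)) ->
  measurable_fun D (fun t : measurableTypeR R => complex.Im (f t)) ->
  mu.-integrable D (EFin \o g) -> (forall t, D t -> normc (f t) <= g t) ->
  cintegrable D f.
Proof.
move=> mD m1 m2 ig fg; split.
  apply: (le_integrable mD _ _ ig); first exact/measurable_EFinP.
  move=> t /fg h /=; rewrite lee_fin (le_trans (normr_Re_le _))//.
  exact: le_trans (ler_norm _).
apply: (le_integrable mD _ _ ig); first exact/measurable_EFinP.
move=> t /fg h /=; rewrite lee_fin (le_trans (normr_Im_le _))//.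
exact: le_trans (ler_norm _).
Qed.

(** The factor 2 is the price of estimating real and imaginary part separately; every use below
    tolerates a constant factor. *)
Lemma normc_cint_le D f (g : R -> R) : measurable D -> cintegrable D f ->
  mu.-integrable D (EFin \o g) -> (forall t, D t -> normc (f t) <= g t) ->
  normc (cint D f) <= 2 * \int[mu]_(t in D) g t.
Proof.
move=> mD [f1 f2] ig fg; apply: (le_trans (normc_le_ReIm _)) => /=.
have key (u : R -> R) : mu.-integrable D (EFin \o u) ->
    (forall t, D t -> `|u t| <= g t) ->
    `|\int[mu]_(t in D) u t| <= \int[mu]_(t in D) g t.
  move=> iu ug; apply: (le_trans (le_normr_Rintegral mD iu)).
  apply: le_Rintegral => //; exact: integrable_norm.
rewrite mulr_natl mulr2n; apply: lerD; apply: key => // t /fg.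
  exact: le_trans (normr_Re_le _).
exact: le_trans (normr_Im_le _).
Qed.

Lemma cint_itv_split (a b c : R) f : a <= c -> c <= b ->
  cintegrable `[a, b] f ->
  cint `[a, b] f = cint `[a, c] f + cint `[c, b] f.
Proof.
move=> ac cb [f1 f2].
have h (u : R -> R) : mu.-integrable `[a, b] (EFin \o u) ->
   \int[mu]_(t in `[a, b]) u t =
   \int[mu]_(t in `[a, c]) u t + \int[mu]_(t in `[c, b]) u t.
  move=> iu; have := @Rintegral_itvB R u (BLeft a) (BRight b) c iu.
  rewrite !bnd_simp => /(_ ac cb) => h.
  rewrite -(@Rintegral_itv_obnd_cbnd R c (BRight b)) -?h; first by rewrite addrC subrK.
  apply: integrableS iu => //; apply: subset_itvr; rewrite bnd_simp; exact: ac.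
by apply: eqC => /=; apply: h.
Qed.

Definition rcontinuous_at f (t : R) :=
  forall e : R, 0 < e -> exists2 d : R, 0 < d &
    forall u, `|u - t| < d -> normc (f u - f t) < e.

Lemma rcontinuous_ReIm f t : rcontinuous_at f t ->
  {for t, continuous (fun t => complex.Re (f t))} /\
  {for t, continuous (fun t => complex.Im (f t))}.
Proof.
move=> h; split; apply/cvgrPdist_lt => e e0; have [d d0 dP] := h e e0;
  (apply/nbhs_ballP; exists d => //= u; rewrite /ball /= distrC => /dP;
  rewrite normc_distC; apply: le_lt_trans).
  by rewrite (le_trans _ (normr_Re_le _))// ReD ReN.
by rewrite (le_trans _ (normr_Im_le _))// ImD ImN.
Qed.

Lemma cintegrable_itv (a b : R) f : (forall t, a <= t <= b -> rcontinuous_at f t) ->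
  cintegrable `[a, b] f.
Proof.
move=> h; split; apply: continuous_compact_integrable => //;
  (try exact: segment_compact); apply: continuous_in_subspaceT => t;
  rewrite inE /= in_itv /= => /h /rcontinuous_ReIm[]//.
Qed.

Lemma normc_cint_itv_le (a b M : R) f : a <= b ->
  (forall t, a <= t <= b -> rcontinuous_at f t) ->
  (forall t, a <= t <= b -> normc (f t) <= M) ->
  normc (cint `[a, b] f) <= 2 * M * (b - a).
Proof.
move=> ab cf fM.
have -> : 2 * M * (b - a) = 2 * \int[mu]_(t in `[a, b]) M.
  rewrite Rintegral_cst//= lebesgue_measure_itv /= lte_fin.
  case: ltP => [_|ba]; first by rewrite -EFinB /= mulrA.
  by have -> : a = b; [apply/le_anti; rewrite ab|rewrite subrr !mulr0].
apply: normc_cint_le => //; first exact: cintegrable_itv.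
  apply: continuous_compact_integrable; first exact: segment_compact.
  by apply: continuous_subspaceT => t; exact: cvg_cst.
Qed.

Lemma Rintegral_FTC (F f : R -> R) (a b : R) : a <= b ->
  (forall x : R, is_derive x 1 F (f x)) -> continuous f ->
  \int[mu]_(t in `[a, b]) f t = F b - F a.
Proof.
rewrite le_eqVlt => /predU1P[->|ab] dF cf.
  by rewrite set_itv1 Rintegral_set1 subrr.
have cF : continuous F.
  move=> x; apply/differentiable_continuous/derivable1_diffP.
  by have [] := dF x.
rewrite /Rintegral (@continuous_FTC2 _ f F)//.
- exact: continuous_subspaceT.
- split; first by move=> x _; have [] := dF x.
  + by apply: cvg_at_right_filter; exact: cF.
  + by apply: cvg_at_left_filter; exact: cF.
- by move=> x _; rewrite derive1E; have [] := dF x.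
Qed.

Lemma cint_FTC (F f : R -> C) (a b : R) : a <= b ->
  (forall x : R, is_derive x 1 (fun t => complex.Re (F t)) (complex.Re (f x))) ->
  (forall x : R, is_derive x 1 (fun t => complex.Im (F t)) (complex.Im (f x))) ->
  (forall t, rcontinuous_at f t) ->
  cint `[a, b] f = F b - F a.
Proof.
move=> ab d1 d2 cf; apply: eqC; rewrite ?ReD ?ReN ?ImD ?ImN /=.
  by apply: Rintegral_FTC => // t; have [] := rcontinuous_ReIm (cf t).
by apply: Rintegral_FTC => // t; have [] := rcontinuous_ReIm (cf t).
Qed.

Lemma Rintegral_dominated D (f_ : nat -> R -> R) (f g : R -> R) : measurable D ->
  (forall n, measurable_fun D (f_ n : measurableTypeR R -> R)) ->
  (forall t, D t -> f_ ^~ t @ \oo --> f t) ->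
  mu.-integrable D (EFin \o g) -> (forall n t, D t -> `|f_ n t| <= g t) ->
  mu.-integrable D (EFin \o f) /\
  (fun n => \int[mu]_(t in D) f_ n t) @ \oo --> \int[mu]_(t in D) f t.
Proof.
move=> mD mf ff ig fg.
have mff : measurable_fun D (f : measurableTypeR R -> R).
  by apply: (measurable_fun_cvg mf) => t; exact: ff.
have [] := @dominated_convergence _ _ R mu D mD (fun n => EFin \o f_ n)
  (EFin \o f) (EFin \o g).
- by move=> n; apply/measurable_EFinP.
- exact/measurable_EFinP.
- by apply: aeW => t Dt; apply: cvg_EFin; [exact: nearW|exact: ff].
- exact: ig.
- by apply: aeW => t n Dt /=; rewrite lee_fin; exact: fg.
move=> i1 _ h; split=> //.
have fin : (\int[mu]_(x in D) (EFin \o f) x)%E =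
    (fine (\int[mu]_(x in D) (EFin \o f) x))%:E.
  by rewrite fineK//; exact: integrable_fin_num.
by move: h; rewrite fin => /fine_cvgP[_].
Qed.

Lemma cint_dominated D (f_ : nat -> R -> C) (f : R -> C) (g : R -> R) :
  measurable D ->
  (forall n, measurable_fun D (fun t : measurableTypeR R => complex.Re (f_ n t))) ->
  (forall n, measurable_fun D (fun t : measurableTypeR R => complex.Im (f_ n t))) ->
  (forall t, D t -> forall e : R, 0 < e ->
     \forall n \near \oo, normc (f t - f_ n t) < e) ->
  mu.-integrable D (EFin \o g) -> (forall n t, D t -> normc (f_ n t) <= g t) ->
  cintegrable D f /\
  forall e : R, 0 < e -> \forall n \near \oo, normc (cint D f - cint D (f_ n)) < e.
Proof.
move=> mD m1 m2 ff ig fg.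
have [i1 c1] : mu.-integrable D (EFin \o (fun t => complex.Re (f t))) /\
  (fun n => \int[mu]_(t in D) complex.Re (f_ n t)) @ \oo -->
    \int[mu]_(t in D) complex.Re (f t).
  apply: (Rintegral_dominated mD m1 _ ig).
    move=> t Dt; apply/cvgrPdist_lt => e e0; have := ff t Dt e e0.
    apply: filterS => n; apply: le_lt_trans.
    by rewrite (le_trans _ (normr_Re_le _))// ReD ReN.
  by move=> n t Dt; apply: le_trans (fg n t Dt); exact: normr_Re_le.
have [i2 c2] : mu.-integrable D (EFin \o (fun t => complex.Im (f t))) /\
  (fun n => \int[mu]_(t in D) complex.Im (f_ n t)) @ \oo -->
    \int[mu]_(t in D) complex.Im (f t).
  apply: (Rintegral_dominated mD m2 _ ig).
    move=> t Dt; apply/cvgrPdist_lt => e e0; have := ff t Dt e e0.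
    apply: filterS => n; apply: le_lt_trans.
    by rewrite (le_trans _ (normr_Im_le _))// ImD ImN.
  by move=> n t Dt; apply: le_trans (fg n t Dt); exact: normr_Im_le.
split=> // e e0; have e2 : 0 < e / 2 by rewrite divr_gt0.
move/cvgrPdist_lt : c1 => /(_ _ e2) h1; move/cvgrPdist_lt : c2 => /(_ _ e2) h2.
near=> n; apply: (le_lt_trans (normc_le_ReIm _)).
rewrite (splitr e) ReD ImD ReN ImN ltrD//=; first by near: n.
by near: n.
Unshelve. all: by end_near. Qed.

End ComplexIntegral.

(** * Goursat's theorem *)

Section Goursat.
Variable R : realType.
Local Notation C := R[i].
Implicit Types (f g : C^o -> C^o) (a b c d : R).

(** The counterclockwise contour integral along the boundary: bottom minus top, plus ['i] times
    right minus left. *)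
Definition rect_int f a b c d : C :=
  (cint `[a, b] (fun t => f (t +i* c)) - cint `[a, b] (fun t => f (t +i* d))) +
  'i * (cint `[c, d] (fun t => f (b +i* t)) - cint `[c, d] (fun t => f (a +i* t))).

Definition in_rect a b c d (z : C) :=
  (a <= complex.Re z <= b) && (c <= complex.Im z <= d).

Definition hol_rect f a b c d :=
  forall z : C^o, in_rect a b c d z -> derivable f z 1.

Lemma hol_rectS f a b c d a' b' c' d' : a <= a' -> b' <= b -> c <= c' ->
  d' <= d -> hol_rect f a b c d -> hol_rect f a' b' c' d'.
Proof.
move=> h1 h2 h3 h4 hf z /andP[/andP[z1 z2] /andP[z3 z4]]; apply: hf.
by rewrite /in_rect (le_trans h1)// (le_trans z2)// (le_trans h3)//= (le_trans z4).
Qed.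

Lemma normc_hline (t u c : R) : normc ((u +i* c) - (t +i* c) : C) = `|u - t|.
Proof.
rewrite -normc_real; congr normc.
by apply: eqC; rewrite ?ReD ?ImD ?ReN ?ImN //= subrr.
Qed.

Lemma normc_vline (t u c : R) : normc ((c +i* u) - (c +i* t) : C) = `|u - t|.
Proof.
have -> : (c +i* u) - (c +i* t) = 'i * (u - t)%:C :> C.
  by apply: eqC; rewrite ?ReD ?ImD ?ReN ?ImN ?ReM ?ImM /=; ring.
by rewrite normcM normc_real /= expr0n expr1n add0r sqrtr1 mul1r.
Qed.

Lemma rcontinuous_hline f c t : derivable f (t +i* c : C^o) 1 ->
  rcontinuous_at (fun t => f (t +i* c)) t.
Proof.
move=> /derivable_ccontinuous h e /h [d d0 dP]; exists d => // u ut.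
by apply: dP; rewrite normc_hline.
Qed.

Lemma rcontinuous_vline f c t : derivable f (c +i* t : C^o) 1 ->
  rcontinuous_at (fun t => f (c +i* t)) t.
Proof.
move=> /derivable_ccontinuous h e /h [d d0 dP]; exists d => // u ut.
by apply: dP; rewrite normc_vline.
Qed.

Lemma cint_hline f a b c d y : hol_rect f a b c d -> c <= y <= d ->
  cintegrable `[a, b] (fun t => f (t +i* y)).
Proof.
move=> hf cyd; apply: cintegrable_itv => t tab.
by apply: rcontinuous_hline; apply: hf; rewrite /in_rect /= tab.
Qed.

Lemma cint_vline f a b c d x : hol_rect f a b c d -> a <= x <= b ->
  cintegrable `[c, d] (fun t => f (x +i* t)).
Proof.
move=> hf axb; apply: cintegrable_itv => t tcd.
by apply: rcontinuous_vline; apply: hf; rewrite /in_rect /= axb.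
Qed.

Lemma rect_int_splitx f a b c d m : hol_rect f a b c d -> a <= m -> m <= b ->
  c <= d -> rect_int f a b c d = rect_int f a m c d + rect_int f m b c d.
Proof.
move=> hf am mb cd; rewrite /rect_int.
rewrite (cint_itv_split am mb (cint_hline hf _)) ?lexx//.
rewrite (cint_itv_split am mb (cint_hline hf _)) ?lexx ?cd//.
ring.
Qed.

Lemma rect_int_splity f a b c d m : hol_rect f a b c d -> c <= m -> m <= d ->
  a <= b -> rect_int f a b c d = rect_int f a b c m + rect_int f a b m d.
Proof.
move=> hf cm md ab; rewrite /rect_int.
rewrite (cint_itv_split cm md (cint_vline hf _)) ?lexx ?ab//.
rewrite (cint_itv_split cm md (cint_vline hf _)) ?lexx ?ab//.
ring.
Qed.

Lemma cint_cst a b (k : C) : a <= b -> cint `[a, b] (fun=> k) = k * (b - a)%:C.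
Proof.
move=> ab; have h (u : R) : \int[@lebesgue_measure R]_(t in `[a, b]) u = u * (b - a).
  rewrite Rintegral_cst//= lebesgue_measure_itv /= lte_fin.
  case: ltP => [_|ba]; first by rewrite -EFinB.
  by have -> : a = b; [apply/le_anti; rewrite ab|rewrite subrr !mulr0].
by apply: eqC; rewrite ?ReM ?ImM /= h; ring.
Qed.

Lemma rcontinuous_real (t : R) : rcontinuous_at (fun t : R => t%:C) t.
Proof.
by move=> e e0; exists e => // u; rewrite -rmorphB normc_real.
Qed.

Lemma cintegrable_cst a b (k : C) : cintegrable `[a, b] (fun=> k).
Proof.
apply: cintegrable_itv => t _ e e0; exists 1 => // u _.
by rewrite subrr normc0.
Qed.

Lemma cint_id a b : a <= b -> 
  cint `[a, b] (fun t : R => t%:C) = ((b ^+ 2 - a ^+ 2) / 2)%:C.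
Proof.
have d1 (x : R) : is_derive x 1 (fun t : R => t ^+ 2 / 2) x.
  by apply: is_derive_eq; rewrite /GRing.scale /=; field.
have d2 (x : R) : is_derive x 1 (fun=> 0 : R) (0 : R) by exact: is_derive_cst.
move=> ab; rewrite (@cint_FTC R (fun t => (t ^+ 2 / 2)%:C) (fun t => t%:C)
  a b ab d1 d2 rcontinuous_real).
by rewrite -rmorphB; congr _%:C; ring.
Qed.

Lemma cint_affine a b (k l : C) : a <= b ->
  cint `[a, b] (fun t => k + l * t%:C) =
  k * (b - a)%:C + l * ((b ^+ 2 - a ^+ 2) / 2)%:C.
Proof.
move=> ab; have h : cintegrable `[a, b] (fun t : R => t%:C).
  by apply: cintegrable_itv => t _; exact: rcontinuous_real.
rewrite cintD ?cintZ ?cint_cst ?cint_id//; first exact: cintegrable_cst.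
exact: cintegrableZ.
Qed.

Lemma rect_int_affine a b c d (k l : C) : a <= b -> c <= d ->
  rect_int (fun z => k + l * z) a b c d = 0.
Proof.
move=> ab cd; rewrite /rect_int.
have hx y : cint `[a, b] (fun t => k + l * (t +i* y)) =
    (k + l * 'i * y%:C) * (b - a)%:C + l * ((b ^+ 2 - a ^+ 2) / 2)%:C.
  rewrite -cint_affine//; apply: eq_cint => t _.
  by apply: eqC; rewrite ?ReD ?ImD ?ReM ?ImM /=; ring.
have hy x : cint `[c, d] (fun t => k + l * (x +i* t)) =
    (k + l * x%:C) * (d - c)%:C + (l * 'i) * ((d ^+ 2 - c ^+ 2) / 2)%:C.
  rewrite -cint_affine//; apply: eq_cint => t _.
  by apply: eqC; rewrite ?ReD ?ImD ?ReM ?ImM /=; ring.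
rewrite !hx !hy; set u := ((b ^+ 2 - a ^+ 2) / 2)%:C; set v := (_ / 2)%:C.
by rewrite !rmorphB /=; ring.
Qed.

(** Subtracting the affine function with value [f p] and slope [l] at [p] does not change the
    integral, by [rect_int_affine]. The remainder is at most [e * L] on the rectangle, where [L] is
    the sum of the two side lengths. The constant 4 collects two parallel sides and the factor 2 of
    [normc_cint_itv_le]. *)
Lemma rect_int_small f a b c d (p : C^o) (e : R) : a <= b -> c <= d ->
  in_rect a b c d p -> 0 <= e -> hol_rect f a b c d ->
  forall l : C, (forall h, in_rect a b c d (p + h) ->
    normc (f (p + h) - f p - l * h) <= e * normc h) ->
  normc (rect_int f a b c d) <= 4 * e * ((b - a) + (d - c)) ^+ 2.
Proof.
move=> ab cd pin e0 hf l lP; set L := (b - a) + (d - c).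
pose q (z : C^o) : C^o := (f p - l * p) + l * z.
pose r (z : C^o) : C^o := f z - q z.
have hq : hol_rect q a b c d.
  move=> z _; apply: derivableD_c; first exact: derivable_cst_c.
  by apply: derivableM_c; [exact: derivable_cst_c|exact: derivable_id_c].
have hr : hol_rect r a b c d by move=> z zin; apply: derivableB_c; [exact: hf|exact: hq].
have L0 : 0 <= L by rewrite addr_ge0 ?subr_ge0.
have rb z : in_rect a b c d z -> normc (r z) <= e * L.
  move=> zin; have zE : z = p + (z - p) by rewrite addrC subrK.
  have := lP (z - p); rewrite -zE => /(_ zin).
  have -> : f z - f p - l * (z - p) = r z by rewrite /r /q; ring.
  move=> /le_trans; apply; apply: ler_wpM2l => //.
  apply: (le_trans (normc_le_ReIm _)); rewrite ReD ReN ImD ImN.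
  move: zin pin => /andP[/andP[? ?] /andP[? ?]] /andP[/andP[? ?] /andP[? ?]].
  by apply: lerD; rewrite ler_norml; apply/andP; split; lra.
have -> : rect_int f a b c d = rect_int r a b c d.
  have split_ (F : R -> C -> C^o) (x u v : R) : 
      cintegrable `[u, v] (fun t => q (F x t%:C)) ->
      cintegrable `[u, v] (fun t => r (F x t%:C)) ->
      cint `[u, v] (fun t => f (F x t%:C)) =
      cint `[u, v] (fun t => q (F x t%:C)) + cint `[u, v] (fun t => r (F x t%:C)).
    move=> i1 i2; rewrite -cintD//; apply: eq_cint => t _.
    by rewrite /r addrC subrK.
  have sx y : c <= y <= d -> cint `[a, b] (fun t => f (t +i* y)) =
      cint `[a, b] (fun t => q (t +i* y)) + cint `[a, b] (fun t => r (t +i* y)).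
    move=> yin; apply: (split_ (fun y z => complex.Re z +i* y)).
      exact: cint_hline hq yin.
    exact: cint_hline hr yin.
  have sy x : a <= x <= b -> cint `[c, d] (fun t => f (x +i* t)) =
      cint `[c, d] (fun t => q (x +i* t)) + cint `[c, d] (fun t => r (x +i* t)).
    move=> xin; apply: (split_ (fun x z => x +i* complex.Re z)).
      exact: cint_vline hq xin.
    exact: cint_vline hr xin.
  have := rect_int_affine (f p - l * p) l ab cd.
  rewrite /rect_int -/q !sx ?sy ?lexx ?ab ?cd//=.
  do 8 (move: (cint _ _) => ?).
  move=> q0.
  rewrite -[RHS]add0r -[X in _ = X + _]q0; ring.
have hx y : c <= y <= d ->
    normc (cint `[a, b] (fun t => r (t +i* y))) <= 2 * (e * L) * (b - a).
  move=> yin; apply: normc_cint_itv_le => // t tin.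
    by apply: rcontinuous_hline; apply: hr; rewrite /in_rect /= tin.
  by apply: rb; rewrite /in_rect /= tin.
have hy x : a <= x <= b ->
    normc (cint `[c, d] (fun t => r (x +i* t))) <= 2 * (e * L) * (d - c).
  move=> xin; apply: normc_cint_itv_le => // t tin.
    by apply: rcontinuous_vline; apply: hr; rewrite /in_rect /= xin.
  by apply: rb; rewrite /in_rect /= xin.
rewrite /rect_int.
apply: (@le_trans _ _ ((2 * (e * L) * (b - a) + 2 * (e * L) * (b - a)) +
   (2 * (e * L) * (d - c) + 2 * (e * L) * (d - c)))); last by rewrite /L; lra.
apply: (le_trans (normcD _ _)); apply: lerD.
  by apply: (le_trans (normcB _ _)); rewrite lerD// hx// lexx ?cd.
have ni : normc ('i : C) = 1 by rewrite /= expr0n expr1n add0r sqrtr1.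
rewrite normcM ni mul1r.
by apply: (le_trans (normcB _ _)); rewrite lerD// hy// lexx ?ab.
Qed.

End Goursat.

(** * Nested rectangles *)

Section Bisection.
Variable R : realType.

Lemma exp2n_gt (x e : R) : 0 < e -> exists n : nat, x / 2 ^+ n < e.
Proof.
move=> e0; exists (Num.bound (`|x| / e)).
rewrite ltr_pdivrMr ?exprn_gt0//; set k := Num.bound _.
have h1 : `|x| / e < k%:R by apply: archi_boundP; rewrite divr_ge0// ltW.
have h2 : (k%:R : R) < 2 ^+ k by rewrite -natrX ltr_nat ltn_expl.
apply: (le_lt_trans (ler_norm _)); rewrite -ltr_pdivrMl// mulrC.
exact: lt_trans h1 h2.
Qed.

Lemma nested_point (u : nat -> R) (w : R) : 0 <= w ->
  (forall n, u n <= u n.+1 /\ u n.+1 + w / 2 ^+ n.+1 <= u n + w / 2 ^+ n) ->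
  exists p, forall n, u n <= p <= u n + w / 2 ^+ n.
Proof.
move=> w0 h.
have mono n m : (n <= m)%N -> u n <= u m /\ u m + w / 2 ^+ m <= u n + w / 2 ^+ n.
  elim: m => [|m IH]; first by rewrite leqn0 => /eqP ->.
  rewrite leq_eqVlt => /predU1P[->//|]; rewrite ltnS => /IH[h1 h2].
  by have [h3 h4] := h m; split; [exact: le_trans h1 h3|exact: le_trans h4 h2].
have wn n : 0 <= w / 2 ^+ n by rewrite divr_ge0// exprn_ge0.
have cross n m : u n <= u m + w / 2 ^+ m.
  have [/mono[h1 _]|/ltnW/mono[_ h1]] := leqP n m.
    by apply: (le_trans h1); rewrite lerDl.
  by apply: le_trans h1; rewrite lerDl.
exists (sup (range u)) => n; apply/andP; split.
  by apply: ub_le_sup; [exists (u 0%N + w / 2 ^+ 0) => _ [m _ <-]; exact: cross|exists n].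
by apply: ge_sup; [exists (u 0%N), 0%N|move=> _ [m _ <-]; exact: cross].
Qed.

(** [P n u v] speaks of the rectangle with lower left corner (u, v) and sides [w / 2 ^+ n],
    [h / 2 ^+ n]. If the property failed at level 0, one of the four quarters would fail at each
    stage, and the common point of these nested rectangles would contradict the local hypothesis. *)
Lemma bisection2 (P : nat -> R -> R -> Prop) (u0 v0 w h : R) :
  0 <= w -> 0 <= h ->
  (forall n u v, u0 <= u -> u + w / 2 ^+ n <= u0 + w ->
     v0 <= v -> v + h / 2 ^+ n <= v0 + h ->
     P n.+1 u v -> P n.+1 (u + w / 2 ^+ n.+1) v ->
     P n.+1 u (v + h / 2 ^+ n.+1) ->
     P n.+1 (u + w / 2 ^+ n.+1) (v + h / 2 ^+ n.+1) -> P n u v) ->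
  (forall p q, u0 <= p <= u0 + w -> v0 <= q <= v0 + h -> exists n, forall u v,
     u0 <= u -> u + w / 2 ^+ n <= u0 + w ->
     v0 <= v -> v + h / 2 ^+ n <= v0 + h ->
     u <= p <= u + w / 2 ^+ n -> v <= q <= v + h / 2 ^+ n -> P n u v) ->
  P 0%N u0 v0.
Proof.
move=> w0 h0 sub loc; apply: contrapT => nP0.
pose inb n (x : R * R) := [/\ u0 <= x.1, x.1 + w / 2 ^+ n <= u0 + w,
  v0 <= x.2 & x.2 + h / 2 ^+ n <= v0 + h].
have half (z : R) n : z / 2 ^+ n = z / 2 ^+ n.+1 + z / 2 ^+ n.+1.
  by rewrite exprS; field; rewrite expf_neq0.
have wn n : 0 <= w / 2 ^+ n by rewrite divr_ge0// exprn_ge0.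
have hn n : 0 <= h / 2 ^+ n by rewrite divr_ge0// exprn_ge0.
(* The failing rectangle is a premise inside the existential, so that choice yields a total function
   [F] and [s] is defined by plain recursion; when the premise fails the point itself is
   returned. *)
have step (nx : nat * (R * R)) : exists y : R * R,
   inb nx.1 nx.2 -> ~ P nx.1 nx.2.1 nx.2.2 ->
   [/\ inb nx.1.+1 y, ~ P nx.1.+1 y.1 y.2,
      nx.2.1 <= y.1 /\ y.1 + w / 2 ^+ nx.1.+1 <= nx.2.1 + w / 2 ^+ nx.1 &
      nx.2.2 <= y.2 /\ y.2 + h / 2 ^+ nx.1.+1 <= nx.2.2 + h / 2 ^+ nx.1].
  case: nx => n [u v] /=.
  have [[i nP]|nin] := pselect (inb n (u, v) /\ ~ P n u v); last first.
    by exists (u, v) => i nP; case: nin.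
  have [i1 i2 i3 i4] := i; rewrite /= in i1 i2 i3 i4.
  have := half w n; have := half h n; have := wn n.+1; have := hn n.+1.
  rewrite /inb /= => {wn hn half}.
  move: (w / 2 ^+ n) (h / 2 ^+ n) (w / 2 ^+ n.+1) (h / 2 ^+ n.+1) i2 i4
    (sub n u v i1) => w2 h2 w' h' i2 i4 /(_ i2 i3 i4) sb a b c d.
  have [p1|n1] := pselect (P n.+1 u v); last first.
    by exists (u, v) => _ _ /=; repeat split => //; lra.
  have [p2|n2] := pselect (P n.+1 (u + w') v); last first.
    by exists (u + w', v) => _ _ /=; repeat split => //; lra.
  have [p3|n3] := pselect (P n.+1 u (v + h')); last first.
    by exists (u, v + h') => _ _ /=; repeat split => //; lra.
  exists (u + w', v + h') => _ _ /=; repeat split => //; try lra.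
  by move=> p4; apply: nP; exact: sb.
pose F nx := projT1 (cid (step nx)).
have FP nx := projT2 (cid (step nx)).
pose s := fix s n := if n is n'.+1 then F (n', s n') else (u0, v0).
have sinv n : inb n (s n) /\ ~ P n (s n).1 (s n).2.
  elim: n => [|n [i nP]]; first by split=> //; split=> //=; rewrite expr0 divr1.
  by have [] := FP (n, s n) i nP.
have sstep n : [/\ inb n.+1 (s n.+1), ~ P n.+1 (s n.+1).1 (s n.+1).2,
      (s n).1 <= (s n.+1).1 /\ (s n.+1).1 + w / 2 ^+ n.+1 <= (s n).1 + w / 2 ^+ n &
      (s n).2 <= (s n.+1).2 /\ (s n.+1).2 + h / 2 ^+ n.+1 <= (s n).2 + h / 2 ^+ n].
  by have [i nP] := sinv n; exact: (FP (n, s n) i nP).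
have [p pP] : exists p, forall n, (s n).1 <= p <= (s n).1 + w / 2 ^+ n.
  by apply: nested_point => // n; have [] := sstep n.
have [q qP] : exists q, forall n, (s n).2 <= q <= (s n).2 + h / 2 ^+ n.
  by apply: nested_point => // n; have [] := sstep n.
have := pP 0%N; have := qP 0%N; rewrite /= !expr0 !divr1 => q0 p0.
have [n nP] := loc p q p0 q0.
have [[i1 i2 i3 i4] ] := sinv n; apply; exact: nP.
Qed.

End Bisection.

(** * Goursat's theorem by bisection *)

Section Goursat.
Variable R : realType.
Local Notation C := R[i].
Implicit Types (f g : C^o -> C^o) (a b c d : R).

Theorem goursat f a b c d : a <= b -> c <= d -> hol_rect f a b c d ->
  rect_int f a b c d = 0.
Proof.
move=> ab cd hf; apply/eq0_normc/le_anti; rewrite normc_ge0 andbT.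
set L := (b - a) + (d - c).
have L0 : 0 <= L by rewrite addr_ge0 ?subr_ge0.
suff key (e : R) : 0 < e -> normc (rect_int f a b c d) <= 4 * e * L ^+ 2.
  apply/ler_addgt0Pr => e e0; rewrite add0r.
  have L1 : 0 < L ^+ 2 + 1 by rewrite ltr_wpDl ?sqr_ge0.
  have /key/le_trans : 0 < e / (4 * (L ^+ 2 + 1)) by rewrite divr_gt0// mulr_gt0.
  have -> : 4 * (e / (4 * (L ^+ 2 + 1))) * L ^+ 2 = e * (L ^+ 2 / (L ^+ 2 + 1)).
    by field; rewrite gt_eqF.
  apply; rewrite ler_piMr ?ltW// ltr_pdivrMr// mul1r; lra.
move=> e0.
(* The bound is quadratic in the size of the rectangle, so the bounds for the four quarters add up
   exactly to the bound for the whole. *)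
pose P n (u v : R) := normc (rect_int f u (u + (b - a) / 2 ^+ n) v (v + (d - c) / 2 ^+ n))
  <= 4 * e * (L / 2 ^+ n) ^+ 2.
have := @bisection2 R P a c (b - a) (d - c).
rewrite /P expr0 !divr1 !subrKC; apply; rewrite ?subr_ge0// {}/P.
  move=> n u v u1 u2 v1 v2.
  have hhalf (z : R) : z / 2 ^+ n = z / 2 ^+ n.+1 + z / 2 ^+ n.+1.
    by rewrite exprS; field; rewrite expf_neq0.
  have w0 : 0 <= (b - a) / 2 ^+ n.+1 by rewrite divr_ge0 ?subr_ge0 ?exprn_ge0.
  have h0 : 0 <= (d - c) / 2 ^+ n.+1 by rewrite divr_ge0 ?subr_ge0 ?exprn_ge0.
  have -> : (L / 2 ^+ n) ^+ 2 = 4 * (L / 2 ^+ n.+1) ^+ 2 by rewrite hhalf; ring.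
  rewrite (hhalf (b - a)) in u2 *; rewrite (hhalf (d - c)) in v2 *.
  move: ((b - a) / 2 ^+ n.+1) ((d - c) / 2 ^+ n.+1) ((L / _) ^+ 2) w0 h0 u2 v2
    => w h l w0 h0 u2 v2; rewrite !addrA in u2 v2 *.
  move=> p1 p2 p3 p4.
  have hf' : hol_rect f u (u + w + w) v (v + h + h) by apply: hol_rectS hf.
  have e1 : u <= u + w by rewrite lerDl.
  have e2 : u + w <= u + w + w by rewrite lerDl.
  have e3 : v <= v + h by rewrite lerDl.
  have e4 : v + h <= v + h + h by rewrite lerDl.
  have e5 : v <= v + h + h := le_trans e3 e4.
  rewrite (rect_int_splitx (m := u + w) hf')//.
  have hf1 : hol_rect f u (u + w) v (v + h + h) by apply: hol_rectS hf'.
  have hf2 : hol_rect f (u + w) (u + w + w) v (v + h + h) by apply: hol_rectS hf'.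
  rewrite (rect_int_splity (m := v + h) hf1)// (rect_int_splity (m := v + h) hf2)//.
  apply: (le_trans (normcD _ _)).
  have := normcD (rect_int f u (u + w) v (v + h)) (rect_int f u (u + w) (v + h) (v + h + h)).
  have := normcD (rect_int f (u + w) (u + w + w) v (v + h))
    (rect_int f (u + w) (u + w + w) (v + h) (v + h + h)).
  move: p1 p2 p3 p4; clear; do 6 (move: (normc _) => ?); lra.
move=> p q pin qin.
have pq : in_rect a b c d (p +i* q) by rewrite /in_rect /= pin.
have /derivablecP[l /(_ e e0)[r r0 rP]] := hf _ pq.
have [n nP] := exp2n_gt L r0; exists n => u v u1 u2 v1 v2 pu qv.
have w0 : 0 <= (b - a) / 2 ^+ n by rewrite divr_ge0 ?subr_ge0 ?exprn_ge0.
have h0 : 0 <= (d - c) / 2 ^+ n by rewrite divr_ge0 ?subr_ge0 ?exprn_ge0.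
have LE : L / 2 ^+ n = (b - a) / 2 ^+ n + (d - c) / 2 ^+ n by rewrite /L mulrDl.
rewrite LE in nP *.
move: ((b - a) / 2 ^+ n) ((d - c) / 2 ^+ n) w0 h0 u2 v2 pu qv nP => w h w0 h0 u2 v2 pu qv nP.
have pin' : in_rect u (u + w) v (v + h) (p +i* q) by rewrite /in_rect /= pu.
have -> : w + h = (u + w - u) + (v + h - v) by ring.
apply: (rect_int_small _ _ pin' (ltW e0) _ (l := l)); rewrite ?lerDl//.
  exact: hol_rectS hf.
move=> z; rewrite /in_rect ReD ImD /= => /andP[/andP[z1 z2] /andP[z3 z4]].
apply: rP; apply: (le_lt_trans (normc_le_ReIm _)); apply: le_lt_trans nP.
move/andP: pu => [? ?]; move/andP: qv => [? ?].
by apply: lerD; rewrite ler_norml; apply/andP; split; lra.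
Qed.

End Goursat.

(** * The identity theorem *)

Section Identity.
Variable R : realType.
Local Notation C := R[i].
Implicit Types (f g h k : C^o -> C^o).

(* Goursat's theorem for [k (z + exp _)] on the rectangle [a, ln r] x [0, 2 pi]:
   the horizontal sides cancel by periodicity. *)
Lemma mean_value_bound k (z : C) (r r' M : R) : 0 < r -> r < r' ->
  (forall w : C^o, normc (w - z) < r' -> derivable k w 1) ->
  (forall t : R, normc (k (z + r%:C * cis t)) <= M) ->
  normc (k z) <= 2 * M.
Proof.
move=> r0 rr' hk kM.
pose g (x : C^o) : C^o := k (z + cexp x).
have zz (x : C) : z + x - z = x by rewrite addrC addKr.
have hg (x : C^o) : complex.Re x <= ln r -> derivable g x 1.
  move=> xr; apply: (@derivable_comp_c _ (fun x : C^o => z + cexp x : C^o) k).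
    by apply: derivableD_c; [exact: derivable_cst_c|exact: derivable_cexp].
  apply: hk; rewrite zz normc_cexp; apply: le_lt_trans rr'.
  by rewrite -[leRHS]lnK// ler_expR.
have pi0 : (0 : R) <= 2 * pi by rewrite mulr_ge0// pi_ge0.
have pip : (0 : R) < 2 * pi by rewrite mulr_gt0// pi_gt0.
pose J a := cint `[0, 2 * pi] (fun t => g (a +i* t)).
have JE a : a <= ln r -> J a = J (ln r).
  move=> ab; have := goursat ab pi0 (f := g).
  have -> : rect_int g a (ln r) 0 (2 * pi) = 'i * (J (ln r) - J a).
    rewrite /rect_int -/(J a) -/(J (ln r)).
    have -> : cint `[a, ln r] (fun t => g (t +i* 0)) =
        cint `[a, ln r] (fun t => g (t +i* (2 * pi))).
      apply: eq_cint => t _; rewrite /g; congr (k (z + _)).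
      rewrite !cexp_cis /=; congr (_ * _).
      by rewrite -[2 * pi]mulr1 -[1]/(1%:~R) cis2pi_int cis0.
    by rewrite subrr add0r.
  move=> H; have {}H : 'i * (J (ln r) - J a) = 0.
    by apply: H => x /andP[/andP[_ xr] _]; exact: hg.
  have i0 : ('i : C) != 0 by rewrite eq_complex /= oner_eq0 andbF.
  by apply/esym/subr0_eq/(mulfI i0); rewrite H mulr0.
have gc a : a <= ln r -> forall t, rcontinuous_at (fun t => g (a +i* t)) t.
  by move=> ar t; apply: rcontinuous_vline; exact: hg.
apply/ler_addgt0Pr => e e0.
have e2 : 0 < e / 2 by rewrite divr_gt0.
have hz : derivable k (z : C^o) 1.
  by apply: hk; rewrite subrr normc0 (lt_trans r0).
have [d d0 dP] := derivable_ccontinuous hz e2.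
(* On the circle of radius [expR a < d] the function [k] differs from [k z] by less than [e / 2], so
   [J a] is close to [k z] times 2 pi, while [J a] equals the integral over the large circle. *)
pose a := Num.min (ln r) (ln (d / 2)).
have ar : a <= ln r by rewrite ge_min lexx.
have ad : expR a < d.
  apply: (@le_lt_trans _ _ (d / 2)); last by rewrite ltr_pdivrMr// ltr_pMr// ltr1n.
  by rewrite -[leRHS]lnK ?ler_expR ?ge_min ?lexx ?orbT// posrE divr_gt0.
have b1 : normc (J (ln r)) <= 2 * M * (2 * pi - 0).
  apply: normc_cint_itv_le => // [t _|t _]; first exact: gc.
  rewrite /g cexp_cis /= lnK//; exact: kM.
have b2 : normc (J a - k z * (2 * pi - 0)%:C) <= 2 * (e / 2) * (2 * pi - 0).
  rewrite -cint_cst// -cintB//; first last.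
  - exact: cintegrable_cst.
  - by apply: cintegrable_itv => t _; exact: gc.
  apply: normc_cint_itv_le => // [t _|t _].
    move=> e' e'0; have [d' d'0 d'P] := gc a ar t e' e'0; exists d' => // u /d'P.
    by rewrite opprB addrA subrK.
  by apply/ltW/dP; rewrite zz normc_cexp.
rewrite subr0 in b1 b2.
have : normc (k z * (2 * pi)%:C) <= 2 * M * (2 * pi) + e * (2 * pi).
  have -> : k z * (2 * pi)%:C = J (ln r) - (J a - k z * (2 * pi)%:C).
    by rewrite JE// opprB addrC subrK.
  apply: (le_trans (normcB _ _)); apply: lerD b1 _; apply: le_trans b2 _.
  by rewrite le_eqVlt; apply/orP; left; apply/eqP; field.
by rewrite normcM normc_real ger0_norm// -mulrDl ler_pM2r.
Qed.

Lemma circle_bounded h (z : C) (r : R) :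
  (forall t : R, derivable h (z + r%:C * cis t : C^o) 1) ->
  exists M, forall t : R, normc (h (z + r%:C * cis t)) <= M.
Proof.
move=> hh.
have cisc (t : R) : rcontinuous_at (@cis R) t.
  move=> e e0.
  have [d d0 dP] := derivable_ccontinuous (@derivable_cexp R (0 +i* t)) e0.
  by exists d => // u ut; rewrite !cis_cexp; apply: dP; rewrite normc_vline.
have hc (t : R) : rcontinuous_at (fun t => h (z + r%:C * cis t)) t.
  move=> e /(derivable_ccontinuous (hh t))[d d0 dP].
  have r1 : 0 < `|r| + 1 by rewrite ltr_wpDl.
  have [d' d'0 d'P] := cisc t (d / (`|r| + 1)) (divr_gt0 d0 r1).
  exists d' => // u /d'P ut; apply: dP.
  rewrite opprD addrACA subrr add0r -mulrBr normcM normc_real.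
  apply: (@le_lt_trans _ _ ((`|r| + 1) * normc (cis u - cis t))).
    by rewrite ler_wpM2r ?normc_ge0// lerDl.
  by rewrite mulrC -ltr_pdivlMr.
have cn : continuous (fun t : R => normc (h (z + r%:C * cis t))).
  move=> t; apply/cvgrPdist_lt => e /(hc t)[d d0 dP].
  apply/nbhs_ballP; exists d => //= u; rewrite /ball /= distrC => /dP.
  rewrite normc_distC; apply: le_lt_trans.
  set A := h _; set B := h (_ + _ * cis u).
  have h1 := normcD (A - B) B; have h2 := normcD (B - A) A.
  rewrite !subrK in h1 h2; rewrite (normc_distC B) in h2.
  by rewrite ler_norml; apply/andP; split; lra.
have [t0 _ t0P] : exists2 c : R, c \in `[0, 2 * pi] &
    forall t, t \in `[0, 2 * pi] ->
      normc (h (z + r%:C * cis t)) <= normc (h (z + r%:C * cis c)).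
  apply: EVT_max; first by rewrite mulr_ge0// pi_ge0.
  exact: continuous_subspaceT.
exists (normc (h (z + r%:C * cis t0))) => t.
have pip : (0 : R) < 2 * pi by rewrite mulr_gt0// pi_gt0.
pose n := Num.floor (t / (2 * pi)); pose t' := t - 2 * pi * n%:~R.
have -> : cis t = cis t'.
  by rewrite /t' cisD -[- _]mulrN -mulrNz cis2pi_int mulr1.
apply: t0P; rewrite in_itv /= /t' subr_ge0 lerBlDr.
have /andP[n1 n2] := floor_itv (t / (2 * pi)).
rewrite -/n in n1 n2; rewrite ler_pdivlMr// in n1; rewrite ltr_pdivrMr// in n2.
rewrite mulrC n1 /=; apply/ltW/(lt_le_trans n2).
by rewrite intrD mulrDl mul1r addrC.
Qed.

(** Apply [mean_value_bound] at [z] to h(w) ((z - u) / (w - u))^n. This product is holomorphic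
    because [h] vanishes near [u], it takes the value [h z] at [w = z], and on the circle of radius
    [r / 2] about [z] it is at most M / 2^n, as |z - u| < r / 6 and |w - u| >= r / 3 there. Let n
    tend to infinity. *)
Lemma identity_disc h (u : C) (r e : R) : 0 < r -> 0 < e ->
  (forall w : C^o, normc (w - u) < r -> derivable h w 1) ->
  (forall w, normc (w - u) < e -> h w = 0) ->
  forall z, normc (z - u) < r / 6 -> h z = 0.
Proof.
move=> r0 e0 hh h0 z zr; have [->|zu] := eqVneq z u; first by rewrite h0// subrr normc0.
have zu' : z - u != 0 by rewrite subr_eq0.
have inD w : normc (w - z) < 2 * r / 3 -> normc (w - u) < r.
  move=> wz; have -> : w - u = (w - z) + (z - u) by rewrite addrA subrK.
  by apply: (le_lt_trans (normcD _ _)); lra.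
have circ t : normc (z + (r / 2)%:C * cis t - z) = r / 2.
  rewrite addrC addKr normcM normc_cis mulr1 normc_real ger0_norm// divr_ge0 ?ltW//.
have [M MP] : exists M, forall t : R, normc (h (z + (r / 2)%:C * cis t)) <= M.
  by apply: circle_bounded => t; apply/hh/inD; rewrite circ; lra.
pose k n (w : C^o) : C^o := h w * ((z - u) / (w - u)) ^+ n.
have hk n (w : C^o) : normc (w - z) < 2 * r / 3 -> derivable (k n) w 1.
  move=> /inD wr; have [wu|wu] := eqVneq w u.
    apply: (@derivable_near _ (fun=> 0)); last exact: derivable_cst_c.
    by apply/nbhscP; exists e => // v; rewrite wu /k => /h0 ->; rewrite mul0r.
  apply: derivableM_c; first exact: hh.
  apply: (@derivableX_c _ (fun w : C^o => (z - u) / (w - u) : C^o)).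
  apply: derivableM_c; first exact: derivable_cst_c.
  apply: (@derivable_inv_c _ (fun w : C^o => w - u : C^o)); first by rewrite subr_eq0.
  by apply: derivableB_c; [exact: derivable_id_c|exact: derivable_cst_c].
have kz n : k n z = h z by rewrite /k divff// expr1n mulr1.
have M0 : 0 <= M := le_trans (normc_ge0 _) (MP 0).
have bnd n : normc (h z) <= 2 * M / 2 ^+ n.
  rewrite -(kz n) -mulrA.
  apply: (@mean_value_bound _ z (r / 2) (2 * r / 3)); [lra|lra|exact: hk|].
  move=> t; rewrite /k normcM normcX normcM normcV -exprVn; apply: ler_pM => //.
  - exact: normc_ge0.
  - by rewrite exprn_ge0// mulr_ge0 ?invr_ge0 ?normc_ge0.
  apply: lerXn2r; rewrite ?nnegrE ?mulr_ge0 ?invr_ge0 ?normc_ge0//.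
  set w := _ + _ * cis t.
  have wu : r / 3 <= normc (w - u).
    have := normcD (w - u) (u - z); rewrite addrA subrK circ (normc_distC u).
    by lra.
  have wu0 : 0 < normc (w - u) by apply: lt_le_trans wu; rewrite divr_gt0.
  by rewrite ler_pdivrMr//; lra.
apply/eq0_normc/le_anti; rewrite normc_ge0 andbT.
apply/ler_addgt0Pr => d d0; rewrite add0r.
by have [n /ltW] := exp2n_gt (2 * M) d0; apply: le_trans.
Qed.

(** A chain of discs along the segment: consecutive centres [p j] are less than [r / 6] apart, so
    each centre lies in the disc on which [identity_disc] gives vanishing. *)
Lemma identity_segment h (u v : C) (r e : R) : 0 < r -> 0 < e ->
  (forall t : R, 0 <= t <= 1 -> forall w : C^o,
     normc (w - (u + t%:C * (v - u))) < r -> derivable h w 1) ->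
  (forall w, normc (w - u) < e -> h w = 0) ->
  h v = 0.
Proof.
move=> r0 e0 hh h0.
have r6 : 0 < r / 6 by rewrite divr_gt0.
pose N := (Num.bound (normc (v - u) / (r / 6))).+1.
have NP : normc (v - u) / N%:R < r / 6.
  rewrite ltr_pdivrMr ?ltr0n// mulrC -ltr_pdivrMr//.
  apply: (@lt_trans _ _ ((Num.bound (normc (v - u) / (r / 6)))%:R)).
    by apply: archi_boundP; rewrite divr_ge0 ?normc_ge0// ltW.
  by rewrite ltr_nat.
have N0 : (N%:R : R) != 0 by rewrite pnatr_eq0.
pose p (j : nat) : C := u + (j%:R / N%:R)%:C * (v - u).
have key j : (j <= N)%N ->
    exists2 e' : R, 0 < e' & forall w, normc (w - p j) < e' -> h w = 0.
  elim: j => [_|j IH jN]; first by exists e => // w; rewrite /p !mul0r addr0; exact: h0.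
  have [e' e'0 hp] := IH (ltnW jN).
  have dist : normc (p j.+1 - p j) < r / 6.
    have -> : p j.+1 - p j = (N%:R^-1)%:C * (v - u).
      rewrite /p -[j.+1%:R]natr1 mulrDl rmorphD /= mul1r; ring.
    by rewrite normcM normc_real ger0_norm ?invr_ge0// mulrC.
  exists (r / 6 - normc (p j.+1 - p j)); first by rewrite subr_gt0.
  move=> w wp; apply: (@identity_disc h (p j) r e') => //.
    move=> x; apply: hh; rewrite divr_ge0//= ler_pdivrMr ?mul1r ?ler_nat ?ltr0n//.
    exact: ltnW.
  have -> : w - p j = (w - p j.+1) + (p j.+1 - p j) by rewrite addrA subrK.
  by apply: (le_lt_trans (normcD _ _)); rewrite -ltrBrDr.
have [e' e'0 hv] := key N (leqnn _); apply: hv.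
by rewrite /p divff// mul1r addrCA subrr addr0 subrr normc0.
Qed.

End Identity.

(** * Uniqueness of meromorphic continuation *)

Section Meromorphic.
Variable R : realType.
Local Notation C := R[i].
Implicit Types (f g h : C^o -> C^o).

Lemma cexp_surj (w : C) : w != 0 -> exists z, cexp z = w.
Proof.
move=> w0; have n0 : 0 < normc w by rewrite normc_gt0.
have nE : (complex.Re w / normc w) ^+ 2 + (complex.Im w / normc w) ^+ 2 = 1.
  rewrite !expr_div_n -mulrDl -[X in X / _](_ : normc w ^+ 2 = _) ?divff ?expf_neq0 ?gt_eqF//.
  by case: w {w0 n0} => a b /=; rewrite sqr_sqrtr// addr_ge0 ?sqr_ge0.
set x := _ / _ in nE; set y := _ / _ in nE.
have xle : -1 <= x <= 1.
  by rewrite -ler_norml -ler_sqr ?nnegrE// real_normK ?num_real// expr1n -nE lerDl sqr_ge0.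
have [t tE] : exists t, cis t = x +i* y.
  have [y0|y0] := leP 0 y.
    exists (acos x); rewrite cisE acosK// sin_acos// -nE addrC addKr.
    by rewrite sqrtr_sqr ger0_norm.
  exists (- acos x); rewrite cisE cosN sinN acosK// sin_acos// -nE addrC addKr.
  by rewrite sqrtr_sqr ltr0_norm// opprK.
exists (ln (normc w) +i* t); rewrite cexp_cis /= lnK// tE.
by apply: eqC; rewrite ?ReM ?ImM /x /y /= mul0r ?subr0 ?addr0 mulrC divfK// gt_eqF.
Qed.

(** A segment in the punctured disc could run through [s]. Pulling back by [s + cexp _] replaces the
    punctured disc by the half-plane Re x < ln r, which is convex, and the two points by logarithms
    of their distances from [s] as complex numbers. *)
Lemma identity_punctured h (s : C) (r : R) (u : C) (e : R) : 0 < e ->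
  (forall w : C^o, w != s -> normc (w - s) < r -> derivable h w 1) ->
  u != s -> normc (u - s) < r -> (forall w, normc (w - u) < e -> h w = 0) ->
  forall w, w != s -> normc (w - s) < r -> h w = 0.
Proof.
move=> e0 hh us ur h0 w ws wr.
have r0 : 0 < r := le_lt_trans (normc_ge0 _) ur.
have [a aE] : exists a, cexp a = u - s by apply: cexp_surj; rewrite subr_eq0.
have [b bE] : exists b, cexp b = w - s by apply: cexp_surj; rewrite subr_eq0.
pose g (x : C^o) : C^o := h (s + cexp x).
have lt_ln (x : C) v : cexp x = v - s -> normc (v - s) < r -> complex.Re x < ln r.
  by move=> xE; rewrite -xE normc_cexp -[X in _ < X]lnK// ltr_expR.
have ar := lt_ln _ _ aE ur; have br := lt_ln _ _ bE wr.
have -> : h w = g b by rewrite /g bE addrC subrK.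
have [d d0 dP] := derivable_ccontinuous (@derivable_cexp R a) e0.
apply: (@identity_segment _ g a b
   (Num.min (ln r - complex.Re a) (ln r - complex.Re b)) d) => //.
- by rewrite lt_min !subr_gt0 ar br.
- move=> t /andP[t0 t1] x; rewrite lt_min => /andP[x1 x2].
  apply: (@derivable_comp_c _ (fun x : C^o => s + cexp x : C^o) h).
    by apply: derivableD_c; [exact: derivable_cst_c|exact: derivable_cexp].
  apply: hh; first by rewrite -subr_eq0 addrC addKr cexp_neq0.
  rewrite addrC addKr normc_cexp -[X in _ < X]lnK// ltr_expR.
  have := le_lt_trans (normr_Re_le _) x1; have := le_lt_trans (normr_Re_le _) x2.
  rewrite !(ReD, ReN, ReM) /= mul0r subr0.
  set A := complex.Re a in ar *; set B := complex.Re b in br *.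
  rewrite !ltr_norml => /andP[_ y1] /andP[_ y2].
  have [ab|/ltW ba] := leP A B.
    have : t * (B - A) <= B - A by rewrite ler_piMl// subr_ge0.
    by move: y1 y2; clear; lra.
  have : t * (B - A) <= 0 by rewrite mulr_ge0_le0// subr_le0.
  by move: y1 y2; clear; lra.
- move=> x xa; rewrite /g; apply: h0.
  have -> : s + cexp x - u = cexp x - cexp a by rewrite aE opprB; ring.
  exact: dP.
Qed.

(* The indicator of [Q] has derivative [0]. *)
Lemma locally_constant (Q : R -> Prop) :
  (forall t : R, exists2 d : R, 0 < d & forall u v, `|u - t| < d -> `|v - t| < d ->
     Q u -> Q v) -> forall a b, Q a -> Q b.
Proof.
move=> loc a b Qa; pose q (t : R) : R := (`[< Q t >])%:R.
have dq (t : R) : is_derive t (1 : R) q (0 : R).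
  apply: (@near_eq_is_derive _ _ _ (fun=> q t)).
  have [d d0 dP] := loc t; apply/nbhs_ballP; exists d => //= u.
  rewrite /ball /= distrC => ut; rewrite /q; congr (nat_of_bool _)%:R.
  by apply: asbool_equiv_eq; split; apply: dP => //; rewrite subrr normr0.
have qE : q b = q a.
  have [ab|/ltW ba] := leP a b.
    by have [c _] := mvt dq ab; rewrite mul0r => /subr0_eq.
  by have [c _] := mvt dq ba; rewrite mul0r => /subr0_eq.
move: qE; rewrite /q (asboolT Qa); case: asboolP => // _ /eqP.
by rewrite eq_sym oner_eq0.
Qed.

Lemma meromorphic_punctured f (s : C) : meromorphic f ->
  exists2 r : R, 0 < r &
    forall w : C^o, w != s -> normc (w - s) < r -> derivable f w 1.
Proof. by move=> /(_ s)[/dnbhscP[r r0 rP] _]; exists r. Qed.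

(** Let [U s] say that f = g on a punctured disc about [s]. This property is locally constant, since
    in a punctured disc where both functions are holomorphic the identity theorem applies, and it
    holds at [d + 1]. So it holds everywhere, by [locally_constant] on the line from [d + 1]; the
    value at [s] itself then follows from the regularity of [g] there. *)
Lemma meromorphic_unique f g (d : R) : meromorphic f -> meromorphic g ->
  (forall s, d < complex.Re s -> f s = g s) ->
  forall s : C^o, derivable g s 1 -> f s = g s.
Proof.
move=> mf mg fg.
pose h (w : C^o) : C^o := f w - g w.
pose U s := exists2 e : R, 0 < e & forall w, w != s -> normc (w - s) < e -> h w = 0.
have Uloc s : exists2 r : R, 0 < r & forall u v, normc (u - s) < r ->
    normc (v - s) < r -> U u -> U v.
  have [r1 r10 fP] := meromorphic_punctured s mf.
  have [r2 r20 gP] := meromorphic_punctured s mg.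
  exists (Num.min r1 r2); first by rewrite lt_min r10.
  set r := Num.min r1 r2 => u v ur vr [e e0 hu].
  have r0 : 0 < r by rewrite lt_min r10.
  have hr (w : C^o) : w != s -> normc (w - s) < r -> derivable h w 1.
    by move=> ws; rewrite lt_min => /andP[w1 w2]; apply: derivableB_c; [exact: fP|exact: gP].
  (* The point [u] may be [s] itself, and agreement near [u] is punctured at [u]; a nearby [u']
     avoids both. *)
  have [u' [us u'r [e' e'0 hu']]] : exists u' : C, [/\ u' != s, normc (u' - s) < r &
      exists2 e' : R, 0 < e' & forall w, normc (w - u') < e' -> h w = 0].
    pose m := Num.min e (r - normc (u - s)).
    have m0 : 0 < m by rewrite lt_min e0 subr_gt0.
    have mk (c : R) : `|c| = m / 2 -> u + c%:C != s ->
        exists u' : C, [/\ u' != s, normc (u' - s) < r &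
      exists2 e' : R, 0 < e' & forall w, normc (w - u') < e' -> h w = 0].
      move=> cm cs; exists (u + c%:C); split => //.
        rewrite addrAC; apply: (le_lt_trans (normcD _ _)).
        rewrite normc_real cm -ltrBrDl; apply: (@lt_le_trans _ _ m).
          by rewrite ltr_pdivrMr// ltr_pMr// ltr1n.
        by rewrite ge_min lexx orbT.
      exists (m / 2); first by rewrite divr_gt0.
      move=> w wu; apply: hu.
        apply/eqP => wE; move: wu; rewrite wE opprD addrA subrr add0r normcNE.
        by rewrite normc_real cm ltxx.
      have -> : w - u = (w - (u + c%:C)) + c%:C by ring.
      apply: (le_lt_trans (normcD _ _)); rewrite normc_real cm.
      apply: (@lt_le_trans _ _ m); last by rewrite ge_min lexx.
      by rewrite [ltRHS]splitr ltrD2r.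
    (* At most one of u + m / 2 and u - m / 2 equals [s]; the other one serves as [u']. *)
    have [cs|] := eqVneq (u + (m / 2)%:C) s; last first.
      by apply: mk; rewrite ger0_norm// divr_ge0// ltW.
    apply: (mk (- (m / 2))); first by rewrite normrN ger0_norm// divr_ge0// ltW.
    rewrite -cs -subr_eq0 opprD addrACA subrr add0r rmorphN -opprD oppr_eq0.
    by rewrite -rmorphD -splitr -normc_eq0 normc_real normr_eq0 gt_eqF.
  have hz := identity_punctured e'0 hr us u'r hu'.
  have [->|vs] := eqVneq v s; first by exists r => //.
  exists (Num.min (normc (v - s)) (r - normc (v - s))).
    by rewrite lt_min normc_gt0 !subr_gt0 subr_eq0 vs vr.
  move=> w wv; rewrite lt_min => /andP[w1 w2]; apply: hz.
    by apply: contraTneq w1 => ->; rewrite normc_distC ltxx.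
  have -> : w - s = (w - v) + (v - s) by rewrite addrA subrK.
  by apply: (le_lt_trans (normcD _ _)); rewrite -ltrBrDr.
have Uall s : U s.
  pose p (t : R) : C := (d + 1)%:C + t%:C * (s - (d + 1)%:C).
  have -> : s = p 1 by rewrite /p mul1r addrC subrK.
  apply: (@locally_constant (fun t => U (p t)) _ 0).
    move=> t; have [r r0 rP] := Uloc (p t).
    have n1 : 0 < normc (s - (d + 1)%:C) + 1 by rewrite ltr_wpDl ?normc_ge0.
    exists (r / (normc (s - (d + 1)%:C) + 1)); first by rewrite divr_gt0.
    have pd u : `|u - t| < r / (normc (s - (d + 1)%:C) + 1) -> normc (p u - p t) < r.
      move=> ut; have -> : p u - p t = (u - t)%:C * (s - (d + 1)%:C).
        by rewrite /p rmorphB /=; ring.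
      rewrite normcM normc_real; rewrite ltr_pdivlMr// in ut.
      apply: le_lt_trans ut; apply: ler_wpM2l => //.
      by rewrite lerDl.
    by move=> u v /pd ut /pd vt; exact: rP.
  exists 1 => // w _; rewrite /p mul0r addr0 => w1; rewrite /h fg ?subrr//.
  have := le_lt_trans (normr_Re_le _) w1; rewrite ReD ReN /= ltr_norml.
  by move=> /andP[? _]; lra.
move=> s dg; have [e e0 hs] := Uall s.
have fgs w : w != s -> normc (w - s) < e -> f w = g w.
  by move=> ws we; apply: subr0_eq; exact: hs.
have near_pt (r : R) : 0 < r -> exists w : C, [/\ w != s, normc (w - s) < e & normc (w - s) < r].
  move=> r0; pose m := Num.min e r / 2.
  have m0 : 0 < m by rewrite divr_gt0// lt_min e0.
  have mlt : m < Num.min e r by rewrite ltr_pdivrMr// ltr_pMr ?ltr1n// lt_min e0.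
  have nE : normc (s + m%:C - s) = m.
    by rewrite addrC addKr normc_real gtr0_norm.
  exists (s + m%:C); rewrite nE; move: mlt; rewrite lt_min => /andP[-> ->]; split => //.
  by rewrite -subr_eq0 -normc_eq0 nE gt_eqF.
have [df|pf] := (mf s).2.
  have [//|fgn] := eqVneq (f s) (g s); exfalso.
  have n0 : 0 < normc (f s - g s) by rewrite normc_gt0 subr_eq0.
  have [r1 r10 fP] := derivable_ccontinuous df (divr_gt0 n0 (ltr0n _ 2)).
  have [r2 r20 gP] := derivable_ccontinuous dg (divr_gt0 n0 (ltr0n _ 2)).
  have [w [ws we]] := near_pt (Num.min r1 r2) ltac:(by rewrite lt_min r10).
  rewrite lt_min => /andP[/fP w1 /gP w2]; rewrite fgs// in w1.
  have := normcB (g w - g s) (g w - f s).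
  have -> : g w - g s - (g w - f s) = f s - g s by ring.
  by apply/negP; rewrite -ltNge [ltRHS]splitr ltrD.
(* A pole of [f] at [s] is impossible: [g] is bounded near [s] and equals [f] off [s]. *)
have [r r0 gP] := derivable_ccontinuous dg (ltr01 : (0 : R) < 1).
have : \forall w \near s^', ((normc (g s) + 1)%:C < `|f w|)%R.
  apply: (pf [set x | (normc (g s) + 1)%:C < x]); exists (normc (g s) + 1)%:C.
  by split=> //; rewrite realE ler0c addr_ge0 ?normc_ge0.
move=> /dnbhscP[r2 r20 fP].
have [w [ws we]] := near_pt (Num.min r r2) ltac:(by rewrite lt_min r0).
rewrite lt_min => /andP[/gP w1 /(fP w ws)].
rewrite fgs// normr_normc ltcR.
have := normcD (g w - g s) (g s); rewrite subrK => h1 h2.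
exfalso; move: h1 h2 w1; lra.
Qed.

End Meromorphic.

(** * Unconditional sums *)

Section UnconditionalSums.
Variable R : realType.
Local Notation C := R[i].

Definition nnsummable (I : choiceType) (g : I -> R) :=
  (forall i, 0 <= g i) /\
  exists M, forall J : seq I, uniq J -> \sum_(i <- J) g i <= M.

(** Duplicate-free lists stand for finite subsets, which makes the [bigop] lemmas on sequences
    available; [sum_has_csum] returns to [summability.sum] at the end. *)
Definition has_csum (I : choiceType) (f : I -> C) (s : C) :=
  forall e : R, 0 < e -> exists J0 : seq I, forall J, uniq J ->
    {subset J0 <= J} -> normc (s - \sum_(i <- J) f i) < e.

Definition csum (I : choiceType) (f : I -> C) : C := xget 0 [set s | has_csum f s].

Definition csummable (I : choiceType) (f : I -> C) :=
  nnsummable (fun i => normc (f i)).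

Section Basics.
Variable I : choiceType.
Implicit Types (f g : I -> C) (J K : seq I).

Lemma big_uniq_split (V : nmodType) (F : I -> V) J K : uniq J -> uniq K ->
  {subset J <= K} ->
  \sum_(i <- K) F i = \sum_(i <- J) F i + \sum_(i <- [seq i <- K | i \notin J]) F i.
Proof.
move=> uJ uK JK; rewrite -big_cat /=; apply: perm_big; apply: uniq_perm => //.
  rewrite cat_uniq uJ filter_uniq//= andbT; apply/hasPn => i.
  by rewrite mem_filter => /andP[].
move=> i; rewrite mem_cat mem_filter; case: (boolP (i \in J)) => //= /JK.
by move=> ->.
Qed.

Lemma ler_sum_uniq (g : I -> R) J K : (forall i, 0 <= g i) -> uniq J -> uniq K ->
  {subset J <= K} -> \sum_(i <- J) g i <= \sum_(i <- K) g i.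
Proof.
move=> g0 uJ uK JK; rewrite (big_uniq_split g uJ uK JK) lerDl.
by apply: sumr_ge0.
Qed.

Lemma uniq_undup_cat J K : uniq (undup (J ++ K)) /\
  {subset J <= undup (J ++ K)} /\ {subset K <= undup (J ++ K)}.
Proof.
by split; [exact: undup_uniq|split=> i; rewrite mem_undup mem_cat => ->]; rewrite ?orbT.
Qed.

Lemma has_csum_unique f s t : has_csum f s -> has_csum f t -> s = t.
Proof.
move=> hs ht; apply/subr0_eq/eq0_normc/le_anti; rewrite normc_ge0 andbT.
apply/ler_addgt0Pr => e e0; rewrite add0r.
have e2 : 0 < e / 2 by rewrite divr_gt0.
have [J1 h1] := hs _ e2; have [J2 h2] := ht _ e2.
have [u [s1 s2]] := uniq_undup_cat J1 J2.
have := h1 _ u s1; have := h2 _ u s2; move: (\sum_(i <- _) _) => x.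
move=> hx hy; have -> : s - t = (s - x) - (t - x) by ring.
by apply: (le_trans (normcB _ _)); rewrite (splitr e) ltW// ltrD.
Qed.

Lemma csum_unique f s : has_csum f s -> csum f = s.
Proof.
move=> hs; rewrite /csum; case: xgetP => [t _ ht|/(_ s)//].
exact: has_csum_unique ht hs.
Qed.

Lemma has_csumD f g s t : has_csum f s -> has_csum g t ->
  has_csum (fun i => f i + g i) (s + t).
Proof.
move=> hs ht e e0; have e2 : 0 < e / 2 by rewrite divr_gt0.
have [J1 h1] := hs _ e2; have [J2 h2] := ht _ e2.
exists (J1 ++ J2) => J u sub; rewrite big_split /=.
rewrite opprD addrACA; apply: (le_lt_trans (normcD _ _)).
rewrite (splitr e) ltrD//; [apply: h1|apply: h2] => // i iJ; apply: sub.
  by rewrite mem_cat iJ.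
by rewrite mem_cat iJ orbT.
Qed.

Lemma has_csumZ (c : C) f s : has_csum f s -> has_csum (fun i => c * f i) (c * s).
Proof.
move=> hs e e0; have c1 : 0 < normc c + 1 by rewrite ltr_wpDl ?normc_ge0.
have [J0 h] := hs _ (divr_gt0 e0 c1); exists J0 => J u /(h _ u).
rewrite -mulr_sumr -mulrBr normcM ltr_pdivlMr// => h1.
by apply: le_lt_trans h1; rewrite mulrC ler_wpM2l ?normc_ge0// lerDl.
Qed.

Lemma has_csumN f s : has_csum f s -> has_csum (fun i => - f i) (- s).
Proof.
move=> /(has_csumZ (-1)); rewrite mulN1r.
by have -> : (fun i => -1 * f i) = (fun i => - f i) by apply/funext => i; rewrite mulN1r.
Qed.

Lemma normc_has_csum_le f s (M : R) : has_csum f s ->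
  (forall J, uniq J -> \sum_(i <- J) normc (f i) <= M) -> normc s <= M.
Proof.
move=> hs hM; apply/ler_addgt0Pr => e e0; have [J0 h] := hs _ e0.
have := h (undup J0) (undup_uniq _) ltac:(by move=> i; rewrite mem_undup).
move=> h1; rewrite -(subrK (\sum_(i <- undup J0) f i) s) addrC.
apply: (le_trans (normcD _ _)); apply: lerD; last exact: ltW.
by apply: (le_trans (normc_sum _ _ _)); apply: hM; exact: undup_uniq.
Qed.

Lemma nnsummable_le (g h : I -> R) : (forall i, 0 <= g i <= h i) ->
  nnsummable h -> nnsummable g.
Proof.
move=> gh [h0 [M hM]]; split=> [i|]; first by have /andP[] := gh i.
exists M => J uJ; apply: le_trans (hM J uJ); apply: ler_sum => i _.
by have /andP[] := gh i.
Qed.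

Lemma nnsummableZ (c : R) (g : I -> R) : 0 <= c -> nnsummable g ->
  nnsummable (fun i => c * g i).
Proof.
move=> c0 [g0 [M hM]]; split=> [i|]; first by rewrite mulr_ge0.
by exists (c * M) => J uJ; rewrite -mulr_sumr ler_wpM2l// hM.
Qed.

Lemma nnsummable_tail (g : I -> R) (e : R) : nnsummable g -> 0 < e ->
  exists J0 : seq I, uniq J0 /\ forall K, uniq K -> (forall i, i \in K -> i \notin J0) ->
    \sum_(i <- K) g i < e.
Proof.
move=> [g0 [M hM]] e0.
pose A := [set x | exists2 J : seq I, uniq J & x = \sum_(i <- J) g i].
have A0 : A 0 by exists [::] => //; rewrite big_nil.
have supA : has_sup A by split; [exists 0|exists M => _ [J uJ ->]; exact: hM].
have [_ [J0 u0 ->] lt0] := @sup_adherent _ A e e0 supA.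
exists J0; split=> // K uK KJ.
have uc : uniq (J0 ++ K).
  by rewrite cat_uniq u0 uK andbT; apply/hasPn => i /KJ.
have : \sum_(i <- J0 ++ K) g i <= sup A.
  by apply: ub_le_sup; [case: supA|exists (J0 ++ K)].
rewrite big_cat /= => h; move: lt0; rewrite ltrBlDr => /(le_lt_trans h).
by rewrite ltrD2l.
Qed.

Lemma nnsummable_has_csum (g : I -> R) : nnsummable g ->
  exists s : R, has_csum (fun i => (g i)%:C) s%:C.
Proof.
move=> sg; have [g0 [M hM]] := sg.
pose A := [set x | exists2 J : seq I, uniq J & x = \sum_(i <- J) g i].
have A0 : A 0 by exists [::] => //; rewrite big_nil.
have supA : has_sup A by split; [exists 0|exists M => _ [J uJ ->]; exact: hM].
exists (sup A) => e e0.
have [_ [J0 u0 ->] lt0] := @sup_adherent _ A e e0 supA.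
exists J0 => J uJ sub; rewrite -rmorph_sum -rmorphB normc_real ger0_norm.
  rewrite ltrBlDr addrC -ltrBlDr; apply: (lt_le_trans lt0).
  exact: ler_sum_uniq.
by rewrite subr_ge0; apply: ub_le_sup; [case: supA|exists J].
Qed.

Lemma csummable_has_csum f : csummable f -> has_csum f (csum f).
Proof.
move=> sf.
suff [s hs] : exists s, has_csum f s by rewrite (csum_unique hs).
have real_case (u : I -> R) : (forall i, `|u i| <= normc (f i)) ->
    exists s : R, has_csum (fun i => (u i)%:C) s%:C.
  (* The family u + |f| lies between 0 and 2 |f|, so the signed family [u] is a difference of two
     summable nonnegative ones. *)
  move=> uf; have s1 : nnsummable (fun i => u i + normc (f i)).
    apply: (@nnsummable_le _ (fun i => 2 * normc (f i))).
      move=> i; have := uf i; rewrite ler_norml => /andP[h1 h2].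
      by apply/andP; split; lra.
    exact: nnsummableZ.
  have [a ha] := nnsummable_has_csum s1; have [b hb] := nnsummable_has_csum sf.
  exists (a - b); rewrite rmorphB.
  have := has_csumD ha (has_csumN hb).
  have -> // : (fun i => (u i + normc (f i))%:C - (normc (f i))%:C) = fun i => (u i)%:C.
  by apply/funext => i; rewrite rmorphD addrK.
have [a ha] := real_case (fun i => complex.Re (f i)) (fun i => normr_Re_le _).
have [b hb] := real_case (fun i => complex.Im (f i)) (fun i => normr_Im_le _).
exists (a%:C + 'i * b%:C); have := has_csumD ha (has_csumZ 'i hb).
have -> // : (fun i => (complex.Re (f i))%:C + 'i * (complex.Im (f i))%:C) = f.
by apply/funext => i; rewrite -complexE.
Qed.

Lemma csummable_le f (g : I -> R) : (forall i, normc (f i) <= g i) ->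
  nnsummable g -> csummable f.
Proof.
by move=> fg; apply: nnsummable_le => i; rewrite normc_ge0 fg.
Qed.

Lemma csummableZ c f : csummable f -> csummable (fun i => c * f i).
Proof.
move=> sf; apply: csummable_le (nnsummableZ (normc_ge0 c) sf) => i.
by rewrite normcM.
Qed.

Lemma csumZ c f : csummable f -> csum (fun i => c * f i) = c * csum f.
Proof. by move=> sf; apply/csum_unique/has_csumZ/csummable_has_csum. Qed.

Lemma normc_csum_le f (M : R) : csummable f ->
  (forall J, uniq J -> \sum_(i <- J) normc (f i) <= M) -> normc (csum f) <= M.
Proof. by move=> /csummable_has_csum; exact: normc_has_csum_le. Qed.

Lemma normc_csum_sub_le f (g : I -> R) (J : seq I) (e : R) : csummable f -> uniq J ->
  (forall i, normc (f i) <= g i) ->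
  (forall K, uniq K -> (forall i, i \in K -> i \notin J) -> \sum_(i <- K) g i < e) ->
  normc (csum f - \sum_(i <- J) f i) <= e.
Proof.
move=> sf uJ fg tail; apply/ler_addgt0Pr => d d0.
have [J1 h1] := csummable_has_csum sf d0.
have [u [s1 s2]] := uniq_undup_cat J J1.
have := h1 _ u s2; rewrite (big_uniq_split f uJ u s1).
set K := [seq _ <- _ | _]; move=> h2.
have uK : uniq K by rewrite filter_uniq.
have h3 : normc (\sum_(i <- K) f i) < e.
  apply: (le_lt_trans (normc_sum _ _ _)).
  apply: (@le_lt_trans _ _ (\sum_(i <- K) g i)); first exact: ler_sum.
  by apply: tail => // i; rewrite mem_filter => /andP[].
move: h2 h3; move: (\sum_(i <- K) f i) (\sum_(i <- J) f i) => x y h2 h3.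
have -> : csum f - y = x + (csum f - (y + x)) by ring.
by apply: (le_trans (normcD _ _)); rewrite lerD// ltW.
Qed.

(** Tannery's theorem. Outside a finite list the common majorant keeps both tails below [e / 4]; on
    the list convergence is termwise. The majorant passes to the limit [f], whence its
    summability. *)
Lemma csum_tannery (f_ : nat -> I -> C) f (g : I -> R) : nnsummable g ->
  (forall n i, normc (f_ n i) <= g i) ->
  (forall i (e : R), 0 < e -> \forall n \near \oo, normc (f i - f_ n i) < e) ->
  csummable f /\
  forall e : R, 0 < e -> \forall n \near \oo, normc (csum f - csum (f_ n)) < e.
Proof.
move=> sg fg ff.
have fg' i : normc (f i) <= g i.
  apply/ler_addgt0Pr => e e0; have [n _ nP] := ff i e e0.
  have /= h := nP n (leqnn n).
  rewrite -(subrK (f_ n i) (f i)) addrC; apply: (le_trans (normcD _ _)).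
  by rewrite lerD// ltW.
have sf : csummable f by apply: csummable_le sg.
split=> // e e0; have e4 : 0 < e / 4 by rewrite divr_gt0.
have [J [uJ tail]] := nnsummable_tail sg e4.
have h1 := normc_csum_sub_le sf uJ fg' tail.
have h2 n := normc_csum_sub_le (csummable_le (fg n) sg) uJ (fg n) tail.
have h3 : \forall n \near \oo, normc (\sum_(i <- J) f i - \sum_(i <- J) f_ n i) < e / 4.
  have : forall d : R, 0 < d ->
      \forall n \near \oo, normc (\sum_(i <- J) f i - \sum_(i <- J) f_ n i) < d.
    move: (J : seq I) => K; elim: K => [|i K IH] d d0.
      by near=> n; rewrite !big_nil subrr normc0.
    have d2 : 0 < d / 2 by rewrite divr_gt0.
    have := IH _ d2; have := ff i _ d2; apply: filterS2 => n h1' h2'.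
    rewrite !big_cons opprD addrACA; apply: (le_lt_trans (normcD _ _)).
    by rewrite (splitr d) ltrD.
  exact.
move: h3; apply: filterS => n h3.
have -> : csum f - csum (f_ n) = (csum f - \sum_(i <- J) f i) +
    (\sum_(i <- J) f i - \sum_(i <- J) f_ n i) - (csum (f_ n) - \sum_(i <- J) f_ n i).
  by ring.
apply: (le_lt_trans (normcB _ _)).
have := normcD (csum f - \sum_(i <- J) f i) (\sum_(i <- J) f i - \sum_(i <- J) f_ n i).
have := h2 n; move: h1 h3 e0; clear; do 4 (move: (normc _) => ?).
lra.
Unshelve. all: by end_near. Qed.

Lemma csum_single f (i0 : I) : (forall i, i != i0 -> f i = 0) -> has_csum f (f i0).
Proof.
move=> f0 e e0; exists [:: i0] => J uJ sub.
rewrite (big_uniq_split f (J := [:: i0]))// big_seq1 big1_seq ?addr0 ?subrr ?normc0//.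
move=> i; rewrite mem_filter mem_seq1 => /andP[_ /andP[? _]]; exact: f0.
Qed.

End Basics.

Section Reindex.
Variables (I T : choiceType) (phi : I -> T).
Hypothesis phi_inj : injective phi.

Lemma nnsummable_comp (g : T -> R) : nnsummable g -> nnsummable (fun i => g (phi i)).
Proof.
move=> [g0 [M hM]]; split=> [i //|]; exists M => J uJ.
by rewrite -(big_map phi predT g) hM// map_inj_uniq.
Qed.

Lemma csummable_comp (f : T -> C) : csummable f -> csummable (fun i => f (phi i)).
Proof. exact: nnsummable_comp. Qed.

(** A list in [T] is pulled back to [I] by [pmap] along the partial inverse [psi]; the entries
    outside the image are dropped, where [F] is 0. This is how sums over residue classes, over
    finite ranges and over coordinates of lattice points are compared with sums over the ambient
    type. *)
Lemma has_csum_extend (f : I -> C) (F : T -> C) s :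
  (forall i, F (phi i) = f i) -> (forall t, (forall i, t <> phi i) -> F t = 0) ->
  has_csum f s -> has_csum F s.
Proof.
move=> Ff F0 hf e e0; have [J0 h] := hf e e0.
exists (map phi J0) => J uJ sub.
pose psi (t : T) : option I :=
  if pselect (exists i, t = phi i) is left h then Some (projT1 (cid h)) else None.
have psiK i : psi (phi i) = Some i.
  rewrite /psi; case: pselect => [h'|[]]; last by exists i.
  by congr Some; apply: phi_inj; rewrite -(projT2 (cid h')).
have psiN t i : psi t = Some i -> t = phi i.
  by rewrite /psi; case: pselect => // h' [<-]; exact: (projT2 (cid h')).
pose K := pmap psi J.
have -> : \sum_(t <- J) F t = \sum_(i <- K) f i.
  rewrite /K; elim: (J) => [|t J' IH]; first by rewrite !big_nil.
  rewrite big_cons IH /=; case E: (psi t) => [i|] /=.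
    by rewrite big_cons (psiN _ _ E) Ff.
  rewrite F0 ?add0r// => i ti; move: E; rewrite ti psiK//.
apply: h.
  rewrite /K -(map_inj_uniq phi_inj) -(@map_inj_uniq _ _ (@Some T)); last by move=> ? ? [].
  have -> : map Some (map phi (pmap psi J)) = [seq Some t | t <- J & psi t].
    elim: (J) => //= t J' IH; case E: (psi t) => [i|] //=.
    by rewrite -IH (psiN _ _ E).
  by rewrite map_inj_uniq ?filter_uniq// => ? ? [].
move=> i iJ0; rewrite /K mem_pmap; apply/mapP; exists (phi i); last by rewrite psiK.
by apply/sub/map_f.
Qed.

End Reindex.

Lemma csum_reindex (I T : choiceType) (phi : I -> T) (psi : T -> I) (f : T -> C) :
  cancel phi psi -> cancel psi phi -> csummable f ->
  csum (fun i => f (phi i)) = csum f.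
Proof.
move=> c1 c2 sf; apply/esym/csum_unique.
apply: (@has_csum_extend _ _ phi (can_inj c1) (fun i => f (phi i))) => //.
  by move=> t /(_ (psi t)); rewrite c2.
by apply/csummable_has_csum/(csummable_comp (can_inj c1)).
Qed.

Section Fubini.
Variables (I K : choiceType).

Lemma nnsummable_prod (g : I -> R) (h : K -> R) : nnsummable g -> nnsummable h ->
  nnsummable (fun x : I * K => g x.1 * h x.2).
Proof.
move=> [g0 [M hM]] [h0 [N hN]]; split=> [x|]; first by rewrite mulr_ge0.
exists (M * N) => J uJ.
have sub : {subset J <= [seq (i, k) | i <- undup (map fst J), k <- undup (map snd J)]}.
  move=> [i k] iJ; apply: allpairs_f; rewrite mem_undup.
    exact: (map_f fst iJ).
  exact: (map_f snd iJ).
have uP : uniq [seq (i, k) | i <- undup (map fst J), k <- undup (map snd J)].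
  by apply: allpairs_uniq; rewrite ?undup_uniq// => -[? ?] [? ?] _ _ [-> ->].
apply: (le_trans (ler_sum_uniq _ uJ uP sub)); first by move=> x; rewrite mulr_ge0.
rewrite big_allpairs /= .
under eq_bigr => i _ do rewrite -mulr_sumr.
rewrite -mulr_suml; apply: ler_pM.
- by apply: sumr_ge0.
- by apply: sumr_ge0.
- by rewrite hM ?undup_uniq.
- by rewrite hN ?undup_uniq.
Qed.

Lemma csummable_row (f : I * K -> C) (i : I) : csummable f ->
  csummable (fun k => f (i, k)).
Proof. by apply: csummable_comp => ? ? []. Qed.

Lemma csum_fubini (f : I * K -> C) : csummable f ->
  has_csum (fun i => csum (fun k => f (i, k))) (csum f).
Proof.
move=> sf e e0; have e2 : 0 < e / 2 by rewrite divr_gt0.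
have [J0 h0] := csummable_has_csum sf e2.
exists (map fst J0) => J uJ sub.
(* The error allowed in each of the [size J] rows; the successor keeps the denominator nonzero for
   the empty list. *)
pose d := e / 2 / (size J).+1%:R.
have d0 : 0 < d by rewrite divr_gt0.
have [L hL] : exists L : I -> seq K, forall i (K' : seq K), uniq K' -> {subset L i <= K'} ->
    normc (csum (fun k => f (i, k)) - \sum_(k <- K') f (i, k)) < d.
  have h i := csummable_has_csum (csummable_row i sf) d0.
  by exists (fun i => projT1 (cid (h i))) => i; exact: (projT2 (cid (h i))).
(* One list of columns for all rows: it contains each [L i] with [i] in [J], and enough columns to
   make the product list cover [J0]. *)
pose K' := undup (map snd J0 ++ flatten (map L J)).
have uK' : uniq K' := undup_uniq _.
have LK i : i \in J -> {subset L i <= K'}.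
  move=> iJ k kL; rewrite mem_undup mem_cat; apply/orP; right.
  by apply/flattenP; exists (L i) => //; apply: map_f.
have uP : uniq [seq (i, k) | i <- J, k <- K'].
  by apply: allpairs_uniq => // -[? ?] [? ?] _ _ [-> ->].
have := h0 _ uP; rewrite big_allpairs /= => h1.
have {}h1 : normc (csum f - \sum_(i <- J) \sum_(k <- K') f (i, k)) < e / 2.
  apply: h1 => -[i k] ik; apply: allpairs_f; first by apply: sub; exact: (map_f fst ik).
  by rewrite mem_undup mem_cat (map_f snd ik).
have h2 : normc (\sum_(i <- J) \sum_(k <- K') f (i, k) -
    \sum_(i <- J) csum (fun k => f (i, k))) <= e / 2.
  rewrite -sumrB; apply: (le_trans (normc_sum _ _ _)).
  apply: (@le_trans _ _ (\sum_(i <- J) d)).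
    rewrite big_seq [leRHS]big_seq; apply: ler_sum => i iJ.
    by rewrite normc_distC; apply/ltW/hL => //; exact: LK.
  rewrite big_const_seq count_predT iter_addr_0.
  have -> : d *+ size J = e / 2 * ((size J)%:R / (size J).+1%:R).
    by rewrite /d -[LHS]mulr_natr mulrAC mulrA.
  by rewrite ler_piMr ?ltW// ltr_pdivrMr// mul1r ltr_nat.
move: h1 h2; move: (csum f) (\sum_(i <- J) _) (\sum_(i <- J) _) => x z y h1 h2.
have -> : x - z = (x - y) + (y - z) by ring.
by apply: (le_lt_trans (normcD _ _)); rewrite (splitr e) ltr_leD.
Qed.

End Fubini.

Lemma csum_exchange (I K : choiceType) (f : I * K -> C) (F : I -> C) (G : K -> C) :
  csummable f -> (forall i, csum (fun k => f (i, k)) = F i) ->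
  (forall k, csum (fun i => f (i, k)) = G k) -> csum F = csum G.
Proof.
move=> sf hF hG.
have h1 := csum_fubini sf.
have cK : cancel (fun x : K * I => (x.2, x.1)) (fun x : I * K => (x.2, x.1)) by case.
have cK' : cancel (fun x : I * K => (x.2, x.1)) (fun x : K * I => (x.2, x.1)) by case.
have h2 := csum_fubini (csummable_comp (can_inj cK) sf).
rewrite (csum_reindex cK cK' sf) in h2.
have -> : F = fun i => csum (fun k => f (i, k)) by apply/funext => i; rewrite hF.
have -> : G = fun k => csum (fun i => f (i, k)) by apply/funext => i; rewrite hG.
by rewrite (csum_unique h1) (csum_unique h2).
Qed.

End UnconditionalSums.

(** * Polya's finite identity *)

Section Binomial.
Variable R : realType.

(** The symmetric binomial weight relative to its central value; for j of the order of sqrt m it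
    behaves like exp (- j^2 / m). *)
Definition bin_ratio (m j : nat) : R := 'C(m.*2, m + j)%:R / 'C(m.*2, m)%:R.

Lemma bin_central_gt0 m : (0 : R) < 'C(m.*2, m)%:R.
Proof. by rewrite ltr0n bin_gt0 -addnn leq_addr. Qed.

Lemma bin_ratio0 m : bin_ratio m 0 = 1.
Proof. by rewrite /bin_ratio addn0 divff// gt_eqF// bin_central_gt0. Qed.

Lemma bin_ratio_ge0 m j : 0 <= bin_ratio m j.
Proof. by rewrite /bin_ratio divr_ge0. Qed.

Lemma bin_ratioS m j : (j <= m)%N ->
  bin_ratio m j.+1 = bin_ratio m j * ((m%:R - j%:R) / (m%:R + j%:R + 1)).
Proof.
move=> jm; have D : m%:R + j%:R + 1 != 0 :> R by rewrite -natrD natr1 pnatr_eq0.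
have := congr1 (fun k => k%:R : R) (mul_bin_left m.*2 (m + j)).
rewrite !natrM -addnn subnDl natrB// -addnS => H.
have {}H : 'C(m + m, m + j.+1)%:R =
    (m%:R - j%:R) * 'C(m + m, m + j)%:R / (m%:R + j%:R + 1) :> R.
  rewrite -H natrD -addn1 natrD addrA mulrAC divff ?mul1r//.
by rewrite /bin_ratio -addnn H; field; rewrite D gt_eqF// addnn bin_central_gt0.
Qed.

Lemma bin_ratio_gt m j : (m < j)%N -> bin_ratio m j = 0.
Proof. by move=> mj; rewrite /bin_ratio bin_small ?mul0r// -addnn ltn_add2l. Qed.

(** Successive quotients are 1 - (2 i + 1) / (m + i + 1) <= exp (- (2 i + 1) / D), and the odd
    numbers below 2 j add up to j^2. The parameter [D] is left free: D = 2 m gives a uniform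
    majorant, D = m + j the sharp asymptotics. *)
Lemma bin_ratio_le m j (D : R) : (j <= m)%N ->
  (forall i, (i < j)%N -> m%:R + i%:R + 1 <= D) ->
  bin_ratio m j <= expR (- (j%:R ^+ 2 / D)).
Proof.
elim: j => [|j IH] jm hD; first by rewrite bin_ratio0 expr0n mul0r oppr0 expR0.
rewrite bin_ratioS; last exact: ltnW.
have D1 := hD j (leqnn _).
have d0 : (0 : R) < m%:R + j%:R + 1 by rewrite ltr_wpDl// addr_ge0.
have D0 : 0 < D by apply: lt_le_trans D1.
have step : (m%:R - j%:R) / (m%:R + j%:R + 1) <= expR (- ((2 * j%:R + 1) / D)).
  apply: (@le_trans _ _ (1 - (2 * j%:R + 1) / D)); last first.
    by have := expR_ge1Dx (- ((2 * j%:R + 1) / D)).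
  rewrite ler_pdivrMr// mulrBl mul1r lerBrDr -lerBrDl.
  have -> : m%:R + j%:R + 1 - (m%:R - j%:R) = 2 * j%:R + 1 :> R by ring.
  rewrite mulrAC ler_pdivrMr//.
  by rewrite ler_wpM2l// addr_ge0// mulr_ge0.
apply: (@le_trans _ _ (expR (- (j%:R ^+ 2 / D)) * expR (- ((2 * j%:R + 1) / D)))).
  apply: ler_pM step; [exact: bin_ratio_ge0| |].
    by rewrite divr_ge0 ?(ltW d0)// subr_ge0 ler_nat ltnW// ltnW.
  by apply: IH => [|i ij]; [exact: ltnW|apply/hD/ltnW].
rewrite -expRD ler_expR -opprD -mulrDl lerN2 -[j.+1%:R]natr1.
by rewrite ler_wpM2r ?invr_ge0 ?(ltW D0)// le_eqVlt; apply/orP; left; apply/eqP; ring.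
Qed.

(** As in [bin_ratio_le], but for the reciprocal quotients 1 + (2 i + 1) / (m - i). *)
Lemma bin_ratio_ge m j (D : R) : 0 < D -> (j <= m)%N -> D <= m%:R - j%:R ->
  expR (- (j%:R ^+ 2 / D)) <= bin_ratio m j.
Proof.
move=> D0; elim: j => [|j IH] jm hD; first by rewrite bin_ratio0 expr0n mul0r oppr0 expR0.
rewrite bin_ratioS; last exact: ltnW.
have D1 : D <= m%:R - j%:R.
  by apply: le_trans hD _; rewrite lerB// ler_nat.
have d0 : (0 : R) < m%:R - j%:R by apply: lt_le_trans D1.
have d1 : (0 : R) < m%:R + j%:R + 1 by rewrite ltr_wpDl// addr_ge0.
have step : expR (- ((2 * j%:R + 1) / D)) <= (m%:R - j%:R) / (m%:R + j%:R + 1).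
  rewrite expRN -[leRHS]invrK lef_pV2 ?posrE ?expR_gt0 ?invr_gt0 ?divr_gt0//.
  apply: (@le_trans _ _ (1 + (2 * j%:R + 1) / D)); last exact: expR_ge1Dx.
  rewrite invf_div.
  have -> : (m%:R + j%:R + 1) / (m%:R - j%:R) = 1 + (2 * j%:R + 1) / (m%:R - j%:R) :> R.
    by field; rewrite gt_eqF.
  rewrite lerD2l; apply: ler_wpM2l; first by rewrite addr_ge0// mulr_ge0.
  by rewrite lef_pV2.
apply: (@le_trans _ _ (expR (- (j%:R ^+ 2 / D)) * expR (- ((2 * j%:R + 1) / D)))).
  rewrite -expRD ler_expR -opprD -mulrDl lerN2 -[j.+1%:R]natr1.
  by rewrite ler_wpM2r ?invr_ge0 ?(ltW D0)// le_eqVlt; apply/orP; left; apply/eqP; ring.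
by apply: ler_pM step; rewrite ?expR_ge0//; apply: IH => //; exact: ltnW.
Qed.

Definition bin_central (m : nat) : R := 'C(m.*2, m)%:R / 4 ^+ m.

Lemma bin_centralS m :
  bin_central m.+1 = bin_central m * ((2 * m%:R + 1) / (2 * m%:R + 2)).
Proof.
have h1 := congr1 (fun k => k%:R : R) (mul_bin_diag m.+1.*2 m).
have h2 := congr1 (fun k => k%:R : R) (mul_bin_diag m.*2.+1 m).
rewrite !natrM doubleS /= in h1 h2.
have e1 : 'C(m.*2.+1, m) = 'C(m.*2.+1, m.+1).
  by rewrite -bin_sub; [congr 'C(_, _); rewrite -addnn; lia|rewrite -addnn; lia].
rewrite /bin_central doubleS exprS; rewrite e1 in h1.
have m2 : m.*2.+1%:R = 2 * m%:R + 1 :> R by rewrite -addn1 natrD -mul2n natrM.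
have m3 : m.*2.+2%:R = 2 * m%:R + 2 :> R by rewrite -addn2 natrD -mul2n natrM.
have m1 : m.+1%:R = m%:R + 1 :> R by rewrite -addn1 natrD.
rewrite m1 m2 in h2; rewrite m1 m3 in h1.
have n1 : m%:R + 1 != 0 :> R by rewrite -m1 pnatr_eq0.
have -> : 'C(m.*2.+2, m.+1)%:R = (2 * m%:R + 2) / (m%:R + 1) * 'C(m.*2.+1, m.+1)%:R :> R.
  by apply: (mulfI n1); rewrite -h1; field.
have -> : 'C(m.*2.+1, m.+1)%:R = (2 * m%:R + 1) / (m%:R + 1) * 'C(m.*2, m)%:R :> R.
  by apply: (mulfI n1); rewrite -h2; field.
have n2 : 2 * m%:R + 2 != 0 :> R by rewrite -m3 pnatr_eq0.
field; rewrite n1 n2 expf_neq0//.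
Qed.

(** Wallis's argument: the sequence is nondecreasing, while (2 m + 1) b_m^2 starts at 1 and does not
    increase. The value of the limit is determined later, in [theta_one]. *)
Lemma bin_central_cvg : exists2 V : R, 0 < V &
  (fun m : nat => m%:R * bin_central m ^+ 2) @ \oo --> V.
Proof.
pose v (m : nat) : R := m%:R * bin_central m ^+ 2.
have vS m : v m <= v m.+1.
  rewrite /v bin_centralS -[m.+1%:R]natr1; move: (bin_central m) => b.
  rewrite exprMn (mulrC (b ^+ 2)) [leRHS]mulrA ler_wpM2r ?sqr_ge0//.
  have n2 : 0 < 2 * m%:R + 2 :> R by rewrite ltr_wpDl// mulr_ge0.
  rewrite expr_div_n [leRHS]mulrA ler_pdivlMr ?exprn_gt0//.
  have : (0 : R) <= m%:R by [].
  by move: (m%:R : R) => t t0; rewrite !expr2; nra.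
have ub m : (2 * m%:R + 1) * bin_central m ^+ 2 <= 1.
  elim: m => [|m IH]; first by rewrite /bin_central bin0 expr0 mulr0 add0r divr1 expr1n mulr1.
  apply: le_trans IH; rewrite bin_centralS -[m.+1%:R]natr1; move: (bin_central m) => b.
  rewrite exprMn (mulrC (b ^+ 2)) [leLHS]mulrA ler_wpM2r ?sqr_ge0//.
  have n2 : 0 < 2 * m%:R + 2 :> R by rewrite ltr_wpDl// mulr_ge0.
  rewrite expr_div_n [leLHS]mulrA ler_pdivrMr ?exprn_gt0//.
  have : (0 : R) <= m%:R by [].
  by move: (m%:R : R) => t t0; rewrite !expr2; nra.
have nd : nondecreasing_seq v by apply/nondecreasing_seqP.
have cv : cvgn v.
  apply: nondecreasing_is_cvgn => //; exists 1 => _ [m _ <-].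
  apply: le_trans (ub m); rewrite /v ler_wpM2r ?sqr_ge0//.
  by have : (0 : R) <= m%:R by []; lra.
exists (limn v) => //; apply: (@lt_le_trans _ _ (v 1%N)).
  by rewrite /v mul1r exprn_gt0// /bin_central divr_gt0.
exact: nondecreasing_cvgn_le.
Qed.

End Binomial.

Section PolyaIdentity.
Variable R : realType.
Local Notation C := R[i].

Lemma has_csum_fin (I : finType) (f : I -> C) : has_csum f (\sum_i f i).
Proof.
move=> e e0; exists (enum I) => J uJ sub.
have -> : \sum_(i <- J) f i = \sum_i f i.
  rewrite -[RHS]big_enum /=; apply: perm_big; apply: uniq_perm => //.
    exact: enum_uniq.
  by move=> i; rewrite sub ?mem_enum.
by rewrite subrr normc0.
Qed.

Lemma cis_eq1 (t : R) : cis (2 * pi * t) = 1 -> exists n : int, t = n%:~R.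
Proof.
pose n := Num.floor t; pose u := t - n%:~R => h; exists n; apply/subr0_eq.
have {}h : cis (2 * pi * u) = 1.
  by rewrite /u mulrBr cisD h -mulrN -mulrNz cis2pi_int mulr1.
have /andP[n1 n2] := floor_itv t.
have u0 : 0 <= u by rewrite subr_ge0.
have u1 : u < 1 by rewrite /u ltrBlDl -intrD1.
move: h; rewrite cisE => -[h _]; have := onem_cosE (2 * pi * u).
rewrite h subrr => /esym/eqP; rewrite mulf_eq0 pnatr_eq0 /= sqrf_eq0 => /eqP.
have -> : 2 * pi * u / 2 = pi * u by field.
move: u0; rewrite le_eqVlt => /predU1P[//|u0] s0.
have := @sin_gt0_pi R (pi * u); rewrite s0 ltxx.
have pi0 := pi_gt0 R.
by rewrite mulr_gt0//= gtr_pMr// u1 => /(_ isT).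
Qed.

Lemma cisX (t : R) n : cis t ^+ n = cis (t * n%:R).
Proof.
elim: n => [|n IH]; first by rewrite mulr0 cis0.
by rewrite exprS IH -[n.+1%:R]natr1 mulrDr mulr1 cisD mulrC.
Qed.

Lemma cos_pow_expand (x : R) m :
  ((cos x ^+ m.*2) * 4 ^+ m)%:C =
  \sum_(j < m.*2.+1) ('C(m.*2, j)%:R : R)%:C * cis (2 * x * (j%:R - m%:R)).
Proof.
have -> : cos x ^+ m.*2 * 4 ^+ m = (2 * cos x) ^+ m.*2.
  rewrite exprMn mulrC; congr (_ * _); rewrite -mul2n exprM; congr (_ ^+ _); ring.
have -> : ((2 * cos x) ^+ m.*2)%:C = (cis (- x) + cis x) ^+ m.*2.
  rewrite rmorphXn; congr (_ ^+ _); rewrite !cisE cosN sinN.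
  by apply: eqC; rewrite ?ReD ?ImD /=; ring.
rewrite exprDn; apply: eq_bigr => j _.
rewrite -mulr_natl rmorph_nat !cisX -cisD; congr (_ * cis _).
have jm : (j <= m.*2)%N by rewrite -ltnS ltn_ord.
move: (j : nat) jm => k jm.
by rewrite natrB// -mul2n natrM; ring.
Qed.

(** Orthogonality of the characters modulo 2 h + 1 at centred points shifted by [eta]. For p = q (2
    h + 1) the centring contributes full turns only, and the shift leaves the phase of [eta * q];
    otherwise the sum is geometric with ratio a nontrivial root of unity. *)
Lemma character_sum (h : nat) (eta : R) (p : int) :
  \sum_(i < h.*2.+1) cis (2 * (pi * (i%:R - h%:R + eta) / h.*2.+1%:R) * p%:~R) =
  if (h.*2.+1%:Z %| p)%Z
  then (h.*2.+1%:R : R)%:C * cis (2 * pi * (eta * (p %/ h.*2.+1%:Z)%Z%:~R)) else 0.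
Proof.
set l := h.*2.+1.
have l0 : (l%:R : R) != 0 by rewrite pnatr_eq0.
have -> : \sum_(i < l) cis (2 * (pi * (i%:R - h%:R + eta) / l%:R) * p%:~R) =
    cis (2 * pi * ((eta - h%:R) * (p%:~R / l%:R))) *
    \sum_(i < l) cis (2 * pi * (p%:~R / l%:R)) ^+ i.
  rewrite mulr_sumr; apply: eq_bigr => i _; rewrite cisX -cisD; congr cis.
  by field.
case: ifPn => [/dvdzP[q ->]|np].
  have -> : (q * l)%:~R / l%:R = q%:~R :> R by rewrite intrM mulfK.
  rewrite mulzK//; rewrite cis2pi_int mulrBl mulrBr cisD mulrC; congr (_ * _).
    under eq_bigr => i _ do rewrite expr1n.
    by rewrite sumr_const card_ord rmorph_nat.
  have -> : - (2 * pi * (h%:R * q%:~R)) = 2 * pi * (- (h%:Z * q))%:~R :> R.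
    by rewrite mulrNz intrM mulrN.
  by rewrite cis2pi_int mulr1.
set z := cis (2 * pi * (p%:~R / l%:R)).
have z1 : z - 1 != 0.
  rewrite subr_eq0; apply: contra np => /eqP/cis_eq1[n nE].
  apply/dvdzP; exists n; apply/eqP; rewrite -(eqr_int R) intrM.
  have E : p%:~R = n%:~R * l%:R :> R by rewrite -nE divfK.
  by apply/eqP.
have zl : z ^+ l = 1.
  by rewrite cisX -[_ * l%:R]mulrA divfK// cis2pi_int.
have -> : \sum_(i < l) z ^+ i = 0.
  by apply: (mulfI z1); rewrite -subrX1 zl subrr mulr0.
by rewrite mulr0.
Qed.

(** Both sides of the finite identity are families over all of [int] that vanish outside a finite
    range, so that the limit can be taken termwise over a fixed index type. *)
Definition polya_left (m h : nat) (eta : R) (r k : int) : C :=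
  if (`|k| <= h)%N then
    (cos (pi * (k%:~R + eta) / h.*2.+1%:R) ^+ m.*2)%:C *
    cis (- (2 * (pi * (k%:~R + eta) / h.*2.+1%:R) * r%:~R))
  else 0.

Definition polya_right (m h : nat) (eta : R) (r q : int) : C :=
  (bin_ratio R m `|r + q * h.*2.+1%:Z|)%:C * cis (2 * pi * (eta * q%:~R)).

Lemma polya_left_sum m h eta r : has_csum (polya_left m h eta r)
  (\sum_(i < h.*2.+1) polya_left m h eta r (i%:Z - h%:Z)).
Proof.
apply: (@has_csum_extend R ('I_(_)) int (fun i : 'I_(h.*2.+1) => i%:Z - h%:Z)).
- move=> i j /addIr [] /eqP; exact: (fun x => val_inj (eqP x)).
- by [].
- move=> t ht; rewrite /polya_left; case: ifPn => // th; exfalso.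
  have lt : (absz (t + h%:Z)%R < h.*2.+1)%N by lia.
  by apply: (ht (Ordinal lt)) => /=; lia.
- exact: has_csum_fin.
Qed.

(** Both sides are sums of one family [G] over [int]: the first reaches its support along the
    residue class r + q (2 h + 1), the second along the window |j| <= m. *)
Lemma polya_right_sum m h eta r (s : C) : has_csum (polya_right m h eta r) s ->
  (h.*2.+1%:R * bin_central R m)%:C * s =
  (4 ^- m)%:C * \sum_(j < m.*2.+1) ('C(m.*2, j)%:R : R)%:C *
    (if (h.*2.+1%:Z %| j%:Z - m%:Z - r)%Z
     then (h.*2.+1%:R : R)%:C *
       cis (2 * pi * (eta * ((j%:Z - m%:Z - r) %/ h.*2.+1%:Z)%Z%:~R)) else 0).
Proof.
move=> /(has_csumZ (h.*2.+1%:R * bin_central R m)%:C) H.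
set l := h.*2.+1 in H *.
pose G (j : int) : C := (4 ^- m)%:C * (('C(m.*2, m + `|j|)%:R : R)%:C *
    (if (l%:Z %| j - r)%Z then (l%:R : R)%:C *
       cis (2 * pi * (eta * ((j - r) %/ l%:Z)%Z%:~R)) else 0)).
rewrite mulr_sumr.
have G1 : has_csum G ((l%:R * bin_central R m)%:C * s).
  apply: (@has_csum_extend R int int (fun q : int => r + q * l%:Z) _ _ G _ _ _ H).
  - by move=> a b /addrI /mulIf; apply.
  - move=> q; rewrite /G; have -> : r + q * l%:Z - r = q * l%:Z by ring.
    rewrite dvdz_mull// mulzK// /polya_right -/l; set a := `|_|%N.
    rewrite !mulrA; congr (_ * _); rewrite -!rmorphM; congr _%:C.
    rewrite /bin_ratio /bin_central; field.
    by rewrite expf_neq0//= gt_eqF// bin_central_gt0.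
  - move=> t ht; rewrite /G; case: ifPn => [/dvdzP[q qE]|]; last by rewrite !mulr0.
    by exfalso; apply: (ht q); rewrite -qE addrC subrK.
apply: has_csum_unique G1 _.
apply: (@has_csum_extend R ('I_(_)) int (fun i : 'I_(m.*2.+1) => i%:Z - m%:Z)); last exact: has_csum_fin.
- move=> i j /addIr [] /eqP; exact: (fun x => val_inj (eqP x)).
- move=> i; rewrite /G; congr (_ * (_%:R%:C * _)).
  have im : (i <= m.*2)%N by rewrite -ltnS.
  case: (leqP m i) => mi.
    by congr 'C(_, _); lia.
  rewrite -bin_sub; first by congr 'C(_, _); lia.
  by lia.
- move=> t ht; rewrite /G bin_small ?mul0r ?mulr0//.
  have [//|tm] := ltnP m.*2 (m + `|t|); exfalso.
  have lt : (absz (t + m%:Z)%R < m.*2.+1)%N by lia.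
  by apply: (ht (Ordinal lt)) => /=; lia.
Qed.

(** Expand the even power of the cosine at the 2 h + 1 sampling points and sum over the points
    first. By orthogonality only those binomial coefficients survive whose offset from the centre is
    congruent to [r] modulo 2 h + 1. *)
Lemma polya_identity m h eta r : csummable (polya_right m h eta r) ->
  csum (polya_left m h eta r) =
  (h.*2.+1%:R * bin_central R m)%:C * csum (polya_right m h eta r).
Proof.
move=> /csummable_has_csum/polya_right_sum ->.
rewrite (csum_unique (polya_left_sum _ _ _ _)).
have n4 : (4 ^- m : R)%:C != 0.
  by rewrite (_ : 0 = (0 : R)%:C)// (inj_eq (@complexI R)) invr_eq0 expf_neq0.
transitivity (\sum_(i < h.*2.+1) (4 ^- m)%:C * \sum_(j < m.*2.+1)
   ('C(m.*2, j)%:R : R)%:C *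
     cis (2 * (pi * (i%:R - h%:R + eta) / h.*2.+1%:R) * (j%:Z - m%:Z - r)%:~R)).
  apply: eq_bigr => i _; rewrite /polya_left.
  have -> : (`|i%:Z - h%:Z| <= h)%N by have := ltn_ord i; lia.
  have -> : (i%:Z - h%:Z)%:~R = i%:R - h%:R :> R by rewrite intrD mulrNz.
  set x := _ / _.
  have -> : cos x ^+ m.*2 = 4 ^- m * (cos x ^+ m.*2 * 4 ^+ m).
    by rewrite mulrCA mulVf ?mulr1// expf_neq0.
  rewrite [(4 ^- m * _)%:C]rmorphM /= cos_pow_expand -[LHS]mulrA mulr_suml; congr (_ * _).
  apply: eq_bigr => j _; rewrite -mulrA -cisD; congr (_ * cis _).
  by rewrite !intrD !mulrNz; ring.
rewrite -mulr_sumr exchange_big /=; congr (_ * _); apply: eq_bigr => j _.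
by rewrite -mulr_sumr character_sum.
Qed.

End PolyaIdentity.

(** * The limit of the finite identity *)

Section GaussSums.
Variable R : realType.

Lemma nnsummable_geometric_nat (q : R) : 0 <= q < 1 -> nnsummable (fun n : nat => q ^+ n).
Proof.
move=> /andP[q0 q1]; split=> [n|]; first exact: exprn_ge0.
exists (1 - q)^-1 => J uJ.
pose N := (\max_(n <- J) n).+1.
apply: (@le_trans _ _ (\sum_(n <- iota 0 N) q ^+ n)).
  apply: ler_sum_uniq => //; [by move=> n; exact: exprn_ge0|exact: iota_uniq|].
  by move=> n nJ; rewrite mem_iota add0n ltnS leq_bigmax_seq.
have q1' : 0 < 1 - q by rewrite subr_gt0.
rewrite -div1r ler_pdivlMr// -[iota 0 N]/(index_iota 0 N) big_mkord mulrC.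
have -> : (1 - q) * \sum_(i < N) q ^+ i = 1 - q ^+ N.
  by rewrite -opprB mulNr -subrX1 opprB.
by rewrite gerBl exprn_ge0.
Qed.

Lemma nnsummable_geometric_int (q : R) : 0 <= q < 1 ->
  nnsummable (fun k : int => q ^+ `|k|%N).
Proof.
move=> q01; have [_ [M hM]] := nnsummable_geometric_nat q01.
have q0 : 0 <= q by case/andP: q01.
split=> [n|]; first exact: exprn_ge0.
exists (M + M) => J uJ.
rewrite (bigID (fun k : int => 0 <= k)) /=.
have half (P : pred int) : (forall a b, P a -> P b -> `|a|%N = `|b|%N -> a = b) ->
    \sum_(k <- J | P k) q ^+ `|k|%N <= M.
  move=> inj; rewrite -big_filter -(big_map absz predT (fun n => q ^+ n)); apply: hM.
  rewrite map_inj_in_uniq ?filter_uniq// => a b.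
  by rewrite !mem_filter => /andP[Pa _] /andP[Pb _]; apply: inj.
by apply: lerD; apply: half => a b /= h1 h2 h3; lia.
Qed.

Lemma nnsummable_gauss_int (c x : R) : 0 < c ->
  nnsummable (fun k : int => expR (- (c * (k%:~R - x) ^+ 2))).
Proof.
move=> c0; pose q := expR (- (c / 2)).
have q01 : 0 <= q < 1 by rewrite expR_ge0 /= -expR0 ltr_expR oppr_lt0 divr_gt0.
apply: (@nnsummable_le _ _ _ (fun k => expR (c * x ^+ 2) * q ^+ `|k|%N)).
  move=> k; rewrite expR_ge0 /= /q -expRM_natr -expRD ler_expR.
  have : (`|k|%N%:R : R) <= k%:~R ^+ 2.
    rewrite -[k%:~R ^+ 2]real_normK ?num_real// -intr_norm -natr_absz -natrX ler_nat.
    by rewrite -mulnn; nia.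
  (* The comparison k^2 / 2 - x^2 <= (k - x)^2 amounts to (k - 2 x)^2 >= 0, and |k| <= k^2 for
     integers then gives a geometric majorant. *)
  have := sqr_ge0 (k%:~R - 2 * x); move: (k%:~R) (`|k|%N%:R) => a b h1 h2.
  have : c * b <= c * a ^+ 2 by rewrite ler_wpM2l// ltW.
  have : 0 <= c * (a - 2 * x) ^+ 2 by rewrite mulr_ge0// ltW.
  by rewrite !expr2; lra.
by apply: nnsummableZ; [exact: expR_ge0|exact: nnsummable_geometric_int].
Qed.

Lemma normc_cisB (t u : R) : normc (cis u - cis t) <= 2 * `|u - t|.
Proof.
rewrite !cisE; apply: (le_trans (normc_le_ReIm _)); rewrite ReD ImD ReN ImN /=.
rewrite mulr_natl mulr2n; apply: lerD.
  have := @lipschitz_bound R cos (fun x => - sin x) 1 t u (fun x => is_derive_cos x).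
  by rewrite mul1r; apply => y _; rewrite normrN sin_max.
have := @lipschitz_bound R sin cos 1 t u (fun x => is_derive_sin x).
by rewrite mul1r; apply => y _; exact: cos_max.
Qed.

End GaussSums.

Section PolyaLimit.
Variable R : realType.
Local Notation C := R[i].
Variables (tau xi eta : R).
Hypothesis tau0 : 0 < tau.
Hypothesis eta12 : `|eta| <= 1 / 2.

(** The scaling of the limit. With L = 2 n + 1 points, exponent M of order tau L^2 and frequency r
    of order - xi L, the power cos^(2M) at pi (k + eta) / L tends to exp (- tau pi^2 (k + eta)^2),
    and the binomial weight at r + q L tends to exp (- (q - xi)^2 / tau). The quotients [s] and
    [rho] tend to [tau] and [- xi]. *)
Local Definition L (n : nat) : R := n.*2.+1%:R.
Local Definition M (n : nat) : nat := `|Num.floor (tau * L n ^+ 2)|%N.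
Local Definition r (n : nat) : int := Num.floor (- xi * L n).
Local Definition s (n : nat) : R := (M n)%:R / L n ^+ 2.
Local Definition rho (n : nat) : R := (r n)%:~R / L n.

Lemma L_gt0 n : 0 < L n. Proof. by rewrite ltr0n. Qed.
Lemma L_neq0 n : L n != 0. Proof. by rewrite gt_eqF// L_gt0. Qed.
Lemma L_ge1 n : 1 <= L n. Proof. by rewrite ler1n. Qed.
Lemma LV_ge0 n : 0 <= (L n)^-1. Proof. by rewrite invr_ge0 ltW// L_gt0. Qed.
Lemma LV_le1 n : (L n)^-1 <= 1. Proof. by rewrite invf_le1 ?L_gt0// L_ge1. Qed.

Lemma cvg_LV : (fun n => (L n)^-1) @ \oo --> (0 : R).
Proof.
apply: (@squeeze_cvgr _ _ _ _ (fun=> 0) harmonic); last 2 first.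
- exact: cvg_cst.
- exact: cvg_harmonic.
near=> n; rewrite LV_ge0 /= lef_pV2 ?posrE ?ltr0n// ler_nat ltnS -addnn leq_addr//.
Unshelve. all: by end_near. Qed.

Lemma cvg_of_LV (u : nat -> R) (l : R) : (forall n, `|u n - l| <= (L n)^-1) ->
  u @ \oo --> l.
Proof.
move=> h; apply/cvgrPdist_lt => e e0.
move/cvgrPdist_lt : cvg_LV => /(_ e e0); apply: filterS => n.
by rewrite sub0r normrN ger0_norm ?LV_ge0// distrC; apply: le_lt_trans.
Qed.

Lemma M_itv n : (M n)%:R <= tau * L n ^+ 2 < (M n)%:R + 1.
Proof.
have x0 : 0 <= tau * L n ^+ 2 by rewrite mulr_ge0 ?(ltW tau0)// sqr_ge0.
have -> : (M n)%:R = (Num.floor (tau * L n ^+ 2))%:~R :> R.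
  by rewrite /M natr_absz ger0_norm ?floor_ge0.
by have := floor_itv (tau * L n ^+ 2); rewrite intrD.
Qed.

Lemma s_le n : s n <= tau.
Proof.
rewrite /s ler_pdivrMr ?exprn_gt0 ?L_gt0//; by have /andP[] := M_itv n.
Qed.

Lemma cvg_s : s @ \oo --> tau.
Proof.
apply: cvg_of_LV => n; rewrite distrC ger0_norm ?subr_ge0 ?s_le//.
have /andP[_ h] := M_itv n.
apply: (@le_trans _ _ ((L n)^-1 * (L n)^-1)); last first.
  by rewrite ler_piMl ?LV_ge0// LV_le1.
rewrite -invfM -expr2 /s lerBlDr -[X in X <= _](@mulfK _ (L n ^+ 2)) ?expf_neq0 ?L_neq0//.
rewrite -[X in X + _]mul1r -mulrDl ler_wpM2r ?invr_ge0 ?sqr_ge0//.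
by rewrite addrC ltW.
Qed.

Lemma rho_bound n : `|rho n + xi| <= (L n)^-1.
Proof.
have /andP[h1 h2] := floor_itv (- xi * L n).
have -> : rho n + xi = ((r n)%:~R + xi * L n) / L n by rewrite /rho mulrDl mulfK ?L_neq0.
rewrite normrM normfV (ger0_norm (ltW (L_gt0 n))) -[leRHS]mul1r ler_wpM2r ?LV_ge0//.
rewrite -/(r n) in h1 h2; rewrite intrD in h2; rewrite ler_norml.
by apply/andP; split; lra.
Qed.

Lemma cvg_rho : rho @ \oo --> - xi.
Proof. by apply: cvg_of_LV => n; rewrite opprK rho_bound. Qed.

Lemma near_s_half : \forall n \near \oo, tau / 2 <= s n.
Proof.
have t2 : 0 < tau / 2 by rewrite divr_gt0.
move/cvgrPdist_lt : cvg_s => /(_ _ t2); apply: filterS => n.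
rewrite ger0_norm ?subr_ge0 ?s_le//; lra.
Qed.

Lemma expRN_squeeze (f g h : nat -> R) (A : R) :
  (\forall n \near \oo, expR (- f n) <= g n <= expR (- h n)) ->
  f @ \oo --> A -> h @ \oo --> A -> g @ \oo --> expR (- A).
Proof.
have cexpN u : u @ \oo --> A -> (fun n => expR (- u n)) @ \oo --> expR (- A).
  by move=> uA; apply: continuous_cvg; [exact: continuous_expR|exact: cvgN].
by move=> fgh /cexpN hf /cexpN hh; exact: squeeze_cvgr fgh _ hf hh.
Qed.

Let lft n := polya_left (R := R) (M n) n eta (r n).
Let rgt n := polya_right (R := R) (M n) n eta (r n).
Let lim_lft (k : int) : C :=
  (expR (- (tau * (pi * (k%:~R + eta)) ^+ 2)))%:C * cis (2 * pi * (k%:~R + eta) * xi).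
Let lim_rgt (q : int) : C :=
  (expR (- ((q%:~R - xi) ^+ 2 / tau)))%:C * cis (2 * pi * (eta * q%:~R)).

Let X n (k : int) : R := pi * (k%:~R + eta) / L n.

(** From |k + eta| <= n + 1 / 2 = L / 2; this is where |eta| <= 1 / 2 enters. It keeps the sampling
    angles in the range of the Gaussian bound for the cosine. *)
Lemma X_bound n k : (`|k| <= n)%N -> `|X n k| <= pi / 2.
Proof.
move=> kn; have pi0 := pi_gt0 R.
rewrite /X !normrM normfV (ger0_norm (ltW pi0)) (ger0_norm (ltW (L_gt0 n))).
rewrite -mulrA ler_wpM2l ?(ltW pi0)// ler_pdivrMr ?L_gt0//.
apply: (le_trans (ler_normD _ _)).
have h1 : `|k%:~R| <= n%:R :> R by rewrite -intr_norm [n%:R]pmulrn ler_int; lia.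
have -> : 2^-1 * L n = n%:R + 1 / 2 by rewrite /L -[n.*2.+1%:R]natr1 -mul2n natrM; field.
exact: lerD.
Qed.

Lemma MX n k : (M n)%:R * X n k ^+ 2 = s n * (pi * (k%:~R + eta)) ^+ 2.
Proof. by rewrite /s /X; move: (L n) (L_neq0 n) => l l0; field. Qed.

Lemma cosX_le n k : (`|k| <= n)%N ->
  `|cos (X n k) ^+ (M n).*2| <= expR (- (s n * (pi * (k%:~R + eta)) ^+ 2)).
Proof.
move=> kn; rewrite normrX -MX.
have -> : expR (- ((M n)%:R * X n k ^+ 2)) = expR (- (X n k ^+ 2 / 2)) ^+ (M n).*2.
  by rewrite -expRM_natl -mul2n natrM; congr expR; field.
apply: lerXn2r; rewrite ?nnegrE ?expR_ge0//.
exact/normr_cos_le_expR/X_bound.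
Qed.

Lemma cvg_cosX k : (fun n => cos (X n k) ^+ (M n).*2) @ \oo -->
  expR (- (tau * (pi * (k%:~R + eta)) ^+ 2)).
Proof.
set A := (pi * (k%:~R + eta)) ^+ 2.
have cX2 : (fun n => X n k ^+ 2) @ \oo --> (0 : R).
  have -> : (fun n => X n k ^+ 2) = (fun n => A * ((L n)^-1 * (L n)^-1)).
    by apply/funext => n; rewrite /X /A; move: (L n) (L_neq0 n) => l l0; field.
  rewrite -(mulr0 A) -[X in A * X](mulr0 0); apply: cvgMl_tmp.
  by apply: cvgM; exact: cvg_LV.
have csA : (fun n => s n * A) @ \oo --> tau * A by apply: cvgM; [exact: cvg_s|exact: cvg_cst].
(* The upper bound is [cosX_le]; the lower one is cos^2 x >= 1 - x^2 >= exp (- x^2 / (1 - x^2))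
   raised to the power [M n]. *)
apply: (@expRN_squeeze (fun n => s n * A / (1 - X n k ^+ 2)) _ (fun n => s n * A)) => //; last first.
  have c1 : (fun n => 1 - X n k ^+ 2) @ \oo --> (1 - 0 : R).
    by apply: cvgB => //; exact: cvg_cst.
  have c2 : (fun n => (1 - X n k ^+ 2)^-1) @ \oo --> ((1 - 0)^-1 : R).
    by apply: cvgV => //; rewrite subr0 oner_neq0.
  have -> : tau * A = tau * A * (1 - 0)^-1 by rewrite subr0 invr1 mulr1.
  by apply: cvgM.
near=> n.
have kn : (`|k| <= n)%N by near: n; exists `|k|%N.
have x1 : X n k ^+ 2 < 1.
  near: n; move/cvgrPdist_lt : cX2 => /(_ _ ltr01); apply: filterS => n.
  by rewrite sub0r normrN ger0_norm ?sqr_ge0.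
apply/andP; split; last first.
  by apply: le_trans (ler_norm _) _; exact: cosX_le.
rewrite -muln2 exprM -MX; set x := X n k in x1 *.
have x1' : 0 < 1 - x ^+ 2 by rewrite subr_gt0.
have -> : cos x ^+ M n ^+ 2 = (cos x ^+ 2) ^+ M n by rewrite -!exprM mulnC.
rewrite -mulrA -mulrN expRM_natl; apply: lerXn2r; rewrite ?nnegrE ?expR_ge0 ?sqr_ge0//.
apply: (@le_trans _ _ (1 - x ^+ 2)).
  rewrite expRN -[leRHS]invrK lef_pV2 ?posrE ?expR_gt0 ?invr_gt0//.
  apply: le_trans (expR_ge1Dx _).
  by rewrite le_eqVlt; apply/orP; left; apply/eqP; field; rewrite gt_eqF.
rewrite cos2sin2 lerB//.
by rewrite -(real_normK (num_real (sin x))) -(real_normK (num_real x)) ler_sqr ?nnegrE// normr_sin_le.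
Unshelve. all: by end_near. Qed.

Let J n (q : int) : nat := absz (r n + q * n.*2.+1%:Z)%R.

Lemma J_sqr n q : (J n q)%:R ^+ 2 = (rho n + q%:~R) ^+ 2 * L n ^+ 2.
Proof.
rewrite /J natr_absz intr_norm real_normK ?num_real// intrD intrM -exprMn.
by congr (_ ^+ 2); rewrite mulrDl /rho divfK ?L_neq0.
Qed.

(** A majorant independent of [n]. Use [bin_ratio_le] with D = 2 M and [s n <= tau], then (rho +
    q)^2 >= (q - xi)^2 / 2 - (rho + xi)^2, where the last square is at most 1. *)
Lemma bin_ratio_J_le n q : 0 < s n -> 
  bin_ratio R (M n) (J n q) <=
  expR (1 / (2 * tau)) * expR (- ((4 * tau)^-1 * (q%:~R - xi) ^+ 2)).
Proof.
move=> s0; have [mj|jm] := ltnP (M n) (J n q).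
  by rewrite bin_ratio_gt// mulr_ge0 ?expR_ge0.
have M0 : (0 : R) < (M n)%:R.
  by move: s0; rewrite /s pmulr_lgt0// invr_gt0 exprn_gt0// L_gt0.
have L0 := L_gt0 n.
apply: (le_trans (@bin_ratio_le R (M n) (J n q) (2 * (M n)%:R) jm _)).
  move=> i ij; have : (i.+1 <= M n)%N by apply: leq_trans jm.
  by rewrite -(ler_nat R) -[i.+1%:R]natr1; lra.
rewrite -expRD ler_expR J_sqr.
have -> : (rho n + q%:~R) ^+ 2 * L n ^+ 2 / (2 * (M n)%:R) =
   (rho n + q%:~R) ^+ 2 / (2 * s n).
  by rewrite /s; move: (L n) (L_neq0 n) (M n)%:R (lt0r_neq0 M0) => l l0 m m0; field; rewrite l0 m0.
apply: (@le_trans _ _ (- ((rho n + q%:~R) ^+ 2 / (2 * tau)))).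
  rewrite lerN2 ler_wpM2l ?sqr_ge0// lef_pV2 ?posrE ?(mulr_gt0 _ s0) ?(mulr_gt0 _ tau0)//.
  by rewrite ler_wpM2l// s_le.
have rb : (rho n + xi) ^+ 2 <= 1.
  rewrite -(real_normK (num_real (rho n + xi))) expr_le1//.
  exact: le_trans (rho_bound n) (LV_le1 n).
have -> : 1 / (2 * tau) - (4 * tau)^-1 * (q%:~R - xi) ^+ 2 =
    - (((q%:~R - xi) ^+ 2 / 2 - 1) / (2 * tau)).
  by field; rewrite gt_eqF.
rewrite lerN2 ler_wpM2r ?invr_ge0 ?mulr_ge0 ?(ltW tau0)//.
have := sqr_ge0 (rho n + q%:~R + (rho n + xi)).
by move: rb; rewrite !expr2; move: (rho n) (q%:~R : R) => a b; lra.
Qed.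

Lemma cvg_bin_ratio_J q : (fun n => bin_ratio R (M n) (J n q)) @ \oo -->
  expR (- ((q%:~R - xi) ^+ 2 / tau)).
Proof.
(* This is J / L^2. The two choices of [D] in the bounds for [bin_ratio], M - J and M + J, become (s
   - u) L^2 and (s + u) L^2, and [u] tends to 0. *)
pose u n := `|rho n + q%:~R| / L n.
have cq : (fun n => rho n + q%:~R) @ \oo --> (- xi + q%:~R : R).
  by apply: cvgD; [exact: cvg_rho|exact: cvg_cst].
have cu : u @ \oo --> (0 : R).
  rewrite -(mulr0 `|- xi + q%:~R|); apply: cvgM; last exact: cvg_LV.
  exact: cvg_norm.
have cnum : (fun n => (rho n + q%:~R) ^+ 2) @ \oo --> ((q%:~R - xi) ^+ 2 : R).
  by rewrite [q%:~R - xi]addrC; apply: cvgM.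
have cinv (v : nat -> R) : v @ \oo --> tau ->
    (fun n => (rho n + q%:~R) ^+ 2 / v n) @ \oo --> (q%:~R - xi) ^+ 2 / tau.
  by move=> cv; apply: cvgM => //; apply: cvgV => //; rewrite gt_eqF.
apply: (@expRN_squeeze (fun n => (rho n + q%:~R) ^+ 2 / (s n - u n)) _
  (fun n => (rho n + q%:~R) ^+ 2 / (s n + u n))); last 2 first.
- by apply: cinv; rewrite -[X in _ --> X]subr0; apply: cvgB => //; exact: cvg_s.
- by apply: cinv; rewrite -[X in _ --> X]addr0; apply: cvgD => //; exact: cvg_s.
have t2 : 0 < tau / 2 by rewrite divr_gt0.
near=> n.
have sn : tau / 2 <= s n by near: n; exact: near_s_half.
have un : u n < tau / 2.
  near: n; move/cvgrPdist_lt : cu => /(_ _ t2); apply: filterS => n.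
  by rewrite sub0r normrN; apply: le_lt_trans; exact: ler_norm.
have L2 : 0 < L n ^+ 2 by rewrite exprn_gt0 ?L_gt0.
have JE : (J n q)%:R = u n * L n ^+ 2.
  rewrite /u expr2 mulrA divfK ?L_neq0// -(ger0_norm (ltW (L_gt0 n))) -normrM.
  by apply/eqP; rewrite -(@eqrXn2 _ 2)// J_sqr real_normK ?num_real// exprMn.
have ME : (M n)%:R = s n * L n ^+ 2 by rewrite /s divfK ?expf_neq0 ?L_neq0.
have su : 0 < s n - u n by rewrite subr_gt0 (lt_le_trans un).
have JM : (J n q <= M n)%N.
  by rewrite -(ler_nat R) JE ME ler_pM2r//; rewrite subr_gt0 in su; exact: ltW.
have divE v : (rho n + q%:~R) ^+ 2 / v = (J n q)%:R ^+ 2 / (v * L n ^+ 2).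
  by rewrite J_sqr invfM mulrACA divff ?mulr1// gt_eqF.
rewrite !divE mulrBl mulrDl -JE -ME; apply/andP; split.
  apply: bin_ratio_ge => //.
  by rewrite JE ME -mulrBl mulr_gt0.
apply: bin_ratio_le => // i ij.
by rewrite -addrA lerD2l natr1 ler_nat.
Unshelve. all: by end_near. Qed.

Lemma polya_left_le n k : tau / 2 <= s n ->
  normc (lft n k) <= expR (- (tau / 2 * pi ^+ 2 * (k%:~R - - eta) ^+ 2)).
Proof.
move=> sn; rewrite /lft /polya_left; case: ifPn => kn; last by rewrite normc0 expR_ge0.
rewrite normcM normc_cis mulr1 normc_real.
apply: (le_trans (cosX_le kn)); rewrite ler_expR lerN2 opprK.
have -> : s n * (pi * (k%:~R + eta)) ^+ 2 = s n * pi ^+ 2 * (k%:~R + eta) ^+ 2 by ring.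
by apply: ler_wpM2r; [exact: sqr_ge0|apply: ler_wpM2r sn; exact: sqr_ge0].
Qed.

Lemma polya_left_cvg k (e : R) : 0 < e ->
  \forall n \near \oo, normc (lim_lft k - lft n k) < e.
Proof.
move=> e0; have e3 : 0 < e / 3 by rewrite divr_gt0.
pose a := 2 * pi * (k%:~R + eta).
have c3 : 0 < e / 3 / (2 * (`|a| + 1)) by rewrite divr_gt0// mulr_gt0// ltr_wpDl.
move/cvgrPdist_lt : (@cvg_cosX k) => /(_ _ e3) h1.
move/cvgrPdist_lt : cvg_rho => /(_ _ c3) h2.
near=> n; have kn : (`|k| <= n)%N by near: n; exists `|k|%N.
rewrite /lft /polya_left kn /lim_lft -/a.
have -> : - (2 * (pi * (k%:~R + eta) / n.*2.+1%:R) * (r n)%:~R) = a * - rho n.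
  by rewrite /a /rho -/(L n); move: (L n) (L_neq0 n) => l l0; field.
rewrite -/(L n) -/(X n k); set E := expR _; set c := cos _ ^+ _.
have -> : E%:C * cis (a * xi) - c%:C * cis (a * - rho n) =
    (E - c)%:C * cis (a * - rho n) + E%:C * (cis (a * xi) - cis (a * - rho n)).
  by rewrite rmorphB /=; ring.
have E1 : E <= 1.
  by rewrite /E -expR0 ler_expR oppr_le0 mulr_ge0 ?sqr_ge0 ?(ltW tau0).
apply: (le_lt_trans (normcD _ _)); rewrite (normcM (E - c)%:C) (normcM E%:C) normc_cis mulr1 !normc_real.
rewrite (ger0_norm (expR_ge0 _)) -/E.
have b1 : `|E - c| < e / 3 by rewrite /E /c; near: n; exact: h1.
have b2 : E * normc (cis (a * xi) - cis (a * - rho n)) <= e / 3.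
  apply: (@le_trans _ _ (1 * (2 * `|a * xi - a * - rho n|))).
    by apply: ler_pM; rewrite ?expR_ge0 ?normc_ge0//; exact: normc_cisB.
  rewrite mul1r -mulrBr normrM.
  have -> : xi - - rho n = - (- xi - rho n) by ring.
  rewrite normrN mulrA; apply: (@le_trans _ _ (2 * (`|a| + 1) * `|- xi - rho n|)).
    by rewrite ler_wpM2r// ler_wpM2l// lerDl.
  rewrite mulrC -ler_pdivlMr ?mulr_gt0 ?ltr_wpDl//.
  by apply: ltW; near: n; exact: h2.
by move: b1 b2; clear -e0; move: `|E - c| (E * _) => x y; lra.
Unshelve. all: by end_near. Qed.

Lemma polya_right_le n q : tau / 2 <= s n ->
  normc (rgt n q) <=
  expR (1 / (2 * tau)) * expR (- ((4 * tau)^-1 * (q%:~R - xi) ^+ 2)).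
Proof.
move=> sn; rewrite /rgt /polya_right normcM normc_cis mulr1 normc_real.
rewrite ger0_norm ?bin_ratio_ge0//; apply: bin_ratio_J_le.
by apply: lt_le_trans sn; rewrite divr_gt0.
Qed.

Lemma polya_right_cvg q (e : R) : 0 < e ->
  \forall n \near \oo, normc (lim_rgt q - rgt n q) < e.
Proof.
move=> e0; move/cvgrPdist_lt : (@cvg_bin_ratio_J q) => /(_ _ e0).
apply: filterS => n; rewrite /lim_rgt /rgt /polya_right -mulrBl.
by rewrite normcM normc_cis mulr1 -rmorphB normc_real.
Qed.

(** Since M = s L^2, the left side is the square root of M b^2 / s, with b the central weight at
    [M n]; here M tends to infinity and s to tau. *)
Lemma cvg_polya_const (V : R) : 0 < V ->
  (fun m : nat => m%:R * bin_central R m ^+ 2) @ \oo --> V ->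
  (fun n => L n * bin_central R (M n)) @ \oo --> Num.sqrt (V / tau).
Proof.
move=> V0 cV.
have Moo : M n @[n --> \oo] --> \oo.
  move=> P [K _ KP]; have [N _ sN] := near_s_half.
  have [K' K'P] : exists K' : nat, K%:R / (tau / 2) <= K'%:R.
    by exists (Num.bound (K%:R / (tau / 2))); apply/ltW/archi_boundP; rewrite divr_ge0// ltW// divr_gt0.
  exists (N + K')%N => // n /= Nn; apply: KP => /=.
  have sn : tau / 2 <= s n by apply: sN => /=; apply: leq_trans Nn; exact: leq_addr.
  rewrite -(ler_nat R); rewrite ler_pdivrMr ?divr_gt0// in K'P; apply: (le_trans K'P).
  have -> : (M n)%:R = L n ^+ 2 * s n by rewrite /s mulrC divfK ?expf_neq0 ?L_neq0.
  apply: ler_pM => //; first by rewrite divr_ge0 ?ltW.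
  apply: (@le_trans _ _ (L n)); last by rewrite expr2 ler_peMr ?L_ge1// ltW// L_gt0.
  by rewrite /L ler_nat; apply: leq_trans (leq_trans (leq_addl N K') Nn) _; lia.
have c1 : (fun n => (M n)%:R * bin_central R (M n) ^+ 2) @ \oo --> V.
  exact: (cvg_comp _ _ Moo cV).
have c2 : (fun n => (M n)%:R * bin_central R (M n) ^+ 2 / s n) @ \oo --> V / tau.
  by apply: cvgM => //; apply: cvgV; [rewrite gt_eqF|exact: cvg_s].
have : (fun n => Num.sqrt ((M n)%:R * bin_central R (M n) ^+ 2 / s n)) @ \oo -->
    Num.sqrt (V / tau).
  by apply: continuous_cvg => //; exact: sqrt_continuous.
apply: cvg_trans; apply: near_eq_cvg; have := near_s_half; apply: filterS => n sn.
have M0 : (M n)%:R != 0 :> R.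
  apply/eqP => M0; move: sn; rewrite /s M0 mul0r leNgt divr_gt0//.
have -> : (M n)%:R * bin_central R (M n) ^+ 2 / s n = (L n * bin_central R (M n)) ^+ 2.
  by rewrite /s; move: (L n) (L_neq0 n) (M n)%:R M0 (bin_central _ _) => l l0 m m0 b; field; rewrite l0.
by rewrite sqrtr_sqr ger0_norm// mulr_ge0 ?(ltW (L_gt0 _))// divr_ge0 ?exprn_ge0.
Qed.

Lemma polya_limit (V : R) : 0 < V ->
  (fun m : nat => m%:R * bin_central R m ^+ 2) @ \oo --> V ->
  csum lim_lft = (Num.sqrt (V / tau))%:C * csum lim_rgt.
Proof.
move=> V0 cV.
(* The majorant of the left side holds once [s n >= tau / 2], whereas [csum_tannery] asks for it at
   all indices; hence the shift by [N]. *)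
have [N _ sN] := near_s_half.
have sN' n : tau / 2 <= s (n + N)%N by apply: sN; rewrite /= leq_addl.
have shift (P : nat -> Prop) : (\forall n \near \oo, P n) -> \forall n \near \oo, P (n + N)%N.
  by move=> [K _ KP]; exists K => // n /= Kn; apply: KP; rewrite /= (leq_trans Kn)// leq_addr.
have sl : nnsummable (fun k : int => expR (- (tau / 2 * pi ^+ 2 * (k%:~R - - eta) ^+ 2))).
  by apply: nnsummable_gauss_int; rewrite mulr_gt0 ?divr_gt0// exprn_gt0// pi_gt0.
have sr : nnsummable (fun q : int =>
    expR (1 / (2 * tau)) * expR (- ((4 * tau)^-1 * (q%:~R - xi) ^+ 2))).
  by apply: nnsummableZ; [exact: expR_ge0|apply: nnsummable_gauss_int; rewrite invr_gt0 mulr_gt0].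
have [_ hl] := @csum_tannery R _ (fun n => lft (n + N)%N) lim_lft _ sl
  (fun n k => polya_left_le k (sN' n)) (fun k e e0 => shift _ (polya_left_cvg k e0)).
have [_ hr] := @csum_tannery R _ (fun n => rgt (n + N)%N) lim_rgt _ sr
  (fun n k => polya_right_le k (sN' n)) (fun k e e0 => shift _ (polya_right_cvg k e0)).
have cl : (fun n => csum (lft (n + N)%N) : C^o) @ \oo --> (csum lim_lft : C^o).
  exact/cvgcP.
have cr : (fun n => csum (rgt (n + N)%N) : C^o) @ \oo --> (csum lim_rgt : C^o).
  exact/cvgcP.
have cc : (fun n => (L (n + N)%N * bin_central R (M (n + N)%N))%:C : C^o) @ \oo -->
    ((Num.sqrt (V / tau))%:C : C^o).
  apply/cvgcP => e e0; apply: (shift (fun n => normc ((Num.sqrt (V / tau))%:C -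
     (L n * bin_central R (M n))%:C) < e)).
  move/cvgrPdist_lt : (@cvg_polya_const V V0 cV) => /(_ e e0).
  by apply: filterS => n; rewrite -rmorphB normc_real.
have cm : (fun n => (L (n + N)%N * bin_central R (M (n + N)%N))%:C * csum (rgt (n + N)%N) : C^o)
    @ \oo --> ((Num.sqrt (V / tau))%:C * csum lim_rgt : C^o).
  exact (@cvgM _ _ _ _ _ _ _ _ cc cr).
have E : (fun n => csum (lft (n + N)%N) : C^o) =
    (fun n => (L (n + N)%N * bin_central R (M (n + N)%N))%:C * csum (rgt (n + N)%N) : C^o).
  apply/funext => n; apply: polya_identity.
  by apply: csummable_le sr => q; exact: polya_right_le.
rewrite E in cl; exact: (cvg_unique _ cl cm).
Qed.

End PolyaLimit.

(** * Theta series *)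

Section ThetaOne.
Variable R : realType.
Local Notation C := R[i].

Lemma has_csum_ge (I : choiceType) (g : I -> R) (s : C) (J : seq I) :
  (forall i, 0 <= g i) -> has_csum (fun i => (g i)%:C) s -> uniq J ->
  \sum_(i <- J) g i <= complex.Re s.
Proof.
move=> g0 hs uJ; apply/ler_addgt0Pr => e e0; have [J0 h] := hs e e0.
have [u [s1 s2]] := uniq_undup_cat J J0.
apply: (le_trans (ler_sum_uniq g0 uJ u s1)).
have := le_lt_trans (normr_Re_le _) (h _ u s2).
by rewrite -rmorph_sum ReD ReN /= ltr_norml => /andP[? _]; lra.
Qed.

Lemma csummable_gauss_cis (a x t : R) : 0 < a ->
  csummable (fun n : int => (expR (- (pi * a * (n%:~R - x) ^+ 2)))%:C * cis (t * n%:~R)).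
Proof.
move=> a0; apply: csummable_le (nnsummable_gauss_int x (mulr_gt0 (pi_gt0 R) a0)) => n.
by rewrite normcM normc_cis mulr1 normc_real ger0_norm ?expR_ge0.
Qed.

Lemma gauss_rescale (p a z : R) : p != 0 -> a != 0 ->
  (p * a)^-1 * (p * z) ^+ 2 = p * a^-1 * z ^+ 2.
Proof. by move=> p0 a0; field; rewrite p0 a0. Qed.

(** This is [polya_limit] with tau = 1 / (pi a) and eta = - y, still with the undetermined constant
    [V] and with y restricted to the range of [eta]. *)
Lemma theta_one_small (V a x y : R) : 0 < V ->
  (fun m : nat => m%:R * bin_central R m ^+ 2) @ \oo --> V ->
  0 < a -> `|y| <= 1 / 2 ->
  csum (fun m : int => (expR (- (pi * a^-1 * (m%:~R - y) ^+ 2)))%:C * cis (2 * pi * x * m%:~R)) =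
  (Num.sqrt (V * pi * a))%:C * cis (2 * pi * x * y) *
  csum (fun n : int => (expR (- (pi * a * (n%:~R - x) ^+ 2)))%:C *
    cis (- (2 * pi * y) * n%:~R)).
Proof.
move=> V0 cV a0 y12; have pi0 := pi_gt0 R.
have pa : pi * a != 0 by rewrite gt_eqF// mulr_gt0.
have t0 : 0 < (pi * a)^-1 by rewrite invr_gt0 mulr_gt0.
have ny : `|- y| <= 1 / 2 by rewrite normrN.
have := @polya_limit R (pi * a)^-1 x (- y) t0 ny V V0 cV.
rewrite invrK mulrA => H.
pose lf (m : int) := (expR (- ((pi * a)^-1 * (pi * (m%:~R + - y)) ^+ 2)))%:C *
     cis (2 * pi * (m%:~R + - y) * x).
have lfE m : (expR (- (pi * a^-1 * (m%:~R - y) ^+ 2)))%:C * cis (2 * pi * x * m%:~R) =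
    cis (2 * pi * x * y) * lf m.
  have -> : 2 * pi * x * m%:~R = 2 * pi * x * y + 2 * pi * (m%:~R + - y) * x by ring.
  by rewrite cisD mulrCA /lf gauss_rescale// gt_eqF.
have slf : csummable lf.
  apply: csummable_le (nnsummable_gauss_int y (_ : 0 < pi * a^-1)) => [m|].
    by rewrite normcM normc_cis mulr1 normc_real ger0_norm ?expR_ge0// gauss_rescale// gt_eqF.
  by rewrite divr_gt0.
under eq_fun do rewrite lfE.
rewrite (csumZ _ slf) [csum lf]H mulrCA mulrA; congr (_ * _ * csum _).
apply/funext => n.
have -> : 2 * pi * (- y * n%:~R) = - (2 * pi * y) * n%:~R by ring.
by rewrite [X in expR (- X)]mulrC.
Qed.

Lemma theta_one (a x y : R) : 0 < a ->
  csum (fun n : int => (expR (- (pi * a * (n%:~R - x) ^+ 2)))%:C *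
    cis (- (2 * pi * y) * n%:~R)) =
  ((Num.sqrt a)^-1)%:C * cis (- (2 * pi * x * y)) *
  csum (fun m : int => (expR (- (pi * a^-1 * (m%:~R - y) ^+ 2)))%:C *
    cis (2 * pi * x * m%:~R)).
Proof.
move=> a0; have [V V0 cV] := bin_central_cvg R; have pi0 := pi_gt0 R.
(* For a = 1 and x = y = 0 the same positive sum stands on both sides, which forces the constant. *)
have Vpi : Num.sqrt (V * pi) = 1.
  have := @theta_one_small V 1 0 0 V0 cV ltr01.
  rewrite normr0 invr1 !mulr0 cis0 mulr1 oppr0 => /(_ ltac:(by rewrite divr_ge0)).
  set F := (fun m : int => _) => H; rewrite mulr1 in H.
  have FE : F = fun m : int => (expR (- (pi * 1 * (m%:~R - 0) ^+ 2)))%:C.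
    by apply/funext => m; rewrite /F mul0r cis0 mulr1 subr0 addr0.
  have sF : csummable F by have := @csummable_gauss_cis 1 (- 0) 0 ltr01; rewrite opprK.
  have F0 : csum F != 0.
    apply/eqP => F0; have := csummable_has_csum sF; rewrite F0 FE => h.
    have := @has_csum_ge _ _ _ [:: 0] (fun i => expR_ge0 _) h isT.
    by rewrite big_seq1 leNgt expR_gt0.
  have := mulIf F0 (etrans (mul1r _) H).
  by move=> /(congr1 (@complex.Re R)) /= <-.
have small y' : `|y'| <= 1 / 2 ->
  csum (fun n : int => (expR (- (pi * a * (n%:~R - x) ^+ 2)))%:C *
    cis (- (2 * pi * y') * n%:~R)) =
  ((Num.sqrt a)^-1)%:C * cis (- (2 * pi * x * y')) *
  csum (fun m : int => (expR (- (pi * a^-1 * (m%:~R - y') ^+ 2)))%:C *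
    cis (2 * pi * x * m%:~R)).
  move=> y12; rewrite (theta_one_small x V0 cV a0 y12) sqrtrM ?mulr_ge0 ?ltW// Vpi mul1r.
  rewrite !mulrA; set S := csum _.
  have -> : ((Num.sqrt a)^-1)%:C * cis (- (2 * pi * x * y')) * (Num.sqrt a)%:C *
     cis (2 * pi * x * y') = ((Num.sqrt a)^-1 * Num.sqrt a)%:C *
     (cis (- (2 * pi * x * y')) * cis (2 * pi * x * y')) by rewrite rmorphM /=; ring.
  by rewrite cisN (mulVf (cis_neq0 _)) mulVf ?mulr1 ?mul1r// gt_eqF// sqrtr_gt0.
(* Reduction to |y| <= 1 / 2: an integer shift of y does not affect the phases on the left, and on
   the right it is undone by reindexing [m] to [m + p]. *)
pose p := Num.floor (y + 1 / 2); pose y' := y - p%:~R.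
have yE : y = y' + p%:~R by rewrite subrK.
have y12 : `|y'| <= 1 / 2.
  have /andP[h1 h2] := floor_itv (y + 1 / 2); rewrite intrD in h2.
  by rewrite ler_norml /y' /p; apply/andP; split; lra.
have := small y' y12.
have -> : (fun n : int => (expR (- (pi * a * (n%:~R - x) ^+ 2)))%:C *
    cis (- (2 * pi * y') * n%:~R)) = (fun n : int => (expR (- (pi * a * (n%:~R - x) ^+ 2)))%:C *
    cis (- (2 * pi * y) * n%:~R)).
  apply/funext => n; congr (_ * _); rewrite yE.
  have -> : - (2 * pi * (y' + p%:~R)) * n%:~R =
    - (2 * pi * y') * n%:~R + 2 * pi * (- (p * n))%:~R by rewrite mulrNz intrM; ring.
  by rewrite cisD cis2pi_int mulr1.
move=> ->; rewrite -mulrA -[RHS]mulrA; congr (_ * _).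
have c1 : cancel (fun m : int => m + p) (fun m => m - p) by move=> m; rewrite addrK.
have c2 : cancel (fun m : int => m - p) (fun m => m + p) by move=> m; rewrite subrK.
rewrite -[in RHS](csum_reindex c1 c2); last by apply: csummable_gauss_cis; rewrite invr_gt0.
rewrite -!csumZ; first last.
- by apply: csummable_gauss_cis; rewrite invr_gt0.
- apply: (csummable_comp (can_inj c1)
    (f := fun m => (expR (- (pi / a * (m%:~R - y) ^+ 2)))%:C * cis (2 * pi * x * m%:~R))).
  by apply: csummable_gauss_cis; rewrite invr_gt0.
congr csum; apply/funext => m; rewrite intrD yE.
have -> : 2 * pi * x * (m%:~R + p%:~R) = 2 * pi * x * m%:~R + 2 * pi * x * p%:~R by ring.
have -> : - (2 * pi * x * (y' + p%:~R)) = - (2 * pi * x * y') + - (2 * pi * x * p%:~R) by ring.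
have -> : m%:~R + p%:~R - (y' + p%:~R) = m%:~R - y' by ring.
rewrite !cisD [cis (- (2 * pi * x * p%:~R))]cisN.
have : cis (2 * pi * x * p%:~R) != 0 by exact: cis_neq0.
move: (cis _) (cis _) (cis _) (_%:C) => c3 c2' c1' E n0.
by field.
Qed.

End ThetaOne.

(** * Raising the dimension of the theta transformation by one *)

Section ThetaStep.
Variable R : realType.
Local Notation C := R[i].

Lemma dotpC d (x y : 'cV[R]_d) : dotp x y = dotp y x.
Proof. by apply: eq_bigr => i _; rewrite mulrC. Qed.

Lemma dotpDl d (x y z : 'cV[R]_d) : dotp (x + y) z = dotp x z + dotp y z.
Proof. by rewrite -big_split; apply: eq_bigr => i _; rewrite !mxE mulrDl. Qed.

Lemma dotpZl d (a : R) (x z : 'cV[R]_d) : dotp (a *: x) z = a * dotp x z.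
Proof. by rewrite mulr_sumr; apply: eq_bigr => i _; rewrite !mxE mulrA. Qed.

Lemma dotpNl d (x z : 'cV[R]_d) : dotp (- x) z = - dotp x z.
Proof. by rewrite -scaleN1r dotpZl mulN1r. Qed.

Lemma dotpDr d (x y z : 'cV[R]_d) : dotp z (x + y) = dotp z x + dotp z y.
Proof. by rewrite dotpC dotpDl !(dotpC z). Qed.

Lemma dotpZr d (a : R) (x z : 'cV[R]_d) : dotp z (a *: x) = a * dotp z x.
Proof. by rewrite dotpC dotpZl (dotpC z). Qed.

Lemma dotpNr d (x z : 'cV[R]_d) : dotp z (- x) = - dotp z x.
Proof. by rewrite dotpC dotpNl (dotpC z). Qed.

Lemma dotpBl d (x y z : 'cV[R]_d) : dotp (x - y) z = dotp x z - dotp y z.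
Proof. by rewrite dotpDl dotpNl. Qed.

Lemma dotpBr d (x y z : 'cV[R]_d) : dotp z (x - y) = dotp z x - dotp z y.
Proof. by rewrite dotpDr dotpNr. Qed.

Lemma dotp_col_mx d (a b : R) (x y : 'cV[R]_d) :
  dotp (col_mx a%:M x : 'cV_(1 + d)) (col_mx b%:M y : 'cV_(1 + d)) = a * b + dotp x y.
Proof.
rewrite /dotp big_split_ord /= big_ord1 !col_mxEu !mxE eqxx !mulr1n; congr (_ + _).
by apply: eq_bigr => i _; rewrite !col_mxEd.
Qed.

Lemma col_mx_subs d (v : 'cV[R]_(1 + d)) : v = col_mx (usubmx v 0 0)%:M (dsubmx v).
Proof. by rewrite -{1}(vsubmxK v); congr col_mx; exact: mx11_scalar. Qed.

Lemma sub_col_mx11 d (a b : R) (x y : 'cV[R]_d) :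
  (col_mx a%:M x : 'cV[R]_(1 + d)) - col_mx b%:M y = col_mx (a - b)%:M (x - y).
Proof. by rewrite opp_col_mx add_col_mx -rmorphB. Qed.

Definition gsum_term (I : choiceType) d (u : I -> 'cV[R]_d) (q : 'cV[R]_d -> R)
  (x w : 'cV[R]_d) (i : I) : C :=
  (expR (- (pi * q (u i - x))))%:C * cis (2 * pi * dotp w (u i)).

(** [q] and [qd] play a positive definite form and the form of the inverse matrix, [D] the square
    root of the determinant. The index type is arbitrary so that an induction step can use
    [int * I]; coordinates are restored by [theta_dual_reindex]. *)
Definition theta_dual (I : choiceType) d (u : I -> 'cV[R]_d) (q qd : 'cV[R]_d -> R)
    (D : R) :=
  [/\ (forall x, nnsummable (fun i => expR (- (pi * q (u i - x))))),
      (forall y, nnsummable (fun i => expR (- (pi * qd (u i - y))))) &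
      (forall x y, csum (gsum_term u q x (- y)) =
         (D^-1)%:C * cis (- (2 * pi * dotp x y)) * csum (gsum_term u qd y x))].

Lemma csummable_gsum (I : choiceType) d (u : I -> 'cV[R]_d) q x w :
  nnsummable (fun i => expR (- (pi * q (u i - x)))) -> csummable (gsum_term u q x w).
Proof.
apply: csummable_le => i.
by rewrite normcM normc_cis mulr1 normc_real ger0_norm ?expR_ge0.
Qed.

Variables (I : choiceType) (d : nat) (u : I -> 'cV[R]_d) (q qd : 'cV[R]_d -> R) (D : R).
Variables (a : R) (b : 'cV[R]_d).
Hypothesis a0 : 0 < a.

Definition up_index (k : int * I) : 'cV[R]_(1 + d) := col_mx (k.1%:~R)%:M (u k.2).

Definition up_form (v : 'cV[R]_(1 + d)) : R :=
  a * (usubmx v 0 0 + dotp b (dsubmx v)) ^+ 2 + q (dsubmx v).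

(** The form of the inverse matrix of [up_form], when [qd] is that of [q]; this is verified in
    [posdef_theta]. *)
Definition up_dual_form (v : 'cV[R]_(1 + d)) : R :=
  a^-1 * (usubmx v 0 0) ^+ 2 + qd (dsubmx v - (usubmx v 0 0) *: b).

End ThetaStep.

Section ThetaStepProof.
Variable R : realType.
Local Notation C := R[i].

Lemma nnsummable_of_rows (T I : choiceType) (g : T * I -> R) (h : I -> R) (B : R) :
  (forall k, 0 <= g k) -> nnsummable h ->
  (forall i (J : seq T), uniq J -> \sum_(k <- J) g (k, i) <= B * h i) ->
  nnsummable g.
Proof.
move=> g0 [h0 [N hN]] rows; split=> //.
exists (`|B| * N) => J uJ.
have sub : {subset J <= [seq (k, i) | k <- undup (map fst J), i <- undup (map snd J)]}.
  move=> [k i] iJ; apply: allpairs_f; rewrite mem_undup.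
    exact: (map_f fst iJ).
  exact: (map_f snd iJ).
have uP : uniq [seq (k, i) | k <- undup (map fst J), i <- undup (map snd J)].
  by apply: allpairs_uniq; rewrite ?undup_uniq// => -[? ?] [? ?] _ _ [-> ->].
apply: (le_trans (ler_sum_uniq g0 uJ uP sub)).
rewrite big_allpairs exchange_big /=.
apply: (@le_trans _ _ (\sum_(i <- undup (map snd J)) `|B| * h i)).
  apply: ler_sum => i _; apply: (le_trans (rows i _ (undup_uniq _))).
  by rewrite ler_wpM2r// ler_norm.
by rewrite -mulr_sumr ler_wpM2l// hN// undup_uniq.
Qed.

Lemma csum_fubini_swap (T I : choiceType) (f : T * I -> C) : csummable f ->
  csum (fun i => csum (fun k => f (k, i))) = csum f.
Proof.
move=> sf; rewrite -(csum_unique (csum_fubini sf)).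
exact/esym/(csum_exchange sf).
Qed.

(** The bound is uniform in [x] because the theta transformation moves [x] into phases, and the dual
    sum is bounded by the sum of its absolute values. *)
Lemma gauss_sum_bound (a : R) : 0 < a -> exists B : R, forall x (J : seq int), uniq J ->
  \sum_(k <- J) expR (- (pi * (a * (k%:~R - x) ^+ 2))) <= B.
Proof.
move=> a0; have pi0 := pi_gt0 R; have a0' : 0 < a^-1 by rewrite invr_gt0.
have [_ [M hM]] := @nnsummable_gauss_int R (pi * a^-1) 0 (mulr_gt0 pi0 a0').
exists ((Num.sqrt a)^-1 * M) => x J uJ.
have := @theta_one R a x 0 a0; rewrite !mulr0 oppr0 cis0 mulr1.
set F := fun n : int => _; set G := fun m : int => _ => H.
have sF : csummable F by have := @csummable_gauss_cis R a x (- 0) a0; rewrite oppr0.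
have sG : csummable G by have := @csummable_gauss_cis R a^-1 0 (2 * pi * x) a0'; rewrite oppr0.
have FE : F = fun n : int => (expR (- (pi * (a * (n%:~R - x) ^+ 2))))%:C.
  by apply/funext => n; rewrite /F mul0r cis0 mulr1 mulrA.
have := csummable_has_csum sF; rewrite FE => /has_csum_ge h.
apply: (le_trans (h _ _ uJ)); first by move=> i; exact: expR_ge0.
rewrite -FE H; apply: (le_trans (ler_norm _)); apply: (le_trans (normr_Re_le _)).
rewrite normcM normc_real ger0_norm ?invr_ge0 ?sqrtr_ge0//.
rewrite ler_wpM2l ?invr_ge0 ?sqrtr_ge0//; apply: normc_csum_le => // J' uJ'.
apply: le_trans (hM J' uJ'); apply: ler_sum => m _.
by rewrite /G normcM normc_cis mulr1 normc_real ger0_norm ?expR_ge0// oppr0.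
Qed.

(** Same reason as for [gauss_sum_bound]: on the side of [q] the shift [y] occurs in phases only. *)
Lemma theta_dual_bound (I : choiceType) d (u : I -> 'cV[R]_d) q qd (D : R) :
  theta_dual u q qd D -> D != 0 -> exists B : R, forall y (J : seq I), uniq J ->
  \sum_(i <- J) expR (- (pi * qd (u i - y))) <= B.
Proof.
move=> [s1 s2 H] D0; have [_ [M hM]] := s1 0.
exists (`|D| * M) => y J uJ; have := H 0 y.
have d0 (z : 'cV[R]_d) : dotp 0 z = 0 by rewrite -(scale0r z) dotpZl mul0r.
rewrite d0 mulr0 oppr0 cis0 mulr1.
have -> : gsum_term u qd y 0 = fun i => (expR (- (pi * qd (u i - y))))%:C.
  by apply/funext => i; rewrite /gsum_term d0 mulr0 cis0 mulr1.
set G := fun i : I => _ => E.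
have sG : csummable G.
  apply: csummable_le (s2 y) => i.
  by rewrite normc_real ger0_norm ?expR_ge0.
apply: (le_trans (has_csum_ge (fun i => expR_ge0 _) (csummable_has_csum sG) uJ)).
have -> : csum G = D%:C * csum (gsum_term u q 0 (- y)).
  by rewrite E mulrA -rmorphM mulfV// mul1r.
apply: (le_trans (ler_norm _)); apply: (le_trans (normr_Re_le _)).
rewrite normcM normc_real ler_wpM2l//; apply: normc_csum_le.
  by apply: csummable_gsum; exact: s1.
move=> J' uJ'; apply: le_trans (hM J' uJ'); apply: ler_sum => i _.
by rewrite normcM normc_cis mulr1 normc_real ger0_norm ?expR_ge0.
Qed.

(** For fixed [i] the sum over the new coordinate is one-dimensional and [theta_one] transforms it.
    After exchanging the sums, for fixed [m] the sum over [i] is an instance of the hypothesis, with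
    [y'] translated by [(m - y1) *: b]. Absolute convergence of the intermediate double family [G]
    justifies the exchange. *)
Lemma theta_dual_step (I : choiceType) d (u : I -> 'cV[R]_d) q qd (D a : R) (b : 'cV[R]_d) :
  0 < a -> D != 0 -> theta_dual u q qd D ->
  theta_dual (up_index u) (up_form q a b) (up_dual_form qd a b) (Num.sqrt a * D).
Proof.
move=> a0 D0 P; have [s1 s2 H] := P; have pi0 := pi_gt0 R.
have a0' : 0 < a^-1 by rewrite invr_gt0.
have s1' x : nnsummable (fun i => expR (- (pi * up_form q a b (up_index u i - x)))).
  have [B hB] := gauss_sum_bound a0.
  rewrite (col_mx_subs x); set x1 := usubmx x 0 0; set x' := dsubmx x.
  apply: (@nnsummable_of_rows _ _ _ (fun i => expR (- (pi * q (u i - x')))) B).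
  - by move=> k; exact: expR_ge0.
  - exact: s1.
  move=> i J uJ; rewrite mulrC.
  apply: (@le_trans _ _ (\sum_(k <- J) expR (- (pi * q (u i - x'))) *
     expR (- (pi * (a * (k%:~R - (x1 - dotp b (u i - x'))) ^+ 2))))).
    rewrite le_eqVlt; apply/orP; left; apply/eqP; apply: eq_bigr => k _.
    rewrite /up_index /up_form sub_col_mx11 col_mxKu col_mxKd mxE eqxx mulr1n -expRD.
    by congr expR; rewrite /=; ring.
  by rewrite -mulr_sumr ler_wpM2l ?expR_ge0// hB.
have s2' y : nnsummable (fun i => expR (- (pi * up_dual_form qd a b (up_index u i - y)))).
  have [B hB] := theta_dual_bound P D0.
  rewrite (col_mx_subs y); set y1 := usubmx y 0 0; set y' := dsubmx y.
  (* The roles of the two indices are swapped with respect to the first form: now it is the sum over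
     [i], for fixed [k], that has a uniform bound, and the Gaussian factor is in [k]. *)
  have := @nnsummable_of_rows I int (fun x : I * int => expR (- (pi *
     up_dual_form qd a b (up_index u (x.2, x.1) - (col_mx y1%:M y' : 'cV_(1 + d))))))
     (fun k : int => expR (- (pi * a^-1 * (k%:~R - y1) ^+ 2))) B.
  move=> S; have {}S : nnsummable (fun x : I * int => expR (- (pi *
     up_dual_form qd a b (up_index u (x.2, x.1) - (col_mx y1%:M y' : 'cV_(1 + d)))))).
    apply: S; [by move=> k; exact: expR_ge0| |].
      by apply: nnsummable_gauss_int; exact: mulr_gt0.
    move=> k J uJ; rewrite mulrC.
    apply: (@le_trans _ _ (\sum_(i <- J) expR (- (pi * a^-1 * (k%:~R - y1) ^+ 2)) *
       expR (- (pi * qd (u i - (y' + (k%:~R - y1) *: b)))))).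
      rewrite le_eqVlt; apply/orP; left; apply/eqP; apply: eq_bigr => i _.
      rewrite /up_index /up_dual_form sub_col_mx11 col_mxKu col_mxKd mxE eqxx mulr1n -expRD.
      by congr expR; rewrite /= opprD addrA; ring.
    by rewrite -mulr_sumr ler_wpM2l ?expR_ge0// hB.
  have inj : injective (fun x : int * I => (x.2, x.1)) by move=> [? ?] [? ?] [-> ->].
  by apply: nnsummable_le (nnsummable_comp inj S) => -[k i]; rewrite expR_ge0 /=.
split=> // x y.
rewrite (col_mx_subs x) (col_mx_subs y).
set x1 := usubmx x 0 0; set x' := dsubmx x; set y1 := usubmx y 0 0; set y' := dsubmx y.
set X := col_mx x1%:M x' : 'cV_(1 + d); set Y := col_mx y1%:M y' : 'cV_(1 + d).
(* The centre of the one-dimensional Gaussian in the new coordinate, read off from the completed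
   square. *)
pose Xi i := x1 - dotp b (u i - x').
pose gq := gsum_term u q x' (- y').
pose hm (m : int) := expR (- (pi * a^-1 * (m%:~R - y1) ^+ 2)).
pose G (z : int * I) : C := (hm z.1)%:C * cis (2 * pi * Xi z.2 * (z.1%:~R - y1)) * gq z.2.
have sG : csummable G.
  apply: csummable_le (nnsummable_prod (nnsummable_gauss_int y1 (mulr_gt0 pi0 a0')) (s1 x')) => z.
  rewrite /G !normcM !normc_cis !mulr1 !normc_real !ger0_norm ?expR_ge0//.
have sf := csummable_gsum (- Y) (s1' X).
have sK := csummable_gsum X (s2' Y).
rewrite -(csum_fubini_swap sf).
have e1 i : csum (fun k => gsum_term (up_index u) (up_form q a b) X (- Y) (k, i)) =
    ((Num.sqrt a)^-1)%:C * csum (fun m => G (m, i)).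
  have -> : (fun k => gsum_term (up_index u) (up_form q a b) X (- Y) (k, i)) =
      (fun k : int => gq i * ((expR (- (pi * a * (k%:~R - Xi i) ^+ 2)))%:C *
         cis (- (2 * pi * y1) * k%:~R))).
    apply/funext => k; rewrite /gsum_term /gq /gsum_term.
    rewrite /up_index /up_form sub_col_mx11 col_mxKu col_mxKd mxE eqxx mulr1n /=.
    rewrite dotpNl dotp_col_mx dotpNl.
    have -> : 2 * pi * - (y1 * k%:~R + dotp y' (u i)) =
        2 * pi * - dotp y' (u i) + - (2 * pi * y1) * k%:~R by ring.
    have -> : - (pi * (a * (k%:~R - x1 + dotp b (u i - x')) ^+ 2 + q (u i - x'))) =
       - (pi * q (u i - x')) + - (pi * a * (k%:~R - Xi i) ^+ 2) by rewrite /Xi; ring.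
    by rewrite cisD expRD rmorphM /=; ring.
  rewrite csumZ; last exact: csummable_gauss_cis.
  rewrite theta_one//; set S := csum (fun m : int => _ * cis (2 * pi * Xi i * _)).
  have -> : gq i * (((Num.sqrt a)^-1)%:C * cis (- (2 * pi * Xi i * y1)) * S) =
     ((Num.sqrt a)^-1)%:C * ((gq i * cis (- (2 * pi * Xi i * y1))) * S) by ring.
  congr (_ * _); rewrite /S -csumZ; last exact: csummable_gauss_cis.
  congr csum; apply/funext => m; rewrite /G /hm.
  have -> : 2 * pi * Xi i * (m%:~R - y1) = - (2 * pi * Xi i * y1) + 2 * pi * Xi i * m%:~R by ring.
  by rewrite [in RHS]cisD; ring.
have e2 m : csum (fun i => G (m, i)) = (D^-1)%:C * cis (- (2 * pi * dotp X Y)) *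
    csum (fun i => gsum_term (up_index u) (up_dual_form qd a b) Y X (m, i)).
  pose w := m%:~R - y1.
  have -> : (fun i => G (m, i)) = (fun i => ((hm m)%:C * cis (2 * pi * (x1 + dotp b x') * w)) *
      gsum_term u q x' (- (y' + w *: b)) i).
    apply/funext => i; rewrite /G /gq /gsum_term /= -/w.
    have -> : 2 * pi * Xi i * w = 2 * pi * (x1 + dotp b x') * w + 2 * pi * - (w * dotp b (u i)).
      by rewrite /Xi dotpBr; ring.
    rewrite opprD dotpDl !dotpNl dotpZl.
    have -> : 2 * pi * (- dotp y' (u i) - w * dotp b (u i)) =
      2 * pi * - dotp y' (u i) + 2 * pi * - (w * dotp b (u i)) by ring.
    by rewrite !cisD; ring.
  rewrite csumZ; last by apply: csummable_gsum; exact: s1.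
  rewrite H -csumZ; last by apply: csummable_gsum; exact: s2.
  rewrite -csumZ; last first.
    by apply: csummableZ; apply: csummable_gsum; exact: s2.
  rewrite -csumZ; last first.
    by apply: (csummable_comp (phi := fun i => (m, i)) _ sK) => ? ? [].
  congr csum; apply/funext => i; rewrite /gsum_term.
  rewrite /up_index /up_dual_form sub_col_mx11 col_mxKu col_mxKd mxE eqxx mulr1n /=.
  rewrite !dotp_col_mx -/w dotpDr dotpZr (dotpC x' b).
  have -> : u i - (y' + w *: b) = u i - y' - w *: b by rewrite opprD addrA.
  have -> : - (pi * (a^-1 * w ^+ 2 + qd (u i - y' - w *: b))) =
     - (pi * a^-1 * w ^+ 2) + - (pi * qd (u i - y' - w *: b)) by ring.
  rewrite expRD rmorphM /= /hm -/w.
  have -> : 2 * pi * (x1 + dotp b x') * w = 2 * pi * (x1 * m%:~R) + 2 * pi * - (x1 * y1) +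
    2 * pi * (w * dotp b x') by rewrite /w; ring.
  have -> : - (2 * pi * (dotp x' y' + w * dotp b x')) =
    2 * pi * - dotp x' y' + - (2 * pi * (w * dotp b x')) by ring.
  have -> : 2 * pi * (x1 * m%:~R + dotp x' (u i)) =
    2 * pi * (x1 * m%:~R) + 2 * pi * dotp x' (u i) by ring.
  have -> : - (2 * pi * (x1 * y1 + dotp x' y')) =
    2 * pi * - (x1 * y1) + 2 * pi * - dotp x' y' by ring.
  rewrite !cisD [cis (- (2 * pi * (w * dotp b x')))]cisN.
  have := cis_neq0 (2 * pi * (w * dotp b x')).
  do 5 (move: (cis _) => ?); do 2 (move: (_%:C) => ?); move=> n0.
  by field.
have row (F : int * I -> C) : csummable F -> forall i, csummable (fun m => F (m, i)).
  by move=> sF i; apply: (csummable_comp (phi := fun m => (m, i)) _ sF) => ? ? [].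
have col (F : int * I -> C) : csummable F -> forall m, csummable (fun i => F (m, i)).
  by move=> sF m; apply: (csummable_comp (phi := fun i => (m, i)) _ sF) => ? ? [].
have -> : (fun i => csum (fun k => gsum_term (up_index u) (up_form q a b) X (- Y) (k, i))) =
    (fun i => csum (fun m => ((Num.sqrt a)^-1)%:C * G (m, i))).
  by apply/funext => i; rewrite e1 csumZ//; exact: row.
rewrite (csum_fubini_swap (csummableZ ((Num.sqrt a)^-1)%:C sG)) csumZ//.
rewrite -(csum_unique (csum_fubini sG)).
have -> : (fun m => csum (fun i => G (m, i))) =
    (fun m => csum (fun i => ((D^-1)%:C * cis (- (2 * pi * dotp X Y))) *
      gsum_term (up_index u) (up_dual_form qd a b) Y X (m, i))).
  by apply/funext => m; rewrite e2 (csumZ _ (col _ sK m)).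
rewrite (csum_unique (csum_fubini (csummableZ _ sK))) csumZ//.
by rewrite invfM rmorphM /= !mulrA.
Qed.

End ThetaStepProof.

(** * The theta transformation for positive definite forms and for lattices *)

Section ThetaLattice.
Variable R : realType.
Local Notation C := R[i].

Definition qform d (Q : 'M[R]_d) (v : 'cV[R]_d) : R := dotp v (Q *m v).

Definition posdef d (Q : 'M[R]_d) := Q^T = Q /\ forall v, v != 0 -> 0 < qform Q v.

Lemma theta_dual_reindex (I T : choiceType) (phi : I -> T) (psi : T -> I) d
    (u : T -> 'cV[R]_d) q qd (D : R) : cancel phi psi -> cancel psi phi ->
  theta_dual (fun i => u (phi i)) q qd D -> theta_dual u q qd D.
Proof.
move=> c1 c2 [s1 s2 H].
have nn (g : T -> R) : nnsummable (fun i => g (phi i)) -> nnsummable g.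
  move=> h; have := nnsummable_comp (can_inj c2) h.
  by apply: nnsummable_le => t; rewrite c2 lexx andbT; case: h => h0 _; rewrite -(c2 t).
have s1' x : nnsummable (fun i => expR (- (pi * q (u i - x)))) by exact: nn (s1 x).
have s2' x : nnsummable (fun i => expR (- (pi * qd (u i - x)))) by exact: nn (s2 x).
split=> // x y; have := H x y.
have -> : csum (gsum_term (fun i => u (phi i)) q x (- y)) = csum (gsum_term u q x (- y)).
  exact: csum_reindex c1 c2 (csummable_gsum _ (s1' x)).
have -> // : csum (gsum_term (fun i => u (phi i)) qd y x) = csum (gsum_term u qd y x).
exact: csum_reindex c1 c2 (csummable_gsum _ (s2' y)).
Qed.

Lemma scalar_mx11E (K : nmodType) (s : K) : (s%:M : 'M[K]_1) 0 0 = s.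
Proof. by rewrite mxE eqxx mulr1n. Qed.

Lemma mul_tr_dotp d (x y : 'cV[R]_d) : x^T *m y = (dotp x y)%:M.
Proof.
apply/matrixP => i j; rewrite !ord1 !mxE eqxx mulr1n.
by apply: eq_bigr => k _; rewrite !mxE.
Qed.

Lemma dotp_mx d e (M : 'M[R]_(d, e)) (x : 'cV[R]_d) (y : 'cV[R]_e) :
  dotp x (M *m y) = dotp (M^T *m x) y.
Proof.
have := mul_tr_dotp x (M *m y); rewrite mulmxA.
have -> : x^T *m M = (M^T *m x)^T by rewrite trmx_mul trmxK.
rewrite mul_tr_dotp => /matrixP/(_ 0 0).
by rewrite !mxE eqxx !mulr1n => ->.
Qed.

Lemma theta_dual_cV0 (u : 'cV[int]_0 -> 'cV[R]_0) q : (forall v, q v = 0) ->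
  theta_dual u q q 1.
Proof.
move=> q0; have all_eq (n : 'cV[int]_0) : n = 0 by apply/matrixP => -[].
have nn (g : 'cV[int]_0 -> R) : (forall i, 0 <= g i) -> nnsummable g.
  move=> g0; split=> //; exists (g 0) => J uJ.
  have -> : g 0 = \sum_(i <- [:: 0]) g i by rewrite big_seq1.
  by apply: ler_sum_uniq => // i _; rewrite (all_eq i) mem_seq1.
have d0 (v w : 'cV[R]_0) : dotp v w = 0 by rewrite /dotp big_ord0.
have tE x w : gsum_term u q x w = fun=> 1.
  by apply/funext => n; rewrite /gsum_term q0 d0 !mulr0 oppr0 expR0 cis0 mulr1.
split=> [x|x|x y]; [by apply: nn => i; exact: expR_ge0..|].
by rewrite !tE d0 mulr0 oppr0 cis0 invr1 !mul1r.
Qed.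

(* Induction on [d]: a Schur complement splits off one square from the form. *)
Lemma posdef_theta d (Q : 'M[R]_d) : posdef Q ->
  0 < \det Q /\ theta_dual (fun n : 'cV[int]_d => map_mx intr n) (qform Q)
    (qform (invmx Q)) (Num.sqrt (\det Q)).
Proof.
elim: d Q => [|d IH] Q [Qsym Qpos].
  have q0 (M : 'M[R]_0) : qform M = fun=> 0.
    by apply/funext => v; rewrite /qform /dotp big_ord0.
  by rewrite det_mx00 ltr01 sqrtr1 !q0; split=> //; exact: theta_dual_cV0.
pose Q' : 'M[R]_(1 + d) := Q.
pose a := ulsubmx Q' 0 0.
have e1 : (col_mx 1%:M 0 : 'cV[R]_(1 + d)) != 0.
  apply/eqP => /(congr1 usubmx); rewrite col_mxKu => /matrixP/(_ 0 0).
  by rewrite !mxE /= => /eqP; rewrite oner_eq0.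
have ulE : ulsubmx Q' = a%:M by rewrite {1}[ulsubmx Q']mx11_scalar.
have Qpos' (v : 'cV[R]_(1 + d)) : v != 0 -> 0 < dotp v (Q' *m v) := Qpos v.
have a0 : 0 < a.
  have := Qpos' _ e1; rewrite -(submxK Q') mul_block_col.
  rewrite !mulmx0 !addr0 ulE !mulmx1 dotp_col_mx mul1r.
  suff -> : dotp 0 (dlsubmx Q') = 0 by rewrite addr0.
  by rewrite /dotp big1// => i _; rewrite mxE mul0r.
have [b dlE] : exists b : 'cV[R]_d, dlsubmx Q' = a *: b.
  by exists (a^-1 *: dlsubmx Q'); rewrite scalerA divff ?scale1r// gt_eqF.
have urE : ursubmx Q' = a *: b^T.
  have : (ursubmx Q')^T = dlsubmx Q' by rewrite trmx_ursub /Q' Qsym.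
  by rewrite dlE => /(congr1 trmx); rewrite trmxK linearZ.
have [S drE] : exists S, drsubmx Q' = S + a *: (b *m b^T).
  by exists (drsubmx Q' - a *: (b *m b^T)); rewrite subrK.
have SE : S = drsubmx Q' - a *: (b *m b^T) by rewrite drE addrK.
have QE : Q' = block_mx a%:M (a *: b^T) (a *: b) (S + a *: (b *m b^T)).
  by rewrite -(submxK Q') ulE dlE urE drE.
have Qmul (s : R) (w : 'cV[R]_d) : Q' *m col_mx s%:M w =
    col_mx (a * (s + dotp b w))%:M ((a * (s + dotp b w)) *: b + S *m w).
  rewrite QE mul_block_col; congr col_mx.
    by rewrite -scalar_mxM -scalemxAl mul_tr_dotp scale_scalar_mx -raddfD mulrDr.
  rewrite mulmxDl -!scalemxAl mul_mx_scalar -mulmxA mul_tr_dotp mul_mx_scalar.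
  have -> : (a * (s + dotp b w)) *: b = (a * s) *: b + (a * dotp b w) *: b.
    by rewrite -scalerDl; congr (_ *: _); ring.
  by rewrite !scalerA addrA addrAC.
have qE (v : 'cV[R]_(1 + d)) : dotp v (Q' *m v) = up_form (qform S) a b v.
  rewrite /up_form (col_mx_subs v) /qform Qmul.
  rewrite dotp_col_mx col_mxKu col_mxKd scalar_mx11E dotpDr dotpZr (dotpC _ b).
  by ring.
have Ssym : S^T = S.
  rewrite SE linearB /= linearZ /= trmx_mul trmxK; congr (_ - _).
  by rewrite trmx_drsub /Q' Qsym.
have Spos : posdef S.
  split=> // w w0.
  (* At this vector the completed square vanishes and the form reduces to that of the Schur
     complement, which thus inherits positivity. *)
  have n0 : (col_mx (- dotp b w)%:M w : 'cV[R]_(1 + d)) != 0.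
    by apply: contraNneq w0 => /(congr1 dsubmx); rewrite col_mxKd => ->; apply/eqP/matrixP => i j; rewrite !mxE.
  have := Qpos' _ n0; rewrite qE /up_form col_mxKu col_mxKd scalar_mx11E.
  by rewrite addNr expr0n mulr0 add0r.
have [dS thS] := IH S Spos.
have detQ : \det Q = a * \det S.
  have Q'E : Q' = (block_mx 1%:M 0 b 1%:M : 'M[R]_(1 + d)%N) *m
      (block_mx a%:M (a *: b^T) 0 S : 'M[R]_(1 + d)%N).
    rewrite QE mulmx_block !mul1mx !mul0mx !addr0.
    by rewrite mul_mx_scalar -scalemxAr [in RHS]addrC.
  have : \det Q' = a * \det S.
    by rewrite Q'E det_mulmx det_lblock det_ublock !det1 !mul1r det_scalar1.
  exact.
have dQ : 0 < \det Q by rewrite detQ mulr_gt0.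
have Su : S \in unitmx by rewrite unitmxE unitfE gt_eqF.
have Qu : Q' \in unitmx by rewrite unitmxE unitfE gt_eqF.
have qdE (v : 'cV[R]_(1 + d)) : dotp v (invmx Q' *m v) = up_dual_form (qform (invmx S)) a b v.
  rewrite /up_dual_form (col_mx_subs v) col_mxKu col_mxKd scalar_mx11E.
  set v1 := usubmx v 0 0; set v' := dsubmx v.
  (* Solves Q' z = v: the first row forces a (z1 + b.z') = v1, and the remaining rows become S z' =
     v' - v1 b. *)
  pose z' := invmx S *m (v' - v1 *: b); pose z1 := a^-1 * v1 - dotp b z'.
  have za : a * (z1 + dotp b z') = v1 by rewrite /z1 subrK mulrA divff ?mul1r// gt_eqF.
  have -> : invmx Q' *m col_mx v1%:M v' = col_mx z1%:M z'.
    rewrite -[RHS](mulKmx Qu) Qmul za; congr (_ *m col_mx _ _).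
    by rewrite /z' mulKVmx// addrC subrK.
  rewrite /qform -/z' dotp_col_mx dotpBl dotpZl /z1; ring.
split=> //; rewrite detQ sqrtrM ?ltW//.
have -> : qform Q = up_form (qform S) a b by apply/funext => v; exact: qE.
have -> : qform (invmx Q) = up_dual_form (qform (invmx S)) a b by apply/funext => v; exact: qdE.
have sS : Num.sqrt (\det S) != 0 by rewrite gt_eqF// sqrtr_gt0.
have := theta_dual_step b a0 sS thS.
pose phi (k : int * 'cV[int]_d) : 'cV[int]_(1 + d) := col_mx (k.1)%:M k.2.
pose psi (n : 'cV[int]_(1 + d)) : int * 'cV[int]_d := (usubmx n 0 0, dsubmx n).
have c1 : cancel phi psi.
  by move=> [k n]; rewrite /phi /psi col_mxKu col_mxKd scalar_mx11E.
have c2 : cancel psi phi.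
  by move=> n; rewrite /phi /psi /= -[RHS](vsubmxK n); congr col_mx; rewrite [RHS]mx11_scalar.
have -> : up_index (fun n : 'cV[int]_d => map_mx intr n : 'cV[R]_d) =
    (fun k => map_mx intr (phi k)).
  apply/funext => -[k n]; rewrite /up_index /phi map_col_mx /=; congr col_mx.
  by apply/matrixP => i j; rewrite !mxE; case: eqP; rewrite ?mulr1n ?mulr0n.
exact: theta_dual_reindex c1 c2.
Qed.

Definition lattice_pt d (A : 'M[R]_d) (n : 'cV[int]_d) : 'cV[R]_d := A *m map_mx intr n.

Definition theta_term d (A : 'M[R]_d) (x w : 'cV[R]_d) (t : R) (n : 'cV[int]_d) : C :=
  (expR (- (pi * (t * dotp (lattice_pt A n - x) (lattice_pt A n - x)))))%:C *
  cis (2 * pi * dotp w (lattice_pt A n)).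

Lemma dotp_gt0 d (v : 'cV[R]_d) : v != 0 -> 0 < dotp v v.
Proof.
move=> v0; rewrite lt_neqAle; apply/andP; split; last first.
  by apply: sumr_ge0 => i _; rewrite -expr2 sqr_ge0.
apply: contraNneq v0 => /esym/eqP; rewrite psumr_eq0.
  move=> /allP h; apply/eqP/matrixP => i j; rewrite !mxE !ord1.
  by have /eqP := h i (mem_index_enum _); rewrite -expr2 => /eqP; rewrite sqrf_eq0 => /eqP.
by move=> i _; rewrite -expr2 sqr_ge0.
Qed.

Lemma theta_lattice d (A : 'M[R]_d) (t : R) : A \in unitmx -> 0 < t ->
  [/\ (forall x w, csummable (theta_term A x w t)),
      (forall x w, csummable (theta_term (reciprocal A) x w t)) &
   forall x y, csum (theta_term A x (- y) t) =
    ((Num.sqrt (t ^+ d) * covolume A)^-1)%:C * cis (- (2 * pi * dotp x y)) *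
    csum (theta_term (reciprocal A) y x t^-1)].
Proof.
move=> Au t0; pose B := reciprocal A.
have ATu : A^T \in unitmx by rewrite unitmx_tr.
have BE : B^T = invmx A by rewrite /B /reciprocal trmxK.
have main s : 0 < s ->
   [/\ (forall x, nnsummable (fun n => expR (- (pi * (s * dotp (lattice_pt A n - x) (lattice_pt A n - x)))))),
       (forall y, nnsummable (fun n => expR (- (pi * (s^-1 * dotp (lattice_pt B n - y) (lattice_pt B n - y)))))) &
       forall x y, csum (theta_term A x (- y) s) =
    ((Num.sqrt (s ^+ d) * covolume A)^-1)%:C * cis (- (2 * pi * dotp x y)) *
    csum (theta_term B y x s^-1)].
  (* In integer coordinates [s] times the squared norm is the form of [Q]. The centre becomes
     [invmx A *m x] and the frequency [A^T *m y], a change that preserves their inner product. *)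
  move=> s0; pose Q := s *: (A^T *m A).
  have qE v : qform Q v = s * dotp (A *m v) (A *m v).
    by rewrite /qform /Q -scalemxAl dotpZr -mulmxA dotp_mx trmxK.
  have Qpos : posdef Q.
    split; first by rewrite /Q linearZ /= trmx_mul trmxK.
    move=> v v0; rewrite qE mulr_gt0// dotp_gt0//.
    by apply: contraNneq v0 => Av; rewrite -(mulKmx Au v) Av mulmx0.
  have [dQ [s1 s2 H]] := posdef_theta Qpos.
  have Qu : Q \in unitmx by rewrite unitmxE unitfE gt_eqF.
  have QV : invmx Q = s^-1 *: (invmx A *m B).
    apply: (can_inj (mulKmx Qu)); rewrite mulmxV// /Q -scalemxAl -scalemxAr scalerA.
    rewrite divff ?gt_eqF// scale1r -mulmxA mulKVmx// /B /reciprocal -trmx_mul.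
    by rewrite mulVmx// trmx1.
  have qdE v : qform (invmx Q) v = s^-1 * dotp (B *m v) (B *m v).
    by rewrite QV /qform -scalemxAl dotpZr -mulmxA -BE dotp_mx trmxK.
  have detE : Num.sqrt (\det Q) = Num.sqrt (s ^+ d) * covolume A.
    rewrite /Q detZ det_mulmx det_tr -expr2 sqrtrM ?exprn_ge0 ?ltW//.
    by rewrite sqrtr_sqr.
  have subA n x : A *m (map_mx intr n - invmx A *m x) = lattice_pt A n - x.
    by rewrite mulmxBr mulKVmx.
  have BA : B *m A^T = 1%:M by rewrite /B /reciprocal -trmx_mul mulmxV// trmx1.
  have subB n y : B *m (map_mx intr n - A^T *m y) = lattice_pt B n - y.
    by rewrite mulmxBr mulmxA BA mul1mx.
  have t1 x y : gsum_term (fun n : 'cV[int]_d => map_mx intr n) (qform Q) (invmx A *m x) (A^T *m y) =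
     theta_term A x y s.
    apply/funext => n; rewrite /gsum_term qE subA /theta_term; congr (_ * cis (_ * _)).
    by rewrite -dotp_mx.
  have t2 x y : gsum_term (fun n : 'cV[int]_d => map_mx intr n) (qform (invmx Q)) (A^T *m y) (invmx A *m x) =
     theta_term B y x s^-1.
    apply/funext => n; rewrite /gsum_term qdE subB /theta_term; congr (_ * cis (_ * _)).
    by rewrite /lattice_pt dotp_mx BE.
  split.
  - move=> x; apply: nnsummable_le (s1 (invmx A *m x)) => n.
    by rewrite expR_ge0 /= qE subA.
  - move=> y; apply: nnsummable_le (s2 (A^T *m y)) => n.
    by rewrite expR_ge0 /= qdE subB.
  - move=> x y; have := H (invmx A *m x) (A^T *m y).
    rewrite -[- (A^T *m y)]mulmxN t1 t2 detE => ->; congr (_ * cis (- (_ * _)) * _).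
    by rewrite dotp_mx trmxK mulKVmx.
have [s1 _ H] := main t t0.
(* The reciprocal series occurs in [main] at the inverse parameter, so its summability at [t] is
   read off at [t^-1]. *)
have [_ s2 _] := main t^-1 ltac:(by rewrite invr_gt0); rewrite invrK in s2.
split=> //.
  move=> x w; apply: csummable_le (s1 x) => n.
  by rewrite normcM normc_cis mulr1 normc_real ger0_norm ?expR_ge0.
move=> x w; apply: csummable_le (s2 x) => n.
by rewrite normcM normc_cis mulr1 normc_real ger0_norm ?expR_ge0.
Qed.

End ThetaLattice.

(** * Integrals over the half-line *)

Section HalfLine.
Variable R : realType.
Local Notation C := R[i].
Local Notation mu := (@lebesgue_measure R).
Local Notation D0 := (`[0%R, +oo[%classic : set (measurableTypeR R)).

Lemma expRN_lt1 (c x : R) : 0 < c -> 0 < x -> expR (- (c * x)) < (c * x)^-1.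
Proof.
move=> c0 x0; have cx : 0 < c * x by rewrite mulr_gt0.
rewrite expRN ltf_pV2 ?posrE ?expR_gt0//; apply: lt_le_trans (expR_ge1Dx _).
by rewrite ltrDr.
Qed.

Lemma cvg_expRN (c : R) : 0 < c -> expR (- (c * x)) @[x --> +oo] --> (0 : R).
Proof.
move=> c0; apply/cvgrPdist_lt => e e0; exists (c * e)^-1; split; first exact: num_real.
move=> x xe; have x0 : 0 < x by apply: lt_trans xe; rewrite invr_gt0 mulr_gt0.
rewrite sub0r normrN ger0_norm ?expR_ge0//; apply: (lt_trans (expRN_lt1 c0 x0)).
rewrite -div1r ltr_pdivrMr ?mulr_gt0// in xe; rewrite -div1r ltr_pdivrMr ?mulr_gt0//.
by have -> : e * (c * x) = x * (c * e) by ring.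
Qed.

Lemma is_derive_expRM (c x : R) : is_derive x 1 (fun t : R => expR (c * t)) (c * expR (c * x)).
Proof. by apply: is_derive_eq; rewrite /GRing.scale /=; ring. Qed.

Lemma continuous_expRM (c : R) : continuous (fun t : R => expR (c * t)).
Proof.
move=> x; apply/differentiable_continuous/derivable1_diffP.
by have [] := is_derive_expRM c x.
Qed.

Lemma integrable_expRN (c : R) : 0 < c ->
  mu.-integrable D0 (EFin \o (fun x => expR (- (c * x)))).
Proof.
move=> c0; have cf : continuous (fun x : R => expR (- (c * x))).
  by under eq_fun do rewrite -mulNr; exact: continuous_expRM.
apply/integrableP; split.
  apply/measurable_EFinP; apply: measurable_funS (continuous_measurable_fun cf) => //.
under eq_integral => x _ do rewrite /= ger0_norm ?expR_ge0//.
have dF (x : R) : is_derive x 1 (fun t : R => - (c^-1 * expR (- (c * t)))) (expR (- (c * x))).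
  have -> : (fun t : R => - (c^-1 * expR (- (c * t)))) = (fun t : R => - (c^-1 * expR (- c * t))).
    by apply/funext => t; rewrite mulNr.
  by apply: is_derive_eq; rewrite /GRing.scale /= mulNr; field; rewrite gt_eqF.
have cF : continuous (fun t : R => - (c^-1 * expR (- (c * t)))).
  move=> x; apply/differentiable_continuous/derivable1_diffP.
  by have [] := dF x.
rewrite (@ge0_continuous_FTC2y R _ (fun t : R => - (c^-1 * expR (- (c * t)))) 0 0).
- by rewrite sub0e -EFinN ltry.
- by move=> x _; exact: expR_ge0.
- exact: continuous_subspaceT.
- rewrite -oppr0 -(mulr0 c^-1); apply: cvgN; apply: cvgMl_tmp; exact: cvg_expRN.
- by move=> x _; have [] := dF x.
- apply: cvg_at_right_filter; exact: cF.
- by move=> x _; rewrite derive1E; have [] := dF x.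
Qed.

Lemma measurableD0 : measurable D0. Proof. exact: measurable_itv. Qed.

Lemma integrable_KexpRN (K c : R) : 0 < c ->
  mu.-integrable D0 (EFin \o (fun x => K * expR (- (c * x)))).
Proof.
by move=> c0; apply: RintegrableZl; [exact: measurableD0|exact: integrable_expRN].
Qed.

Definition cmeasurable (f : R -> C) :=
  measurable_fun (setT : set (measurableTypeR R)) (fun t : measurableTypeR R => complex.Re (f t)) /\
  measurable_fun (setT : set (measurableTypeR R)) (fun t : measurableTypeR R => complex.Im (f t)).

Lemma cmeasurableM f g : cmeasurable f -> cmeasurable g ->
  cmeasurable (fun t => f t * g t).
Proof.
move=> [f1 f2] [g1 g2]; split.
  under eq_fun do rewrite ReM.
  by apply: measurable_funB; apply: measurable_funM.
under eq_fun do rewrite ImM.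
by apply: measurable_funD; apply: measurable_funM.
Qed.

Lemma cmeasurableD f g : cmeasurable f -> cmeasurable g ->
  cmeasurable (fun t => f t + g t).
Proof.
move=> [f1 f2] [g1 g2]; split.
  under eq_fun do rewrite ReD.
  exact: measurable_funD.
under eq_fun do rewrite ImD.
exact: measurable_funD.
Qed.

Lemma cmeasurable_real (f : R -> R) : continuous f -> cmeasurable (fun t => (f t)%:C).
Proof.
by move=> cf; split; [exact: continuous_measurable_fun|exact: measurable_cst].
Qed.

Lemma rcontinuous_cmeasurable f : (forall t, rcontinuous_at f t) -> cmeasurable f.
Proof.
by move=> cf; split; apply: continuous_measurable_fun => t;
  have [] := rcontinuous_ReIm (cf t).
Qed.

Lemma rcontinuous_cexp (a : C) t : rcontinuous_at (fun t : R => cexp (a * t%:C)) t.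
Proof.
move=> e e0; have a1 : 0 < normc a + 1 by rewrite ltr_wpDl ?normc_ge0.
have [d d0 dP] := derivable_ccontinuous (@derivable_cexp R (a * t%:C)) e0.
exists (d / (normc a + 1)); first by rewrite divr_gt0.
move=> u ut; apply: dP; rewrite -mulrBr -rmorphB normcM normc_real.
rewrite ltr_pdivlMr// in ut; apply: le_lt_trans ut.
by rewrite mulrC ler_wpM2l// lerDl.
Qed.

Lemma cmeasurable_cexp (a : C) : cmeasurable (fun t : R => cexp (a * t%:C)).
Proof. by apply: rcontinuous_cmeasurable => t; exact: rcontinuous_cexp. Qed.

Lemma normc_cexpM (a : C) (t : R) : normc (cexp (a * t%:C)) = expR (complex.Re a * t).
Proof. by rewrite normc_cexp ReM /= mulr0 subr0. Qed.

Lemma cintegrable_D0 f (K c : R) : 0 < c -> cmeasurable f ->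
  (forall t, 0 <= t -> normc (f t) <= K * expR (- (c * t))) -> cintegrable D0 f.
Proof.
move=> c0 [m1 m2] fK.
apply: (@cintegrable_le _ _ _ (fun x => K * expR (- (c * x)))).
- exact: measurableD0.
- exact: measurable_funS m1.
- exact: measurable_funS m2.
- exact: integrable_KexpRN.
- by move=> t /=; rewrite in_itv /= andbT; exact: fK.
Qed.

(** Truncate at [n]: the truncated integral is F(n) - F(0), it converges by domination, and F(n)
    tends to 0 by the bound on [F]. *)
Lemma cint_halfline_FTC (F f : R -> C) (K c : R) :
  (forall x : R, is_derive x 1 (fun t => complex.Re (F t)) (complex.Re (f x))) ->
  (forall x : R, is_derive x 1 (fun t => complex.Im (F t)) (complex.Im (f x))) ->
  (forall t, rcontinuous_at f t) -> 0 < c ->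
  (forall t, 0 <= t -> normc (f t) <= K * expR (- (c * t))) ->
  (forall t, 0 <= t -> normc (F t) <= K * expR (- (c * t))) ->
  cint D0 f = - F 0.
Proof.
move=> d1 d2 cf c0 fK FK.
pose f_ (n : nat) (t : R) : C := if t <= n%:R then f t else 0.
have restr (n : nat) (u : R -> R) : \int[mu]_(t in `[0, n%:R]) u t =
    \int[mu]_(t in D0) (if t <= n%:R then u t else 0).
  have -> : `[0, n%:R]%classic = D0 `&` [set t : R | t <= n%:R].
    apply/seteqP; split=> t /=; rewrite !in_itv /=; first by move=> /andP[-> ->].
    by rewrite andbT => -[-> ->].
  rewrite Rintegral_mkcondr; apply: eq_Rintegral => t _; rewrite /patch.
  by case: ifPn => [|]; rewrite ?inE ?notin_setE /=; [move=> ->|move/negP/negbTE ->].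
have fE n : cint D0 (f_ n) = F n%:R - F 0.
  rewrite -(cint_FTC _ d1 d2 cf)//; apply: eqC => /=; rewrite restr;
    by apply: eq_Rintegral => t _; rewrite /f_; case: ifP.
have [m1 m2] := rcontinuous_cmeasurable cf.
have mif (n : nat) (u : R -> R) : measurable_fun (setT : set (measurableTypeR R)) (u : measurableTypeR R -> R) ->
   measurable_fun D0 (fun t : measurableTypeR R => if t <= n%:R then u t else 0).
  move=> mu'.
  have : measurable_fun (setT : set (measurableTypeR R))
      (fun t : measurableTypeR R => if t <= n%:R then u t else 0).
    apply: measurable_fun_ifT => //.
    by apply: measurable_fun_ler => //; exact: measurable_cst.
  exact: measurable_funS.
have [_ lim] := @cint_dominated R D0 f_ f (fun x => K * expR (- (c * x))) measurableD0
  ltac:(by move=> n; apply: (eq_measurable_fun (fun t : measurableTypeR R => if t <= n%:R then complex.Re (f t) else 0));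
     [move=> t _; rewrite /f_; case: ifP|exact: mif])
  ltac:(by move=> n; apply: (eq_measurable_fun (fun t : measurableTypeR R => if t <= n%:R then complex.Im (f t) else 0));
     [move=> t _; rewrite /f_; case: ifP|exact: mif])
  ltac:(move=> t _ e e0; exists (Num.bound `|t|) => // n /= tn; rewrite /f_ ifT ?subrr ?normc0//;
     apply: (le_trans (ler_norm t)); apply: ltW; apply: (lt_le_trans (archi_boundP _)) => //; by rewrite ler_nat)
  (integrable_KexpRN K c0)
  ltac:(move=> n t /=; rewrite in_itv /= andbT => t0; rewrite /f_; case: ifP => _; [exact: fK|];
     by rewrite normc0; apply: le_trans (fK t t0); exact: normc_ge0).
apply/subr0_eq/eq0_normc/le_anti; rewrite normc_ge0 andbT opprK.
apply/ler_addgt0Pr => e e0; rewrite add0r; have e2 : 0 < e / 2 by rewrite divr_gt0.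
have Fn0 : \forall n \near \oo, K * expR (- (c * n%:R)) < e / 2.
  have : (fun n : nat => K * expR (- (c * n%:R))) @ \oo --> K * 0.
    by apply: cvgMl_tmp; apply: (cvg_comp _ _ cvgr_idn (cvg_expRN c0)).
  rewrite mulr0 => /cvgrPdist_lt/(_ _ e2); apply: filterS => n.
  by rewrite sub0r normrN; apply: le_lt_trans; exact: ler_norm.
near \oo => n.
have -> : cint D0 f + F 0 = (cint D0 f - cint D0 (f_ n)) + F n%:R by rewrite fE; ring.
apply: (le_trans (normcD _ _)); rewrite (splitr e) lerD//.
  by apply: ltW; near: n; exact: lim.
apply: (le_trans (FK _ _)) => //; apply: ltW; near: n; exact: Fn0.
Unshelve. all: by end_near. Qed.

End HalfLine.

(** * Euler's integrals *)

Section GammaIntegral.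
Variable R : realType.
Local Notation C := R[i].
Local Notation D0 := (`[0%R, +oo[%classic : set (measurableTypeR R)).

Definition cder (f : R -> C) (t : R) (l : C) :=
  is_derive t (1 : R) (fun u => complex.Re (f u)) (complex.Re l) /\
  is_derive t (1 : R) (fun u => complex.Im (f u)) (complex.Im l).

Lemma cderN f t k : cder f t k -> cder (fun u => - f u) t (- k).
Proof.
move=> [f1 f2]; split.
  under eq_fun do rewrite ReN.
  by rewrite ReN; apply: is_derive_eq.
under eq_fun do rewrite ImN.
by rewrite ImN; apply: is_derive_eq.
Qed.

Lemma cderM f g t k l : cder f t k -> cder g t l ->
  cder (fun u => f u * g u) t (k * g t + f t * l).
Proof.
move=> [f1 f2] [g1 g2]; split.
  under eq_fun do rewrite ReM.
  by apply: is_derive_eq; rewrite ReD !ReM /GRing.scale /=; ring.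
under eq_fun do rewrite ImM.
by apply: is_derive_eq; rewrite ImD !ImM /GRing.scale /=; ring.
Qed.

Lemma cder_real (f : R -> R) (t l : R) : is_derive t (1 : R) f l -> cder (fun u => (f u)%:C) t l%:C.
Proof. by move=> df; split => //=; exact: is_derive_cst. Qed.

Lemma cder_cexp (a : C) t : cder (fun u => cexp (a * u%:C)) t (a * cexp (a * t%:C)).
Proof.
have E u : cexp (a * u%:C) =
    (expR (complex.Re a * u) * cos (complex.Im a * u)) +i*
    (expR (complex.Re a * u) * sin (complex.Im a * u)).
  rewrite /cexp ReM ImM /= mulr0 subr0 mulr0 add0r.
  by apply: eqC; rewrite ?ReM ?ImM /= mul0r ?subr0 ?addr0.
have d1 : is_derive t 1 (fun u : R => expR (complex.Re a * u)) (complex.Re a * expR (complex.Re a * t)).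
  exact: is_derive_expRM.
have d2 : is_derive t 1 (fun u : R => cos (complex.Im a * u)) (- (complex.Im a * sin (complex.Im a * t))).
  by apply: is_derive_eq; rewrite /GRing.scale /=; ring.
have d3 : is_derive t 1 (fun u : R => sin (complex.Im a * u)) (complex.Im a * cos (complex.Im a * t)).
  by apply: is_derive_eq; rewrite /GRing.scale /=; ring.
split.
  under eq_fun do rewrite E.
  by apply: is_derive_eq; rewrite E ReM /GRing.scale /=; ring.
under eq_fun do rewrite E.
by apply: is_derive_eq; rewrite E ImM /GRing.scale /=; ring.
Qed.

Lemma cder_rcontinuous f t l : cder f t l -> rcontinuous_at f t.
Proof.
move=> [[d1 _] [d2 _]] e e0; have e2 : 0 < e / 2 by rewrite divr_gt0.
have /cvgrPdist_lt/(_ _ e2)/nbhs_ballP[r1 r10 h1] :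
    {for t, continuous (fun u => complex.Re (f u))}.
  exact/differentiable_continuous/derivable1_diffP.
have /cvgrPdist_lt/(_ _ e2)/nbhs_ballP[r2 r20 h2] :
    {for t, continuous (fun u => complex.Im (f u))}.
  by apply/differentiable_continuous/derivable1_diffP.
exists (Num.min r1 r2); first by rewrite lt_min; apply/andP.
move=> u; rewrite lt_min distrC => /andP[/h1 /= u1 /h2 /= u2].
rewrite normc_distC; apply: (le_lt_trans (normc_le_ReIm _)).
by rewrite ReD ImD ReN ImN (splitr e) ltrD.
Qed.

(** The factor exp (- r t) after the substitution t = e^v. *)
Definition edecay (r v : R) : R := expR (- (r * expR v)).

Lemma edecay_ge0 r v : 0 <= edecay r v. Proof. exact: expR_ge0. Qed.

Lemma edecay_le1 r v : 0 < r -> edecay r v <= 1.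
Proof. by move=> r0; rewrite -expR0 ler_expR oppr_le0 mulr_ge0 ?expR_ge0 ?ltW. Qed.

(** From exp x >= x^(n+1) / (n+1)! at x = r e^v, with n + 1 >= k. *)
Lemma edecay_rapid (r k : R) : 0 < r ->
  exists2 K : R, 0 <= K & forall v, 0 <= v -> edecay r v <= K * expR (- (k * v)).
Proof.
move=> r0; pose n := Num.bound `|k|.
have kn : k <= n.+1%:R.
  apply: (le_trans (ler_norm _)); apply: (le_trans (ltW (archi_boundP _))) => //.
  by rewrite ler_nat.
exists ((n.+1)`!%:R / r ^+ n.+1); first by rewrite divr_ge0// exprn_ge0// ltW.
move=> v v0; have x0 : 0 < r * expR v by rewrite mulr_gt0 ?expR_gt0.
have h := @expR_ge1Dxn R (r * expR v) n (ltW x0).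
have f0 : (0 : R) < (n.+1)`!%:R by rewrite ltr0n fact_gt0.
apply: (@le_trans _ _ ((n.+1)`!%:R / (r * expR v) ^+ n.+1)).
  rewrite /edecay expRN -[leRHS]invrK invf_div lef_pV2 ?posrE ?expR_gt0 ?divr_gt0 ?exprn_gt0//.
  by apply: le_trans h; rewrite lerDr.
rewrite exprMn invfM mulrA ler_wpM2l ?divr_ge0 ?exprn_ge0 ?(ltW r0)//.
by rewrite -expRM_natl -expRN ler_expR lerN2 ler_wpM2r.
Qed.

Lemma continuous_edecay r : continuous (edecay r).
Proof.
move=> v; apply: (@continuous_comp _ _ _ (fun v => - (r * expR v)) expR); last exact: continuous_expR.
by apply: continuousN; apply: continuousM; [exact: cst_continuous|exact: continuous_expR].
Qed.

Lemma continuous_edecayN r : continuous (fun v => edecay r (- v)).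
Proof.
move=> v; apply: (@continuous_comp _ _ _ -%R (edecay r)); last exact: continuous_edecay.
exact: opp_continuous.
Qed.

(* The integral of [gker r a] over the half-line is
   [int_0^oo t^(a-1) e^(-rt) dt], by the substitutions [t = e^v] and [t = e^-v]. *)
Definition gker (r : R) (a : C) (v : R) : C :=
  cexp (a * v%:C) * (edecay r v)%:C + cexp (- a * v%:C) * (edecay r (- v))%:C.

Definition gint (r : R) (a : C) : C := cint D0 (gker r a).

Lemma cmeasurable_gker r a : cmeasurable (gker r a).
Proof.
apply: cmeasurableD; apply: cmeasurableM; try exact: cmeasurable_cexp; apply: cmeasurable_real.
  exact: continuous_edecay.
exact: continuous_edecayN.
Qed.

Lemma normc_cexpMr (a : C) (v b : R) :
  normc (cexp (a * v%:C) * b%:C) = expR (complex.Re a * v) * `|b|.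
Proof. by rewrite normcM normc_cexpM normc_real. Qed.

Lemma gker_bound r a : 0 < r -> 0 < complex.Re a -> exists K : R,
  forall v, 0 <= v -> normc (gker r a v) <= K * expR (- (complex.Re a * v)).
Proof.
move=> r0 a0; have [K K0 hK] := edecay_rapid (2 * complex.Re a) r0.
exists (K + 1) => v v0; apply: (le_trans (normcD _ _)).
rewrite (normc_cexpMr a) (normc_cexpMr (- a)) (ger0_norm (edecay_ge0 r v)).
rewrite (ger0_norm (edecay_ge0 r (- v))) mulrDl mul1r ReN mulNr.
apply: lerD; last by rewrite ler_piMr ?expR_ge0// edecay_le1.
apply: (le_trans (ler_wpM2l (expR_ge0 _) (hK v v0))).
rewrite mulrCA ler_wpM2l// -expRD ler_expR le_eqVlt; apply/orP; left; apply/eqP; ring.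
Qed.

Lemma cintegrable_gker r a : 0 < r -> 0 < complex.Re a -> cintegrable D0 (gker r a).
Proof.
move=> r0 a0; have [K hK] := gker_bound r0 a0.
exact: (cintegrable_D0 a0 (cmeasurable_gker r a) hK).
Qed.


Lemma is_derive_pow (f : R -> R) (v l : R) m : is_derive v (1 : R) f l ->
  is_derive v (1 : R) (fun v => f v ^+ m.+1) (m.+1%:R * f v ^+ m * l).
Proof.
move=> df; elim: m => [|m IH].
  by under eq_fun do rewrite expr1; rewrite expr0 !mul1r.
under eq_fun do rewrite exprS.
by apply: is_derive_eq; rewrite /GRing.scale /= -[m.+2%:R]natr1 [_ ^+ m.+1]exprS; ring.
Qed.

(** The product rule behind the integration by parts in Euler's integral. The values e = 1 and e =
    -1 serve the two substitutions t = e^v and t = e^-v; in the second term the exponent has moved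
    from [a] to [a + e]. *)
Lemma cder_pow1 (c e : R) (m : nat) (a : C) (v : R) :
  cder (fun v => cexp (a * v%:C) * ((1 - c * expR (e * v)) ^+ m.+1)%:C) v
   (a * (cexp (a * v%:C) * ((1 - c * expR (e * v)) ^+ m.+1)%:C) -
    (e * m.+1%:R * c)%:C * (cexp ((a + e%:C) * v%:C) * ((1 - c * expR (e * v)) ^+ m)%:C)).
Proof.
have d1 : is_derive v (1 : R) (fun v => 1 - c * expR (e * v)) (- (c * (e * expR (e * v)))).
  have d0 := is_derive_expRM e v.
  by apply: is_derive_eq; rewrite /GRing.scale /=; ring.
have d2 : is_derive v (1 : R) (fun v => (1 - c * expR (e * v)) ^+ m.+1)
   (- (e * m.+1%:R * c) * (expR (e * v) * (1 - c * expR (e * v)) ^+ m)).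
  by apply: is_derive_eq (is_derive_pow m d1) _; ring.
have := cderM (cder_cexp a v) (cder_real d2).
rewrite mulrDl (cexpD (a * _)) -rmorphM cexp_real !rmorphM rmorphN /= !rmorphM /=.
by congr cder; ring.
Qed.

Lemma cder_rcontinuous_ex f t : (exists l, cder f t l) -> rcontinuous_at f t.
Proof. by case=> l; exact: cder_rcontinuous. Qed.

Lemma rcontinuous_pow1 (c e : R) (m : nat) (a : C) (v : R) :
  rcontinuous_at (fun v => cexp (a * v%:C) * ((1 - c * expR (e * v)) ^+ m)%:C) v.
Proof.
apply: cder_rcontinuous_ex; case: m => [|m]; last by eexists; exact: cder_pow1.
eexists; apply: cderM (cder_cexp a v) _; apply: (cder_real (l := 0)).
by under eq_fun do rewrite expr0; exact: is_derive_cst.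
Qed.

Lemma rcontinuous_lin f g (a b : C) t : rcontinuous_at f t -> rcontinuous_at g t ->
  rcontinuous_at (fun t => a * f t - b * g t) t.
Proof.
move=> hf hg e e0.
have a0 : 0 < normc a + normc b + 1 by rewrite ltr_wpDl ?addr_ge0 ?normc_ge0.
have e1 : 0 < e / (normc a + normc b + 1) by rewrite divr_gt0.
have [d1 d10 h1] := hf _ e1; have [d2 d20 h2] := hg _ e1.
exists (Num.min d1 d2); first by rewrite lt_min d10.
move=> u; rewrite lt_min => /andP[/h1 u1 /h2 u2].
have -> : a * f u - b * g u - (a * f t - b * g t) = a * (f u - f t) - b * (g u - g t) by ring.
apply: (le_lt_trans (normcB _ _)); rewrite !normcM.
apply: (@le_lt_trans _ _ ((normc a + normc b) * (e / (normc a + normc b + 1)))).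
  by rewrite mulrDl lerD// ler_wpM2l ?normc_ge0// ltW.
by rewrite mulrA ltr_pdivrMr// mulrC ltr_pM2l// ltrDl.
Qed.

(* For [c = r / n] and [m = n] this is Euler's integral of
   [t^(a-1) (1 - r t / n)^n] over [0, n / r], again with [t = e^v] and [t = e^-v]. *)
Definition eint (c : R) (a : C) (m : nat) : C :=
  cint `[0, - ln c] (fun v => cexp (a * v%:C) * ((1 - c * expR (1 * v)) ^+ m)%:C) +
  cint D0 (fun v => cexp (- a * v%:C) * ((1 - c * expR (- 1 * v)) ^+ m)%:C).

Lemma pow1N_bound (c v : R) m : 0 < c <= 1 -> 0 <= v ->
  0 <= (1 - c * expR (- 1 * v)) ^+ m <= 1.
Proof.
move=> /andP[c0 c1] v0; have e1 : expR (- 1 * v) <= 1.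
  by rewrite -[leRHS]expR0 ler_expR mulN1r oppr_le0.
have e0 := expR_gt0 (-1 * v).
have h : c * expR (- 1 * v) <= 1 by rewrite mulr_ile1 ?(ltW c0) ?(ltW e0).
have h0 : 0 < c * expR (- 1 * v) by rewrite mulr_gt0.
have [h1 h2] : 0 <= 1 - c * expR (- 1 * v) /\ 1 - c * expR (- 1 * v) <= 1 by split; move: h h0; lra.
by rewrite exprn_ge0 ?exprn_ile1.
Qed.

Lemma eint_int2 (c : R) (a : C) m : 0 < c <= 1 -> 0 < complex.Re a ->
  forall t, 0 <= t -> normc (cexp (- a * t%:C) * ((1 - c * expR (- 1 * t)) ^+ m)%:C)
    <= 1 * expR (- (complex.Re a * t)).
Proof.
move=> c01 a0 t t0; rewrite normc_cexpMr ReN [- complex.Re a * t]mulNr [leRHS]mul1r.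
have /andP[h0 h1] := pow1N_bound m c01 t0.
by rewrite ger0_norm// ler_piMr ?expR_ge0.
Qed.

(** Integration by parts on both pieces: the boundary term at [v = - ln c] vanishes with the cut-off
    factor, and the two boundary terms at [v = 0], that is t = 1, cancel. *)
Lemma eint_rec (c : R) (a : C) m : 0 < c <= 1 -> 0 < complex.Re a ->
  a * eint c a m.+1 = (m.+1%:R * c)%:C * eint c (a + 1) m.
Proof.
move=> c01 a0; have /andP[c0 c1] := c01.
have a1 : 0 < complex.Re (a + 1) by rewrite ReD /= addr_gt0.
have L0 : 0 <= - ln c by rewrite oppr_ge0 ln_le0.
have mD := @measurableD0 R.
pose f b m v := cexp (b * v%:C) * ((1 - c * expR (1 * v)) ^+ m)%:C.
pose g b m v := cexp (- b * v%:C) * ((1 - c * expR (- 1 * v)) ^+ m)%:C.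
have cf b k t : rcontinuous_at (f b k) t by exact: rcontinuous_pow1.
have cg b k t : rcontinuous_at (g b k) t by exact: rcontinuous_pow1.
have fi b k : cintegrable `[0, - ln c] (f b k) by apply: cintegrable_itv => t _.
have gi b k : 0 < complex.Re b -> cintegrable D0 (g b k).
  move=> b0; apply: (@cintegrable_D0 _ _ 1 _ b0); last exact: eint_int2.
  by apply: rcontinuous_cmeasurable => t; exact: cg.
pose k : C := (m.+1%:R * c)%:C.
have h1 : a * cint `[0, - ln c] (f a m.+1) - k * cint `[0, - ln c] (f (a + 1) m) =
    - ((1 - c) ^+ m.+1)%:C.
  rewrite -!cintZ// -cintB//; try exact: cintegrableZ.
  have dF t : cder (f a m.+1) t (a * f a m.+1 t - k * f (a + 1) m t).
    have := cder_pow1 c 1 m a t; rewrite -/(f a m.+1 t) /k /f.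
    by rewrite [1 * m.+1%:R]mul1r.
  rewrite (@cint_FTC R (f a m.+1) _ _ _ L0 (fun t => proj1 (dF t)) (fun t => proj2 (dF t))); last first.
    by move=> t; exact: rcontinuous_lin.
  rewrite /f !mul1r expR0 mulr1 expRN lnK ?posrE// mulfV ?gt_eqF// subrr expr0n /= !mulr0.
  by rewrite sub0r cexp0 mul1r.
have h2 : a * cint D0 (g a m.+1) - k * cint D0 (g (a + 1) m) = ((1 - c) ^+ m.+1)%:C.
  rewrite -!cintZ//; try exact: gi.
  rewrite -cintB//; try (apply: cintegrableZ => //; exact: gi).
  have dF t : cder (fun t => - g a m.+1 t) t (a * g a m.+1 t - k * g (a + 1) m t).
    have := cderN (cder_pow1 c (-1) m (- a) t); rewrite /k /g.
    have -> : - (a + 1) = - a + (-1 : R)%:C by rewrite rmorphN rmorph1 opprD.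
    have -> : - 1 * m.+1%:R * c = - (m.+1%:R * c) by ring.
    by rewrite (rmorphN _ (m.+1%:R * c)) /=; congr cder; ring.
  rewrite (@cint_halfline_FTC R (fun t => - g a m.+1 t) _ (normc a + normc k + 1) (complex.Re a)
    (fun t => proj1 (dF t)) (fun t => proj2 (dF t)))//.
  - by rewrite opprK /g mulr0 cexp0 mul1r mulr0 expR0 mulr1.
  - by move=> t; exact: rcontinuous_lin.
  - move=> t t0; apply: (le_trans (normcB _ _)); rewrite (normcM a) (normcM k).
    have b1 := @eint_int2 c a m.+1 c01 a0 t t0.
    have b2 := @eint_int2 c (a + 1) m c01 a1 t t0.
    have b3 : expR (- (complex.Re (a + 1) * t)) <= expR (- (complex.Re a * t)).
      by rewrite ler_expR lerN2 ler_wpM2r// ReD /= lerDl.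
    rewrite [leRHS]mul1r in b1; rewrite [leRHS]mul1r in b2; rewrite 2!mulrDl.
    apply: ler_wpDr; first by rewrite mul1r expR_ge0.
    by apply: lerD; rewrite ler_wpM2l ?normc_ge0//; exact: (le_trans b2 b3).
  - move=> t t0; rewrite normcNE; apply: le_trans (@eint_int2 c a m.+1 c01 a0 t t0) _.
    by rewrite ler_wpM2r ?expR_ge0// lerDr addr_ge0 ?normc_ge0.
change (a * (cint `[0, - ln c] (f a m.+1) + cint D0 (g a m.+1)) =
  k * (cint `[0, - ln c] (f (a + 1) m) + cint D0 (g (a + 1) m))).
move: h1 h2; move: (cint _ (f a m.+1)) (cint _ (g a m.+1)) (cint _ (f (a + 1) m))
  (cint _ (g (a + 1) m)) => u1 u3 u2 u4 h1 h2; apply/subr0_eq.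
transitivity ((a * u1 - k * u2) + (a * u3 - k * u4)); first by ring.
by rewrite h1 h2 addNr.
Qed.

Lemma eint0 (c : R) (a : C) : 0 < c <= 1 -> 0 < complex.Re a ->
  a * eint c a 0 = cexp (a * (- ln c)%:C).
Proof.
move=> c01 a0; have /andP[c0 c1] := c01.
have L0 : 0 <= - ln c by rewrite oppr_ge0 ln_le0.
have mD := @measurableD0 R; rewrite /eint.
have ce b t : rcontinuous_at (fun t : R => b * cexp (b * t%:C)) t.
  by apply: (cder_rcontinuous (l := 0 * cexp (b * t%:C) + b * (b * cexp (b * t%:C))));
   apply: cderM (cder_cexp _ _); split => /=; exact: is_derive_cst.
rewrite (@eq_cint _ _ _ (fun v => cexp (a * v%:C))); last by move=> t _; rewrite expr0 mulr1.
rewrite (@eq_cint _ D0 _ (fun v => cexp (- a * v%:C))); last by move=> t _; rewrite expr0 mulr1.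
have bd t : 0 <= t -> normc (cexp (- a * t%:C)) <= 1 * expR (- (complex.Re a * t)).
  by move=> _; rewrite normc_cexpM ReN mulNr mul1r.
have i2 : cintegrable D0 (fun v => cexp (- a * v%:C)).
  exact: (cintegrable_D0 a0 (cmeasurable_cexp _) bd).
have i1 : cintegrable `[0, - ln c] (fun v => cexp (a * v%:C)).
  by apply: cintegrable_itv => t _; exact: rcontinuous_cexp.
rewrite mulrDr -[X in _ + X]opprK -[in X in _ + X]mulNr -!cintZ//.
rewrite (@cint_FTC R (fun v => cexp (a * v%:C)) _ _ _ L0 (fun t => proj1 (cder_cexp a t))
  (fun t => proj2 (cder_cexp a t)))//.
rewrite (@cint_halfline_FTC R (fun v => cexp (- a * v%:C)) _ (normc a + 1) (complex.Re a)
  (fun t => proj1 (cder_cexp (- a) t)) (fun t => proj2 (cder_cexp (- a) t)))//.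
- by rewrite !mulr0 cexp0; ring.
- move=> t t0; rewrite normcM normcNE mulrDl ler_wpDr ?mul1r ?expR_ge0//.
  by rewrite ler_wpM2l ?normc_ge0//; have := bd t t0; rewrite mul1r.
- move=> t t0; apply: (le_trans (bd t t0)).
  by rewrite ler_wpM2r ?expR_ge0// lerDr normc_ge0.
Qed.

(** Iterating [eint_rec] lowers the exponent to 0 while [a] rises to [a + m]; the factor c^m
    collected on the way combines with c^(-a-m) from [eint0] to c^(-a). *)
Lemma eint_prod (c : R) m : 0 < c <= 1 -> forall a : C, 0 < complex.Re a ->
  (\prod_(k < m.+1) (a + k%:R)) * eint c a m = m`!%:R * cexp (a * (- ln c)%:C).
Proof.
move=> c01; have /andP[c0 c1] := c01.
elim: m => [|m IH] a a0; first by rewrite big_ord1 addr0 eint0// mul1r.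
have a1 : 0 < complex.Re (a + 1) by rewrite ReD /= addr_gt0.
rewrite big_ord_recl /= addr0 mulrAC eint_rec//.
under eq_bigr => k _ do rewrite /bump /= add1n -natr1 [_ + 1]addrC addrA.
rewrite -mulrA [eint _ _ _ * _]mulrC IH// mulrDl mul1r cexpD [cexp (- ln c)%:C]cexp_real.
rewrite expRN lnK ?posrE// factS natrM rmorphM rmorph_nat fmorphV /=.
have c0' : c%:C != 0 by rewrite -normc_eq0 normc_real normr_eq0 gt_eqF.
set E := cexp _; set F := m`!%:R; set N := _.+1%:R.
transitivity (N * F * E * (c%:C / c%:C)); first by ring.
by rewrite mulfV// mulr1.
Qed.

End GammaIntegral.

(** * Laplace transforms *)

Section Laplace.
Variable R : realType.
Local Notation C := R[i].
Local Notation mu := (@lebesgue_measure R).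
Local Notation D0 := (`[0%R, +oo[%classic : set (measurableTypeR R)).

Definition laplace (w : R -> C) (a : C) : C := cint D0 (fun v => cexp (a * v%:C) * w v).

Lemma laplace_bound w (K k : R) (a : C) :
  (forall v, 0 <= v -> normc (w v) <= K * expR (- (k * v))) ->
  forall v, 0 <= v -> normc (cexp (a * v%:C) * w v) <= K * expR (- ((k - complex.Re a) * v)).
Proof.
move=> wK v v0; rewrite normcM normc_cexpM.
apply: (le_trans (ler_wpM2l (expR_ge0 _) (wK v v0))).
by rewrite mulrCA -expRD mulrBl opprB.
Qed.

Lemma cintegrable_laplace w (K k : R) (a : C) : cmeasurable w ->
  (forall v, 0 <= v -> normc (w v) <= K * expR (- (k * v))) -> complex.Re a < k ->
  cintegrable D0 (fun v => cexp (a * v%:C) * w v).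
Proof.
move=> mw wK ak; have ak' : 0 < k - complex.Re a by rewrite subr_gt0.
apply: (cintegrable_D0 ak' _ (laplace_bound a wK)).
by apply: cmeasurableM => //; exact: cmeasurable_cexp.
Qed.

Lemma derivable_laplace w (K k : R) (a : C^o) : cmeasurable w ->
  (forall v, 0 <= v -> normc (w v) <= K * expR (- (k * v))) -> complex.Re a < k ->
  derivable (laplace w : C^o -> C^o) a 1.
Proof.
move=> mw wK ak; have mD := @measurableD0 R.
have K0 : 0 <= K.
  by have := le_trans (normc_ge0 _) (wK 0 (lexx 0)); rewrite mulr0 oppr0 expR0 mulr1.
(* The exponential room is cut in four: one quarter absorbs v^2, another absorbs exp (|h| v), and
   the rest leaves an integrable factor. The remainder is then of order |h|^2, which gives
   differentiation under the integral. *)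
pose d := (k - complex.Re a) / 4.
have d0 : 0 < d by rewrite divr_gt0// subr_gt0.
have kd : k - complex.Re a = 4 * d by rewrite /d mulrC divfK.
pose g v := v%:C * w v.
have vd (v : R) : 0 <= v -> v <= d^-1 * expR (d * v).
  move=> v0; rewrite mulrC ler_pdivlMr// mulrC.
  by apply: le_trans (expR_ge1Dx _); rewrite lerDr.
have vd2 (v : R) : 0 <= v -> v ^+ 2 <= 2 / d ^+ 2 * expR (d * v).
  move=> v0; rewrite mulrAC ler_pdivlMr ?exprn_gt0// -exprMn [v * d]mulrC.
  by apply: expR_ge_sqr; rewrite mulr_ge0// ltW.
have mid : continuous (fun v : R => v) by move=> ?; exact: cvg_id.
have mg : cmeasurable g by apply: cmeasurableM => //; exact: cmeasurable_real.
have gK v : 0 <= v -> normc (g v) <= d^-1 * K * expR (- ((k - d) * v)).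
  move=> v0; rewrite /g normcM normc_real ger0_norm//.
  apply: le_trans (ler_pM v0 (normc_ge0 _) (vd v v0) (wK v v0)) _.
  by rewrite mulrACA -expRD mulrBl opprB.
have ig : cintegrable D0 (fun v => cexp (a * v%:C) * g v).
  apply: (cintegrable_laplace mg gK).
  by rewrite -subr_gt0; move: kd; rewrite -mulr_natl; lra.
pose M := 2 * (4 * K / d ^+ 2 * \int[mu]_(v in D0) expR (- (d * v))).
apply: (@cderiv_derivable _ _ _ (cint D0 (fun v => cexp (a * v%:C) * g v))).
move=> e e0; exists (Num.min d (e / (`|M| + 1))).
  by rewrite lt_min d0 divr_gt0// ltr_wpDl.
move=> h; rewrite lt_min => /andP[hd he].
have i1 : cintegrable D0 (fun v => cexp (a * v%:C) * w v).
  apply: (cintegrable_laplace mw wK ak).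
have Rh : complex.Re h <= d.
  apply: ltW; apply: le_lt_trans hd; apply: (le_trans (ler_norm _)); exact: normr_Re_le.
have i2 : cintegrable D0 (fun v => cexp ((a + h) * v%:C) * w v).
  apply: (cintegrable_laplace mw wK); rewrite ReD.
  by move: kd Rh d0; lra.
rewrite /laplace [X in _ - X]mulrC -cintZ// -!cintB//; try exact: cintegrableZ.
  2: exact: cintegrableB.
have ir : cintegrable D0 (fun v => (cexp ((a + h) * v%:C) * w v - cexp (a * v%:C) * w v) -
   h * (cexp (a * v%:C) * g v)).
  by apply: cintegrableB => //; [exact: cintegrableB|exact: cintegrableZ].
have bound v : D0 v -> normc ((cexp ((a + h) * v%:C) * w v - cexp (a * v%:C) * w v) -
   h * (cexp (a * v%:C) * g v)) <= normc h ^+ 2 * (4 * K / d ^+ 2) * expR (- (d * v)).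
  rewrite /= in_itv /= andbT => v0.
  have -> : cexp ((a + h) * v%:C) * w v - cexp (a * v%:C) * w v - h * (cexp (a * v%:C) * g v) =
      (cexp (a * v%:C) * w v) * (cexp (h * v%:C) - 1 - h * v%:C).
    by rewrite mulrDl cexpD /g; ring.
  rewrite normcM; apply: (le_trans (ler_wpM2l (normc_ge0 _) (normc_cexp_sub1x _))).
  rewrite (normcM h) normc_real ger0_norm//.
  apply: (le_trans (ler_wpM2r _ (laplace_bound a wK v0))).
    by rewrite !mulr_ge0// ?exprn_ge0 ?mulr_ge0 ?normc_ge0 ?expR_ge0.
  rewrite exprMn kd.
  have e1 : expR (normc h * v) <= expR (d * v) by rewrite ler_expR ler_wpM2r// ltW.
  have h1 := ler_pM (sqr_ge0 v) (expR_ge0 _) (vd2 v v0) e1.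
  have h2 : 0 <= K * expR (- (4 * d * v)) * (2 * normc h ^+ 2).
    by rewrite !mulr_ge0// ?expR_ge0 ?sqr_ge0 ?normc_ge0.
  have := ler_wpM2l h2 h1.
  have -> : expR (- (4 * d * v)) = expR (- (2 * d * v)) * expR (- (d * v)) * expR (- (d * v)).
    by rewrite -!expRD; congr expR; ring.
  have e2 : expR (- (d * v)) * expR (d * v) = 1 by rewrite -expRD addNr expR0.
  have e3 : expR (- (2 * d * v)) <= expR (- (d * v)).
    have := mulr_ge0 (ltW d0) v0; rewrite ler_expR lerN2; clear; lra.
  move: e2 e3 (expR_gt0 (- (2 * d * v))); set E := expR (d * v).
  set Ei := expR (- (d * v)); set E2 := expR (- (2 * d * v)); set N := expR (normc h * v).
  move=> e2 e3 e20 H; apply: le_trans (_ : _ <= K * (E2 * Ei * Ei) * (2 * normc h ^+ 2) * (v ^+ 2 * N)) _.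
    by rewrite le_eqVlt; apply/orP; left; apply/eqP; ring.
  apply: (le_trans H).
  have -> : K * (E2 * Ei * Ei) * (2 * normc h ^+ 2) * (2 / d ^+ 2 * E * E) =
     (normc h ^+ 2 * (4 * K / d ^+ 2)) * (E2 * (Ei * E) * (Ei * E)) by ring.
  rewrite e2 !mulr1 ler_wpM2l// !mulr_ge0// ?exprn_ge0 ?normc_ge0//.
  by rewrite invr_ge0 exprn_ge0// ltW.
have := normc_cint_le mD ir (integrable_KexpRN _ d0) bound.
rewrite RintegralZl//; last exact: integrable_expRN.
move=> H; apply: (le_trans H).
have -> : 2 * (normc h ^+ 2 * (4 * K / d ^+ 2) * \int[mu]_(v in D0) expR (- (d * v))) =
  normc h * (normc h * M) by rewrite /M; ring.
rewrite mulrC ler_wpM2r ?normc_ge0//.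
have M1 : 0 < `|M| + 1 by rewrite ltr_wpDl.
apply: (@le_trans _ _ (normc h * (`|M| + 1))).
  by rewrite ler_wpM2l ?normc_ge0// ler_wpDr// ler_norm.
by rewrite -ler_pdivlMr// ltW.
Qed.
End Laplace.

(** * Euler's finite integrals converge to the gamma integral *)

Section Gamma.
Variable R : realType.
Local Notation C := R[i].
Local Notation mu := (@lebesgue_measure R).
Local Notation D0 := (`[0%R, +oo[%classic : set (measurableTypeR R)).

Lemma exprn_sub_le (a b : R) n : 0 <= b -> b <= a -> a <= 1 ->
  a ^+ n - b ^+ n <= n%:R * (a - b).
Proof.
move=> b0 ba a1; elim: n => [|n IH]; first by rewrite !expr0 subrr mul0r.
have an : a ^+ n <= 1 by rewrite exprn_ile1// (le_trans b0).
have -> : a ^+ n.+1 - b ^+ n.+1 = a ^+ n * (a - b) + b * (a ^+ n - b ^+ n).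
  by rewrite !exprS; ring.
rewrite -natr1 mulrDl mul1r addrC; apply: lerD.
  apply: le_trans IH; rewrite ler_piMl// ?(le_trans ba)//.
  by rewrite subr_ge0 lerXn2r// nnegrE// (le_trans b0).
by rewrite ler_piMl// subr_ge0.
Qed.

(* The cut-off [1 - r e^v / n] to the power [n] inside Euler's integral. *)
Definition ecut (n : nat) (r v : R) : R :=
  if r * expR v <= n%:R then (1 - r / n%:R * expR v) ^+ n else 0.

Lemma ecut_n_gt0 n (r v : R) : 0 < r -> r * expR v <= n%:R -> 0 < n%:R :> R.
Proof. by move=> r0; apply: lt_le_trans; rewrite mulr_gt0 ?expR_gt0. Qed.

Lemma ecut_arg n (r v : R) : 0 < r -> r * expR v <= n%:R ->
  0 <= 1 - r / n%:R * expR v <= 1.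
Proof.
move=> r0 h; have n0 := ecut_n_gt0 r0 h.
rewrite subr_ge0 mulrAC ler_pdivrMr// mul1r h /= gerBl.
by rewrite divr_ge0 ?mulr_ge0 ?expR_ge0// ltW.
Qed.

Lemma ecut_exp n (r v : R) : 0 < n%:R :> R -> edecay r v = expR (- (r / n%:R * expR v)) ^+ n.
Proof.
by move=> n0; rewrite -expRM_natl; congr expR; field; rewrite gt_eqF.
Qed.

Lemma ecut_bound n (r v : R) : 0 < r -> 0 <= ecut n r v <= edecay r v.
Proof.
move=> r0; rewrite /ecut; case: ifP => h; last by rewrite lexx edecay_ge0.
have /andP[h0 h1] := ecut_arg r0 h; rewrite exprn_ge0//=.
rewrite (ecut_exp r v (ecut_n_gt0 r0 h)) lerXn2r ?nnegrE ?expR_ge0//.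
by have := expR_ge1Dx (- (r / n%:R * expR v)).
Qed.

Lemma ecut_cvg (r v e : R) : 0 < r -> 0 < e ->
  \forall n \near \oo, `|edecay r v - ecut n r v| < e.
Proof.
move=> r0 e0; pose x := r * expR v.
have x0 : 0 < x by rewrite mulr_gt0 ?expR_gt0.
near=> n.
have h : r * expR v <= n%:R by near: n; exact: nbhs_infty_ger.
have n0 := ecut_n_gt0 r0 h; have /andP[h0 h1] := ecut_arg r0 h.
have /andP[_ b] := ecut_bound n v r0.
rewrite ger0_norm ?subr_ge0// /ecut h (ecut_exp _ _ n0).
have uE : r / n%:R * expR v = x / n%:R by rewrite mulrAC.
rewrite uE; rewrite uE in h0 h1; set u := x / n%:R in h0 h1 *.
have u0 : 0 < u by rewrite divr_gt0.
apply: le_lt_trans (exprn_sub_le _ h0 _ _) _.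
- by have := expR_ge1Dx (- u).
- by rewrite -[leRHS]expR0 ler_expR oppr_le0 ltW.
have u1 : u <= 1 by rewrite -subr_ge0.
(* Together with [exprn_sub_le] this makes the error at most n u^2 = x^2 / n. *)
have eu : expR (- u) <= 1 - u + u ^+ 2.
  have e2 := expR_ge1Dx u; have e3 : expR (- u) * (1 + u) <= 1.
    by rewrite expRN mulrC ler_pdivrMr ?expR_gt0// mul1r.
  have u2 : 0 < u ^+ 2 by rewrite exprn_gt0.
  rewrite -(@ler_pM2r _ (1 + u)) ?addr_gt0//; apply: (le_trans e3).
  have -> : (1 - u + u ^+ 2) * (1 + u) = 1 + u * u ^+ 2 by ring.
  by rewrite lerDl mulr_ge0// ltW.
apply: (@le_lt_trans _ _ (n%:R * u ^+ 2)).
  by rewrite ler_wpM2l//; move: eu; lra.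
have -> : n%:R * u ^+ 2 = x ^+ 2 / n%:R by rewrite /u; field; rewrite gt_eqF.
rewrite ltr_pdivrMr// mulrC -ltr_pdivrMr//.
by near: n; exact: nbhs_infty_gtr.
Unshelve. all: by end_near. Qed.

Lemma measurable_Mexp (c : R) :
  measurable_fun (setT : set (measurableTypeR R)) (fun v : measurableTypeR R => c * expR v).
Proof.
apply: continuous_measurable_fun; move: c => c v.
by apply: continuousM; [exact: cst_continuous|exact: continuous_expR].
Qed.

Lemma measurable_ecut n r : 0 < r ->
  measurable_fun (setT : set (measurableTypeR R)) (ecut n r : measurableTypeR R -> R).
Proof.
move=> r0; apply: measurable_fun_ifT => //.
  apply: measurable_fun_ler; last exact: measurable_cst.
  exact: measurable_Mexp.
apply: measurable_funX; apply: measurable_funB; first exact: measurable_cst.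
exact: measurable_Mexp.
Qed.

Definition ecker n (r : R) (a : C) (v : R) : C :=
  cexp (a * v%:C) * (ecut n r v)%:C + cexp (- a * v%:C) * (ecut n r (- v))%:C.

Lemma cmeasurable_ecker n r a : 0 < r -> cmeasurable (ecker n r a).
Proof.
move=> r0; apply: cmeasurableD; apply: cmeasurableM; try exact: cmeasurable_cexp.
  by split; [exact: measurable_ecut|exact: measurable_cst].
split; last exact: measurable_cst.
apply: (measurableT_comp (measurable_ecut n r0)).
by apply: continuous_measurable_fun => v; exact: opp_continuous.
Qed.

Lemma cint_cut (L : R) (f : R -> C) : 0 <= L ->
  cint `[0, L] f = cint D0 (fun v => if v <= L then f v else 0).
Proof.
move=> L0; have restr (u : R -> R) : \int[mu]_(t in `[0, L]) u t =
    \int[mu]_(t in D0) (if t <= L then u t else 0).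
  have -> : `[0, L]%classic = D0 `&` [set t : R | t <= L].
    apply/seteqP; split=> t /=; rewrite !in_itv /=; first by move=> /andP[-> ->].
    by rewrite andbT => -[-> ->].
  rewrite Rintegral_mkcondr; apply: eq_Rintegral => t _; rewrite /patch.
  by case: ifPn => [|]; rewrite ?inE ?notin_setE /=; [move=> ->|move/negP/negbTE ->].
by apply: eqC => /=; rewrite restr; apply: eq_Rintegral => t _; case: ifP.
Qed.

Lemma ecker_bound r a : 0 < r -> 0 < complex.Re a -> exists K : R,
  forall n v, 0 <= v -> normc (ecker n r a v) <= K * expR (- (complex.Re a * v)).
Proof.
move=> r0 a0; have [K K0 hK] := edecay_rapid (2 * complex.Re a) r0.
exists (K + 1) => n v v0; apply: (le_trans (normcD _ _)).
have /andP[p0 p1] := ecut_bound n v r0; have /andP[q0 q1] := ecut_bound n (- v) r0.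
rewrite (normc_cexpMr a) (normc_cexpMr (- a)) (ger0_norm p0) (ger0_norm q0).
rewrite mulrDl mul1r ReN mulNr.
apply: lerD; last by rewrite ler_piMr ?expR_ge0// (le_trans q1)// edecay_le1.
apply: (le_trans (ler_wpM2l (expR_ge0 _) (le_trans p1 (hK v v0)))).
rewrite mulrCA ler_wpM2l// -expRD ler_expR le_eqVlt; apply/orP; left; apply/eqP; ring.
Qed.

(** Moving the cut-off into the integrand puts all [n] on one half-line, as domination requires: v
    <= - ln (r / n) is the condition r e^v <= n. On the second piece the cut-off is inactive because
    r <= n. *)
Lemma eint_ecker n r a : 0 < r -> 0 < complex.Re a -> r <= n%:R -> (0 < n)%N ->
  eint (r / n%:R) a n = cint D0 (ecker n r a).
Proof.
move=> r0 a0 rn n0; have n0' : 0 < n%:R :> R by rewrite ltr0n.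
have c0 : 0 < r / n%:R by rewrite divr_gt0.
have c1 : r / n%:R <= 1 by rewrite ler_pdivrMr// mul1r.
have c01 : 0 < r / n%:R <= 1 by rewrite c0.
have [K hK] := ecker_bound r0 a0; have mD := @measurableD0 R.
have i0 : cintegrable D0 (ecker n r a).
  exact: (cintegrable_D0 a0 (cmeasurable_ecker n a r0) (hK n)).
have i2 : cintegrable D0 (fun v => cexp (- a * v%:C) * (ecut n r (- v))%:C).
  apply: (@cintegrable_D0 _ _ 1 _ a0).
    apply: cmeasurableM; first exact: cmeasurable_cexp.
    split; last exact: measurable_cst.
    apply: (measurableT_comp (measurable_ecut n r0)).
    by apply: continuous_measurable_fun => v; exact: opp_continuous.
  move=> v v0; rewrite (normc_cexpMr (- a)) mul1r ReN mulNr.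
  have /andP[q0 q1] := ecut_bound n (- v) r0.
  by rewrite (ger0_norm q0) ler_piMr ?expR_ge0// (le_trans q1)// edecay_le1.
rewrite /eint cint_cut ?oppr_ge0 ?ln_le0//.
have -> : cint D0 (fun v => cexp (- a * v%:C) * ((1 - r / n%:R * expR (-1 * v)) ^+ n)%:C) =
    cint D0 (fun v => cexp (- a * v%:C) * (ecut n r (- v))%:C).
  apply: eq_cint => v; rewrite /= in_itv /= andbT => v0; rewrite /ecut ifT ?mulN1r//.
  apply: le_trans rn; rewrite ler_piMr ?(ltW r0)// -[leRHS]expR0 ler_expR.
  by rewrite oppr_le0.
have -> : cint D0 (fun v => if v <= - ln (r / n%:R) then
      cexp (a * v%:C) * ((1 - r / n%:R * expR (1 * v)) ^+ n)%:C else 0) =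
    cint D0 (fun v => ecker n r a v - cexp (- a * v%:C) * (ecut n r (- v))%:C).
  apply: eq_cint => v _; rewrite /ecker addrK /ecut mul1r.
  have -> : (v <= - ln (r / n%:R)) = (r * expR v <= n%:R).
    rewrite lerNr -[in RHS](mul1r n%:R) -ler_pdivrMr// mulrAC.
    by rewrite -{2}(lnK c0) -?posrE// -expRD -[X in _ = (_ <= X)]expR0 ler_expR -lerBrDr sub0r.
  by case: ifP => //; rewrite mulr0.
by rewrite cintB// subrK.
Qed.

Lemma ecker_cvg r a v (e : R) : 0 < r -> 0 < e ->
  \forall n \near \oo, normc (gker r a v - ecker n r a v) < e.
Proof.
move=> r0 e0; pose E1 := expR (complex.Re a * v); pose E2 := expR (complex.Re (- a) * v).
have E0 : 0 < E1 + E2 by rewrite addr_gt0 ?expR_gt0.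
have e1 : 0 < e / (E1 + E2) by rewrite divr_gt0.
near=> n.
have -> : gker r a v - ecker n r a v = cexp (a * v%:C) * (edecay r v - ecut n r v)%:C +
    cexp (- a * v%:C) * (edecay r (- v) - ecut n r (- v))%:C.
  by rewrite /gker /ecker !rmorphB /=; ring.
apply: (le_lt_trans (normcD _ _)).
rewrite (normc_cexpMr a) (normc_cexpMr (- a)) -/E1 -/E2.
rewrite -[e](@divfK _ (E1 + E2)) ?gt_eqF// [X in _ < X]mulrC mulrDl ltrD//.
  by rewrite ltr_pM2l ?expR_gt0//; near: n; exact: ecut_cvg.
by rewrite ltr_pM2l ?expR_gt0//; near: n; exact: ecut_cvg.
Unshelve. all: by end_near. Qed.

Lemma eint_cvg r a (e : R) : 0 < r -> 0 < complex.Re a -> 0 < e ->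
  \forall n \near \oo, normc (gint r a - eint (r / n%:R) a n) < e.
Proof.
move=> r0 a0 e0; have [K hK] := ecker_bound r0 a0; have mD := @measurableD0 R.
have [_ lim] := @cint_dominated R D0 (fun n => ecker n r a) (gker r a)
  (fun v => K * expR (- (complex.Re a * v))) mD
  (fun n => measurable_funS measurableT (@subsetT _ _) (proj1 (cmeasurable_ecker n a r0)))
  (fun n => measurable_funS measurableT (@subsetT _ _) (proj2 (cmeasurable_ecker n a r0)))
  (fun v _ d d0 => ecker_cvg a v r0 d0)
  (integrable_KexpRN K a0)
  ltac:(move=> n v /=; rewrite in_itv /= andbT; exact: hK).
have := lim e e0 => H; near=> n.
rewrite (@eint_ecker n)//; first by near: n.
  by near: n; exact: nbhs_infty_ger.
by near: n; exact: nbhs_infty_gt.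
Unshelve. all: by end_near. Qed.

End Gamma.

(** * The reciprocal gamma function *)

Section ReciprocalGamma.
Variable R : realType.
Local Notation C := R[i].
Local Notation C' := (R[i]^o).
Local Notation D0 := (`[0%R, +oo[%classic : set (measurableTypeR R)).

Definition gauss_quot (s : C) (n : nat) : C :=
  (\prod_(k < n.+1) (s + k%:R)) / (n`!%:R * cpow n%:R s).

Lemma Re_nat n : complex.Re (n%:R : C) = n%:R.
Proof. by rewrite -(rmorph_nat (real_complex R)). Qed.

Lemma natC_neq0 n : (0 < n)%N -> (n%:R : C) != 0.
Proof. by rewrite pnatr_eq0 lt0n. Qed.

Lemma cpow_div (a b : R) (s : C) : 0 < a -> 0 < b ->
  cexp (s * (- ln (b / a))%:C) = cpow a s * cpow b (- s).
Proof.
move=> a0 b0; rewrite /cpow -cexpD; congr cexp.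
by rewrite ln_div ?posrE// opprB rmorphB /=; ring.
Qed.

Lemma gauss_quotM r (a : C) n : 0 < r -> 0 < complex.Re a -> r <= n%:R -> (0 < n)%N ->
  gauss_quot a n * eint (r / n%:R) a n = cpow r (- a).
Proof.
move=> r0 a0 rn n0; have n0' : 0 < n%:R :> R by rewrite ltr0n.
have c01 : 0 < r / n%:R <= 1 by rewrite divr_gt0//= ler_pdivrMr// mul1r.
rewrite /gauss_quot mulrAC eint_prod// cpow_div// mulrA mulrAC divff ?mul1r//.
by rewrite mulf_neq0 ?cpow_neq0// natC_neq0// fact_gt0.
Qed.

(** From |1 + z|^2 = 1 + 2 Re z + |z|^2 <= exp (2 Re z + |z|^2) at z = a / n. The first-order term
    involves Re a only, so the product of these factors can be compared with the power of [n] in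
    [gauss_quot]. *)
Lemma normc_add_nat_le (a : C) n : (0 < n)%N ->
  normc (a + n%:R) <= n%:R * expR (complex.Re a / n%:R + normc a ^+ 2 / (2 * n%:R ^+ 2)).
Proof.
move=> n0; have n0' : 0 < n%:R :> R by rewrite ltr0n.
have e0 := expR_gt0 (complex.Re a / n%:R + normc a ^+ 2 / (2 * n%:R ^+ 2)).
rewrite -(@ler_pXn2r _ 2) ?nnegrE ?normc_ge0 ?mulr_ge0 ?(ltW n0') ?(ltW e0)//.
have -> : normc (a + n%:R) ^+ 2 =
    n%:R ^+ 2 * (1 + (2 * (complex.Re a / n%:R) + normc a ^+ 2 / n%:R ^+ 2)).
  have sq (z : C) : normc z ^+ 2 = complex.Re z ^+ 2 + complex.Im z ^+ 2.
    by case: z => u v /=; rewrite sqr_sqrtr// addr_ge0 ?sqr_ge0.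
  rewrite !sq ReD ImD Re_nat.
  have -> : complex.Im (n%:R : C) = 0 by rewrite -(rmorph_nat (real_complex R)).
  by field; rewrite gt_eqF.
rewrite exprMn ler_wpM2l ?sqr_ge0// -expRM_natl.
apply: (le_trans (expR_ge1Dx _)); rewrite ler_expR le_eqVlt; apply/orP; left; apply/eqP.
by field; rewrite gt_eqF.
Qed.

Lemma ln_natS_ge n : (0 < n)%N -> ln n%:R + n.+1%:R^-1 <= ln n.+1%:R :> R.
Proof.
move=> n0; have n0' : 0 < n%:R :> R by rewrite ltr0n.
have n1' : 0 < n.+1%:R :> R by rewrite ltr0n.
rewrite -lerBrDl -ln_div ?posrE//.
have -> : (n.+1%:R / n%:R : R) = (n%:R / n.+1%:R)^-1 by rewrite invf_div.
rewrite lnV ?posrE ?divr_gt0//.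
have := @le_ln1Dx R (- n.+1%:R^-1).
have -> : 1 + - n.+1%:R^-1 = n%:R / n.+1%:R :> R.
  by rewrite -[n.+1%:R]natr1; field; rewrite natr1 gt_eqF.
rewrite ltrN2 => /(_ _); rewrite lerNr; apply.
by rewrite invf_lt1// ltr1n.
Qed.

(* A bounded factor in [gauss_quot a n * eint n^-1 a n = 1] keeps the limit
   [gint 1 a] of the other one away from [0]. *)
Lemma gauss_quot_bound (a : C) : 0 <= complex.Re a ->
  exists B : R, forall n, (0 < n)%N -> normc (gauss_quot a n) <= B.
Proof.
move=> a0; pose A := normc a; pose s := complex.Re a.
(* The two summands majorise the accumulated exponents: 1 + ln n bounds the harmonic sum, and 2 - 1
   / n bounds the sum of 1 / (2 k^2), since 1 / (2 N^2) <= 1 / (N - 1) - 1 / N. *)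
pose E n := s * (1 + ln n%:R) + A ^+ 2 * (2 - n%:R^-1).
have h n : normc (\prod_(k < n.+2) (a + k%:R)) <= A * n.+1`!%:R * expR (E n.+1).
  elim: n => [|n IH].
    rewrite big_ord_recr big_ord1 /= addr0 normcM (_ : 1`! = 1%N)// mulr1 ler_wpM2l ?normc_ge0//.
    apply: (le_trans (normc_add_nat_le a (ltn0Sn 0))); rewrite !mul1r ler_expR /E ln1.
    have := sqr_ge0 A; rewrite -/s -/A invr1; lra.
  rewrite big_ord_recr /= normcM.
  apply: (le_trans (ler_pM (normc_ge0 _) (normc_ge0 _) IH (normc_add_nat_le a (ltn0Sn _)))).
  rewrite -/s -/A (factS n.+1) natrM.
  set N := n.+2%:R : R; set F := n.+1`!%:R.
  have N0 : 0 < N by rewrite ltr0n.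
  have -> : A * F * expR (E n.+1) * (N * expR (s / N + A ^+ 2 / (2 * N ^+ 2))) =
     A * (N * F) * expR (E n.+1 + (s / N + A ^+ 2 / (2 * N ^+ 2))) by rewrite [expR (E n.+1 + _)]expRD; ring.
  rewrite ler_wpM2l ?mulr_ge0 ?normc_ge0 ?ler0n// ler_expR /E -/N.
  have l := ler_wpM2l a0 (ln_natS_ge (ltn0Sn n)); rewrite -/s -/N in l.
  have q : 1 / (2 * N ^+ 2) <= n.+1%:R^-1 - N^-1.
    have M0 : 0 < n.+1%:R :> R by rewrite ltr0n.
    have NE : N = n.+1%:R + 1 by rewrite natr1.
    have -> : n.+1%:R^-1 - N^-1 = 1 / (n.+1%:R * N).
      rewrite NE; move: (n.+1%:R : R) M0 => M M0.
      by field; rewrite !gt_eqF// addr_gt0.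
    rewrite !div1r lef_pV2 ?posrE ?mulr_gt0 ?exprn_gt0// expr2 mulrA ler_pM2r//.
    by rewrite NE; lra.
  have := ler_wpM2l (sqr_ge0 A) q; rewrite mulrBr mul1r => q'.
  move: l q'; move: (A ^+ 2) (ln n.+1%:R) (ln N) (n.+1%:R^-1 : R) (N^-1) ((2 * N ^+ 2)^-1).
  by clear => A2 lM lN iM iN i2 l q'; lra.
exists (A * expR (s + A ^+ 2 * 2)) => -[//|n] _.
rewrite /gauss_quot normcM normcV normcM normc_cpow -(rmorph_nat (real_complex R)) normc_real.
rewrite ger0_norm ?ler0n// -/s.
have f0 : 0 < n.+1`!%:R * expR (s * ln n.+1%:R) :> R.
  by rewrite mulr_gt0 ?expR_gt0// ltr0n fact_gt0.
rewrite ler_pdivrMr//; apply: (le_trans (h n)).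
set F := n.+1`!%:R; set X := expR _.
have -> : A * expR (s + A ^+ 2 * 2) * (F * expR (s * ln n.+1%:R)) =
  A * F * expR (s + A ^+ 2 * 2 + s * ln n.+1%:R) by rewrite [expR (_ + _ + _)]expRD; ring.
rewrite ler_wpM2l ?mulr_ge0 ?normc_ge0 ?ler0n// ler_expR /E.
have : 0 <= A ^+ 2 * n.+1%:R^-1 by rewrite mulr_ge0 ?sqr_ge0// invr_ge0.
move: (A ^+ 2) (ln n.+1%:R) (n.+1%:R^-1 : R) => A2 lM iM.
by clear; lra.
Qed.

Lemma eint1_gauss (a : C) n : 0 < complex.Re a -> (0 < n)%N ->
  gauss_quot a n * eint (n%:R^-1) a n = 1.
Proof.
move=> a0 n0; have := @gauss_quotM 1 a n ltr01 a0.
by rewrite ler1n n0 div1r /cpow ln1 mulr0 cexp0; apply.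
Qed.

Lemma gint1_neq0 (a : C) : 0 < complex.Re a -> gint 1 a != 0.
Proof.
move=> a0; apply/eqP => g0; have [B hB] := gauss_quot_bound (ltW a0).
have B1 : 0 < (`|B| + 1)^-1 by rewrite invr_gt0 ltr_wpDl.
have /(_ _ B1) := @eint_cvg R 1 a _ ltr01 a0 => -[N _ hN].
have := hN N.+1 (leqnSn N); rewrite g0 sub0r normcNE div1r => h.
have := eint1_gauss a0 (ltn0Sn N) => /(congr1 (@normc R)).
rewrite normcM (_ : normc 1 = 1 :> R); last by rewrite -(rmorph1 (real_complex R)) normc_real normr1.
apply/eqP; rewrite lt_eqF//.
apply: (@le_lt_trans _ _ ((`|B| + 1) * normc (eint N.+1%:R^-1 a N.+1))).
  rewrite ler_wpM2r ?normc_ge0//; apply: (le_trans (hB _ (ltn0Sn N))).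
  by rewrite ler_wpDr// ler_norm.
by rewrite -ltr_pdivlMl ?mulr1// -invr_gt0.
Qed.

Lemma ccvgM (f g : nat -> C) (k l : C) :
  (f n : C') @[n --> \oo] --> (k : C') -> (g n : C') @[n --> \oo] --> (l : C') ->
  ((f n * g n : C) : C') @[n --> \oo] --> ((k * l : C) : C').
Proof. by move=> fk gl; exact (@cvgM C' nat \oo _ f g k l fk gl). Qed.

Lemma gauss_quot_cvg (a : C) : 0 < complex.Re a ->
  (gauss_quot a n : C') @[n --> \oo] --> ((gint 1 a)^-1 : C').
Proof.
move=> a0; have c1 : (eint (1 / n%:R) a n : C') @[n --> \oo] --> (gint 1 a : C').
  by apply/cvgcP => e e0; exact: eint_cvg.
have c2 : ((eint (1 / n%:R) a n : C')^-1 : C') @[n --> \oo] --> ((gint 1 a)^-1 : C').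
  exact (@cvgV _ _ _ _ _ _ (gint1_neq0 a0) c1).
apply: cvg_trans c2; apply: near_eq_cvg; near=> n.
have n0 : (0 < n)%N by near: n; exact: nbhs_infty_gt.
have E := eint1_gauss a0 n0; rewrite div1r.
have z : eint n%:R^-1 a n != 0.
  by apply/eqP => z; move: E; rewrite z mulr0 => /esym/eqP; rewrite oner_eq0.
by apply: (mulIf z); rewrite E mulVf.
Unshelve. all: by end_near. Qed.

Lemma rGammaE (a : C) : rGamma a = lim ((gauss_quot a n : C') @[n --> \oo]).
Proof. by []. Qed.

Lemma C_hausdorff : hausdorff_space C'.
Proof. exact: norm_hausdorff. Qed.

Lemma rGamma_gint (a : C) : 0 < complex.Re a -> rGamma a = (gint 1 a)^-1.
Proof. by move=> a0; apply: (cvg_lim C_hausdorff); exact: gauss_quot_cvg. Qed.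

Lemma rGamma_neq0 (a : C) : 0 < complex.Re a -> rGamma a != 0.
Proof. by move=> a0; rewrite rGamma_gint// invr_neq0// gint1_neq0. Qed.

(** For n >= r the product of Gauss's quotient and Euler's integral with c = r / n is exactly
    r^(-a), by [gauss_quotM], and this identity passes to the limit. *)
Lemma gint_cpow r (a : C) : 0 < r -> 0 < complex.Re a ->
  rGamma a * gint r a = cpow r (- a).
Proof.
move=> r0 a0; have c1 : (eint (r / n%:R) a n : C') @[n --> \oo] --> (gint r a : C').
  by apply/cvgcP => e e0; exact: eint_cvg.
have c2 : (gauss_quot a n * eint (r / n%:R) a n : C') @[n --> \oo] -->
    (rGamma a * gint r a : C').
  rewrite (rGamma_gint a0); exact (ccvgM (gauss_quot_cvg a0) c1).
have c3 : (gauss_quot a n * eint (r / n%:R) a n : C') @[n --> \oo] --> (cpow r (- a) : C').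
  apply: cvg_near_cst; near=> n; apply: gauss_quotM => //; near: n.
    exact: nbhs_infty_ger.
  exact: nbhs_infty_gt.
exact: (cvg_unique C_hausdorff c2 c3).
Unshelve. all: by end_near. Qed.

Lemma gauss_quot_rec (s : C) n : (0 < n)%N -> s + n.+1%:R != 0 ->
  gauss_quot s n = s * gauss_quot (s + 1) n * (n%:R / (s + n.+1%:R)).
Proof.
move=> n0 sn; rewrite /gauss_quot cpowD.
have n0' : 0 < n%:R :> R by rewrite ltr0n.
have -> : cpow n%:R 1 = n%:R :> C.
  by rewrite /cpow mul1r cexp_real lnK ?posrE// rmorph_nat.
have E : s * (\prod_(k < n.+1) (s + 1 + k%:R)) = (\prod_(k < n.+1) (s + k%:R)) * (s + n.+1%:R).
  transitivity (\prod_(k < n.+2) (s + k%:R)); last by rewrite big_ord_recr.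
  rewrite [RHS]big_ord_recl /= addr0; congr (_ * _).
  by apply: eq_bigr => k _; rewrite /bump /= add1n -natr1; ring.
rewrite [s * _]mulrA E.
have := natC_neq0 (fact_gt0 n); have := cpow_neq0 n%:R s; have := natC_neq0 n0; move: sn.
move: (\prod_(k < n.+1) _) (s + n.+1%:R) (n`!%:R : C) (cpow n%:R s) (n%:R : C) => P S F c N.
by move=> S0 N0 c0 F0; field; rewrite S0 N0 c0 F0.
Qed.

Lemma ratio_cvg1 (s : C) : (n%:R / (s + n.+1%:R) : C') @[n --> \oo] --> (1 : C').
Proof.
apply/cvgcP => e e0; near=> n.
have h1 : normc (s + 1) / e + normc (s + 1) + 1 <= n%:R by near: n; exact: nbhs_infty_ger.
have n1 : n%:R - normc (s + 1) <= normc (s + n.+1%:R).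
  have -> : s + n.+1%:R = n%:R - - (s + 1) by rewrite -natr1; ring.
  have := normcD (n%:R - - (s + 1)) (- (s + 1)); rewrite subrK normcNE.
  rewrite -{1}(rmorph_nat (real_complex R)) normc_real ger0_norm//; lra.
have q0 : 0 <= normc (s + 1) / e by rewrite divr_ge0 ?normc_ge0// ltW.
have p0 : 0 < normc (s + n.+1%:R) by move: h1 n1 q0; lra.
have z0 : s + n.+1%:R != 0 by rewrite -normc_eq0 gt_eqF.
have -> : 1 - n%:R / (s + n.+1%:R) = (s + 1) / (s + n.+1%:R).
  by move: z0; rewrite -natr1; move: (n%:R : C) => z z0; field; move: z0; rewrite addrA addrAC -addrA; congr (_ != _); ring.
rewrite normcM normcV ltr_pdivrMr// mulrC -ltr_pdivrMr//.
by move: h1 n1; lra.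
Unshelve. all: by end_near. Qed.

Lemma gauss_quot_cvg_rec (s l : C) :
  (gauss_quot (s + 1) n : C') @[n --> \oo] --> (l : C') ->
  (gauss_quot s n : C') @[n --> \oo] --> (s * l : C').
Proof.
move=> h.
have h1 : (s * gauss_quot (s + 1) n : C') @[n --> \oo] --> (s * l : C').
  exact (ccvgM (@cvg_cst C' s nat \oo _) h).
have h2 : (s * gauss_quot (s + 1) n * (n%:R / (s + n.+1%:R)) : C') @[n --> \oo] --> (s * l * 1 : C').
  exact (ccvgM h1 (@ratio_cvg1 s)).
rewrite mulr1 in h2; apply: cvg_trans h2; apply: near_eq_cvg; near=> n.
rewrite -gauss_quot_rec//; first by near: n; exact: nbhs_infty_gt.
rewrite -normc_eq0; have n1 : normc s + 1 <= n%:R by near: n; exact: nbhs_infty_ger.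
have := normcD (s + n.+1%:R) (- s); rewrite addrAC subrr add0r normcNE.
rewrite -{1}(rmorph_nat (real_complex R)) normc_real ger0_norm// -natr1 => h3.
by rewrite gt_eqF//; move: n1 h3; lra.
Unshelve. all: by end_near. Qed.

(** Convergence on the right half-plane is carried one unit to the left at a time by
    [gauss_quot_cvg_rec]; the induction is on m for the half-plane Re z > - m. *)
Lemma gauss_quot_cvg_ex (s : C) :
  (gauss_quot s n : C') @[n --> \oo] --> (rGamma s : C').
Proof.
suff [l hl] : exists l : C', (gauss_quot s n : C') @[n --> \oo] --> l.
  by rewrite rGammaE (cvg_lim C_hausdorff hl).
have main : forall m (z : C), - m%:R < complex.Re z ->
    exists l : C', (gauss_quot z n : C') @[n --> \oo] --> l.
  elim=> [|m IH] z; first by rewrite oppr0 => z0; eexists; exact: gauss_quot_cvg.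
  move=> zm; have [|l hl] := IH (z + 1).
    by rewrite ReD /=; move: zm; rewrite -natr1; lra.
  by eexists; exact: gauss_quot_cvg_rec hl.
apply: (main (Num.bound `|complex.Re s|)).
by rewrite ltrNl; apply: le_lt_trans (archi_boundP (normr_ge0 _)); rewrite -normrN ler_norm.
Qed.

Lemma rGamma_rec (s : C) : rGamma s = s * rGamma (s + 1).
Proof.
rewrite [LHS]rGammaE; apply: (cvg_lim C_hausdorff).
exact (gauss_quot_cvg_rec (@gauss_quot_cvg_ex (s + 1))).
Qed.

Lemma gint_laplace r (a : C) : 0 < r -> 0 < complex.Re a ->
  gint r a = laplace (fun v => (edecay r v)%:C) a + laplace (fun v => (edecay r (- v))%:C) (- a).
Proof.
move=> r0 a0; have [K K0 hK] := @edecay_rapid R r (complex.Re a + 1) r0.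
have i1 : cintegrable D0 (fun v => cexp (a * v%:C) * (edecay r v)%:C).
  apply: (@cintegrable_laplace _ _ K (complex.Re a + 1)).
  + by apply: cmeasurable_real; exact: continuous_edecay.
  + by move=> v v0; rewrite normc_real ger0_norm ?edecay_ge0// hK.
  + by rewrite ltrDl.
have i2 : cintegrable D0 (fun v => cexp (- a * v%:C) * (edecay r (- v))%:C).
  apply: (@cintegrable_laplace _ _ 1 0).
  + by apply: cmeasurable_real; exact: continuous_edecayN.
  + move=> v v0; rewrite normc_real ger0_norm ?edecay_ge0// mul0r oppr0 expR0 mulr1.
    by rewrite edecay_le1.
  + by rewrite ReN oppr_lt0.
by rewrite /laplace -(cintD (@measurableD0 R) i1 i2).
Qed.

Lemma derivableN_c (f : C' -> C') (s : C') : derivable f s 1 ->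
  derivable ((fun w => - f w) : C' -> C') s 1.
Proof. exact (@derivableN _ _ _ f s 1). Qed.

Lemma derivable_gint1 (a : C') : 0 < complex.Re a -> derivable (gint 1 : C' -> C') a 1.
Proof.
move=> a0; have [K K0 hK] := @edecay_rapid R 1 (complex.Re a + 1) ltr01.
pose w1 v := (edecay (1 : R) v)%:C; pose w2 v := (edecay (1 : R) (- v))%:C.
have d1 : derivable (laplace w1 : C' -> C') a 1.
  apply: (@derivable_laplace _ _ K (complex.Re a + 1)).
  + by apply: cmeasurable_real; exact: continuous_edecay.
  + by move=> v v0; rewrite normc_real ger0_norm ?edecay_ge0// hK.
  + by rewrite ltrDl.
have d2 : derivable (laplace w2 : C' -> C') (- a) 1.
  apply: (@derivable_laplace _ _ 1 0).
  + by apply: cmeasurable_real; exact: continuous_edecayN.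
  + move=> v v0; rewrite normc_real ger0_norm ?edecay_ge0// mul0r oppr0 expR0 mulr1.
    by rewrite edecay_le1.
  + by rewrite ReN oppr_lt0.
have dN : derivable (fun s : C' => - s : C') a 1.
  exact (@derivableN_c _ _ (@derivable_id_c _ a)).
have d3 := @derivable_comp_c _ _ _ _ dN d2.
have := @derivableD_c _ _ _ _ d1 d3.
apply: derivable_near; apply/nbhscP; exists (complex.Re a) => // w wa.
rewrite gint_laplace//.
have := le_lt_trans (normr_Re_le (w - a)) wa.
by rewrite ReD ReN ltr_norml => /andP[h _]; move: h; lra.
Qed.

(** On the right half-plane it is the reciprocal of the nonvanishing integral [gint 1]; the
    recurrence moves holomorphy to the left unit by unit. *)
Lemma derivable_rGamma (s : C') : derivable (@rGamma R : C' -> C') s 1.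
Proof.
have main : forall m (z : C'), - m%:R < complex.Re z -> derivable (@rGamma R : C' -> C') z 1.
  elim=> [|m IH] z.
    rewrite oppr0 => z0.
    have := @derivable_inv_c _ _ _ (gint1_neq0 z0) (derivable_gint1 z0).
    apply: derivable_near; apply/nbhscP; exists (complex.Re z) => // w wz.
    rewrite rGamma_gint//.
    have := le_lt_trans (normr_Re_le (w - z)) wz.
    by rewrite ReD ReN ltr_norml => /andP[h _]; move: h; lra.
  move=> zm; have z1 : - m%:R < complex.Re (z + 1 : C').
    by rewrite ReD /=; move: zm; rewrite -natr1; lra.
  have d1 : derivable (fun s : C' => s + 1 : C') z 1.
    exact: (@derivableD_c _ _ _ _ (@derivable_id_c _ z) (@derivable_cst_c _ 1 z)).
  have d2 := @derivable_comp_c _ _ _ _ d1 (IH _ z1).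
  have := @derivableM_c _ _ _ _ (@derivable_id_c _ z) d2.
  by apply: derivable_near; apply/nbhscP; exists 1 => // w _; rewrite [RHS]rGamma_rec.
apply: (main (Num.bound `|complex.Re s|)).
by rewrite ltrNl; apply: le_lt_trans (archi_boundP (normr_ge0 _)); rewrite -normrN ler_norm.
Qed.

End ReciprocalGamma.

(** * Exchanging sums with integrals and with limits *)

Section Exchange.
Variable R : realType.
Local Notation C := R[i].
Local Notation mu := (@lebesgue_measure R).
Local Notation D0 := (`[0%R, +oo[%classic : set (measurableTypeR R)).

(** The majorant is a product of a summable family and an integrable exponential. A finite list
    therefore controls the tail of the series for all [v] at once, relative to that exponential, and
    integrating keeps the control. *)
Lemma has_csum_cint (I : choiceType) (F : I -> R -> C) (G : I -> R) (K k : R) :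
  0 <= K -> 0 < k -> nnsummable G -> (forall i, cmeasurable (F i)) ->
  cmeasurable (fun v => csum (F ^~ v)) ->
  (forall i v, 0 <= v -> normc (F i v) <= G i * (K * expR (- (k * v)))) ->
  has_csum (fun i => cint D0 (F i)) (cint D0 (fun v => csum (F ^~ v))).
Proof.
move=> K0 k0 sG mF mS FG; have mD := @measurableD0 R.
have [G0 [S hS]] := sG.
have S0 : 0 <= S by have := hS [::] isT; rewrite big_nil.
have h0 v : 0 <= K * expR (- (k * v)) by rewrite mulr_ge0 ?expR_ge0.
have sF v : 0 <= v -> csummable (F ^~ v).
  move=> v0; apply: (@csummable_le _ _ _ (fun i => (K * expR (- (k * v))) * G i)).
    by move=> i; rewrite mulrC FG.
  exact: nnsummableZ.
have iF i : cintegrable D0 (F i).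
  by apply: (@cintegrable_D0 _ _ (G i * K) k) => // v v0; rewrite -mulrA FG.
have iS : cintegrable D0 (fun v => csum (F ^~ v)).
  apply: (@cintegrable_D0 _ _ (S * K) k) => // v v0; apply: normc_csum_le; first exact: sF.
  move=> J uJ; apply: (le_trans (ler_sum _ (fun i _ => FG i v v0))).
  by rewrite -mulr_suml -mulrA ler_wpM2r// hS.
move=> e e0; pose M := 2 * \int[mu]_(v in D0) (K * expR (- (k * v))).
have M1 : 0 < `|M| + 1 by rewrite ltr_wpDl.
have e1 : 0 < e / (`|M| + 1) by rewrite divr_gt0.
have [J0 [uJ0 tail]] := nnsummable_tail sG e1.
exists J0 => J uJ sub; rewrite -(cint_sum J mD iF) -cintB//; last exact: cintegrable_sum.
apply: (@le_lt_trans _ _ (2 * \int[mu]_(v in D0) (e / (`|M| + 1) * (K * expR (- (k * v)))))).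
  apply: (normc_cint_le mD); first by apply: cintegrableB => //; exact: cintegrable_sum.
    by apply: RintegrableZl => //; exact: integrable_KexpRN.
  (* The slack [d] supplies the strict tail inequality of [normc_csum_sub_le] also when the
     exponential factor is 0, that is for [K = 0]. *)
  move=> v; rewrite /= in_itv /= andbT => v0; apply/ler_addgt0Pr => d d0.
  apply: (@normc_csum_sub_le _ _ _ (fun i => G i * (K * expR (- (k * v))))) => //.
  - exact: sF.
  - by move=> i; exact: FG.
  - move=> L uL LJ; rewrite -mulr_suml; apply: ltr_pwDr; first exact: d0.
    rewrite ler_wpM2r//; apply: ltW; apply: tail => // i /LJ; apply: contra; exact: sub.
rewrite RintegralZl//; last exact: integrable_KexpRN.
rewrite mulrCA -/M mulrAC ltr_pdivrMr// ltr_pM2l//.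
by apply: le_lt_trans (ler_norm _) _; rewrite ltrDl.
Qed.

Lemma rcontinuousD (f g : R -> C) t : rcontinuous_at f t -> rcontinuous_at g t ->
  rcontinuous_at (fun t => f t + g t) t.
Proof.
move=> hf hg; have := rcontinuous_lin 1 (-1) hf hg.
by under eq_fun do rewrite mul1r mulN1r opprK.
Qed.

Lemma rcontinuous_sum (I : Type) (J : seq I) (F : I -> R -> C) t :
  (forall i, rcontinuous_at (F i) t) -> rcontinuous_at (fun t => \sum_(i <- J) F i t) t.
Proof.
move=> cF; elim: J => [|i J IH].
  by under eq_fun do rewrite big_nil; move=> e e0; exists 1 => // u _; rewrite subrr normc0.
by under eq_fun do rewrite big_cons; exact: rcontinuousD.
Qed.

Lemma rcontinuous_csum (I : choiceType) (F : I -> R -> C) (G : I -> R) (t r : R) : 0 < r ->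
  nnsummable G -> (forall i, rcontinuous_at (F i) t) ->
  (forall i u, `|u - t| < r -> normc (F i u) <= G i) ->
  rcontinuous_at (fun v => csum (F ^~ v)) t.
Proof.
move=> r0 sG cF FG e e0; have e3 : 0 < e / 4 by rewrite divr_gt0.
have [J [uJ tail]] := nnsummable_tail sG e3.
have [d d0 hd] := rcontinuous_sum J cF e3.
exists (Num.min d r); first by rewrite lt_min d0.
move=> u; rewrite lt_min => /andP[ud ur].
have near_sum v : `|v - t| < r -> normc (csum (F ^~ v) - \sum_(i <- J) F i v) <= e / 4.
  move=> vr; apply: (@normc_csum_sub_le _ _ _ G) => //; last by move=> i; exact: FG.
  by apply: csummable_le sG => i; exact: FG.
have hu := near_sum u ur; have := near_sum t; rewrite subrr normr0 => /(_ r0) ht.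
have := hd u ud; move: hu ht; rewrite [X in _ -> X <= _ -> _]normc_distC.
set a := csum _; set b := csum _; set s := \sum_(i <- J) _; set s' := \sum_(i <- J) _.
move=> h1 h2 h3; have -> : a - b = (a - s) + (s - s') + (s' - b) by ring.
apply: (le_lt_trans (normcD _ _)).
apply: (@le_lt_trans _ _ (normc (a - s) + normc (s - s') + normc (s' - b))).
  by rewrite lerD2r normcD.
by move: h1 h2 h3 e0; lra.
Qed.

End Exchange.

(** * The punctured theta series *)

Section Punctured.
Variables (R : realType) (d : nat).
Local Notation C := R[i].
Implicit Types (A : 'M[R]_d) (x y w : 'cV[R]_d).

Definition lat_r A x (n : 'cV[int]_d) : R :=
  pi * dotp (lattice_pt A n - x) (lattice_pt A n - x).

(* The theta series at [t = e^v], with the vector [x] of the lattice left out. *)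
Definition pterm A x w (v : R) (n : 'cV[int]_d) : C :=
  if lattice_pt A n == x then 0
  else (edecay (lat_r A x n) v)%:C * cis (2 * pi * dotp w (lattice_pt A n)).

Definition psi A x w (v : R) : C := csum (pterm A x w v).

(** The term omitted from [psi]: at the lattice point [x] the Gaussian factor is 1, so this term
    does not depend on [v]. *)
Definition lat_cst A x w : C := if `[< lattice A x >] then cis (2 * pi * dotp w x) else 0.

Lemma dotp0l (x : 'cV[R]_d) : dotp 0 x = 0.
Proof. by rewrite /dotp big1// => i _; rewrite mxE mul0r. Qed.

Lemma dotp_ge0 (x : 'cV[R]_d) : 0 <= dotp x x.
Proof. by apply: sumr_ge0 => i _; rewrite -expr2 sqr_ge0. Qed.

Lemma lat_r_ge0 A x n : 0 <= lat_r A x n.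
Proof. by rewrite mulr_ge0 ?pi_ge0 ?dotp_ge0. Qed.

Lemma lat_r_gt0 A x n : lattice_pt A n != x -> 0 < lat_r A x n.
Proof. by move=> h; rewrite mulr_gt0 ?pi_gt0// dotp_gt0// subr_eq0. Qed.

Lemma lattice_pt_inj A : A \in unitmx -> injective (lattice_pt A).
Proof.
move=> Au m n /(congr1 (mulmx (invmx A))); rewrite !mulKmx// => /matrixP mn.
by apply/matrixP => i j; have := mn i j; rewrite !mxE => /intr_inj.
Qed.

Lemma theta_termE A x w v n : theta_term A x w (expR v) n =
  (edecay (lat_r A x n) v)%:C * cis (2 * pi * dotp w (lattice_pt A n)).
Proof.
rewrite /theta_term /edecay /lat_r; congr ((expR _)%:C * _).
by rewrite -mulrA [_ * expR v]mulrC.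
Qed.

Lemma csummable_theta A x w v : A \in unitmx -> csummable (theta_term A x w (expR v)).
Proof. by move=> Au; have [h _ _] := theta_lattice Au (expR_gt0 v). Qed.

Lemma nnsummable_edecay A x v : A \in unitmx ->
  nnsummable (fun n => edecay (lat_r A x n) v).
Proof.
move=> Au; have := csummable_theta x 0 v Au; rewrite /csummable.
under eq_fun do rewrite theta_termE dotp0l mulr0 cis0 mulr1 normc_real.
by under eq_fun do rewrite ger0_norm ?edecay_ge0//.
Qed.

Lemma normc_pterm_le A x w v n : normc (pterm A x w v n) <= edecay (lat_r A x n) v.
Proof.
rewrite /pterm; case: eqP => _; first by rewrite normc0 edecay_ge0.
by rewrite normcM normc_cis mulr1 normc_real ger0_norm ?edecay_ge0.
Qed.

Lemma csummable_pterm A x w v : A \in unitmx -> csummable (pterm A x w v).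
Proof.
by move=> Au; apply: csummable_le (nnsummable_edecay x v Au) => n; exact: normc_pterm_le.
Qed.

Lemma theta_psi A x w v : A \in unitmx ->
  csum (theta_term A x w (expR v)) = psi A x w v + lat_cst A x w.
Proof.
move=> Au; pose q n : C := if lattice_pt A n == x then cis (2 * pi * dotp w x) else 0.
have hq : has_csum q (lat_cst A x w).
  rewrite /lat_cst; case: asboolP => [[m _ mx]|nx].
    have -> : cis (2 * pi * dotp w x) = q m by rewrite /q /lattice_pt mx eqxx.
    apply: csum_single => n nm; rewrite /q ifN//; apply: contra nm => /eqP nx.
    by apply/eqP/(lattice_pt_inj Au); rewrite nx /lattice_pt mx.
  have -> : q = fun=> 0.
    apply/funext => n; rewrite /q ifN//; apply/eqP => h; apply: nx.
    by exists n => //; rewrite -h.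
  by move=> e e0; exists [::] => J _ _; rewrite big1// subrr normc0.
apply: csum_unique.
have := has_csumD (csummable_has_csum (csummable_pterm x w v Au)) hq.
congr has_csum; apply/funext => n; rewrite theta_termE /pterm /q.
case: eqP => [nx|_]; last by rewrite addr0.
by rewrite add0r /lat_r nx subrr /edecay dotp0l mulr0 mul0r oppr0 expR0 mul1r.
Qed.

Lemma reciprocal_unitmx A : A \in unitmx -> reciprocal A \in unitmx.
Proof. by move=> Au; rewrite /reciprocal unitmx_tr unitmx_inv. Qed.

Definition theta_cst A x y : C := ((covolume A)^-1)%:C * cis (- (2 * pi * dotp x y)).

(** The theta transformation at t = e^(-v), where t^(-d/2) is the exponential factor. The omitted
    terms of the two series reappear as constants; after integration they become the fractions in
    [xi]. *)
Lemma psi_dual A x y v : A \in unitmx ->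
  psi A x (- y) (- v) = theta_cst A x y * (expR (d%:R / 2 * v))%:C *
    (psi (reciprocal A) y x v + lat_cst (reciprocal A) y x) - lat_cst A x (- y).
Proof.
move=> Au; have Bu := reciprocal_unitmx Au.
have [_ _ h] := theta_lattice Au (expR_gt0 (- v)).
have := h x y; rewrite theta_psi// -expRN opprK theta_psi// => /(canRL (addrK _)) ->.
have E : (Num.sqrt (expR (- v) ^+ d))^-1 = expR (d%:R / 2 * v) :> R.
  have -> : expR (- v) ^+ d = expR (- (d%:R / 2 * v)) ^+ 2 :> R.
    by rewrite -!expRM_natl; congr expR; field.
  by rewrite sqrtr_sqr ger0_norm ?expR_ge0// -expRN opprK.
rewrite invfM E rmorphM /= /theta_cst; congr (_ * _ - _).
by move: (cis _) (_%:C) (_%:C) => c p q; ring.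
Qed.

(** Outside a finite list each term exp (- r) of the convergent theta series at t = 1 is below exp
    (-1), which means r > 1; on the list a minimum exists. *)
Lemma lat_gap A x : A \in unitmx ->
  exists2 g : R, 0 < g & forall n, lattice_pt A n != x -> g <= lat_r A x n.
Proof.
move=> Au; have sE := nnsummable_edecay x 0 Au.
have h0 : 0 < expR (- 1) :> R by exact: expR_gt0.
have [J [uJ tail]] := nnsummable_tail sE h0.
have [g g0 gJ] : exists2 g : R, 0 < g & forall n, n \in J -> lattice_pt A n != x -> g <= lat_r A x n.
  elim: J {uJ tail} => [|m J [g g0 IH]]; first by exists 1.
  exists (if lattice_pt A m == x then g else Num.min g (lat_r A x m)).
    by case: ifPn => // mx; rewrite lt_min g0 lat_r_gt0.
  move=> n; rewrite inE => /orP[/eqP -> mx|nJ nx].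
    by rewrite (negbTE mx) ge_min lexx orbT.
  by case: ifP => _; rewrite ?ge_min IH.
exists (Num.min g 1); first by rewrite lt_min g0 ltr01.
move=> n nx; have [nJ|nJ] := boolP (n \in J); first by rewrite ge_min gJ.
have := tail [:: n] isT ltac:(by move=> i; rewrite inE => /eqP ->).
rewrite big_seq1 /edecay expR0 mulr1 ltr_expR ltrN2 => h.
by rewrite ge_min (ltW h) orbT.
Qed.

(** For v >= 0 and r at least the gap g one has r e^v >= r + g (e^v - 1). Hence the bound separates
    into a factor summable over the lattice and a factor in [v] that decays faster than any
    exponential. *)
Lemma pterm_decay A x w k : A \in unitmx -> exists2 K : R, 0 <= K &
  forall n v, 0 <= v ->
    normc (pterm A x w v n) <= edecay (lat_r A x n) 0 * (K * expR (- (k * v))).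
Proof.
move=> Au; have [g g0 gap] := lat_gap x Au; have [K K0 hK] := edecay_rapid k g0.
exists (expR g * K) => [|n v v0]; first by rewrite mulr_ge0 ?expR_ge0.
have [nx|nx] := eqVneq (lattice_pt A n) x.
  by rewrite /pterm nx eqxx normc0 !mulr_ge0 ?expR_ge0.
apply: (le_trans (normc_pterm_le _ _ _ _ _)).
apply: (@le_trans _ _ (edecay (lat_r A x n) 0 * (expR g * edecay g v))); last first.
  by rewrite ler_wpM2l ?edecay_ge0// -mulrA ler_wpM2l ?expR_ge0// hK.
rewrite /edecay expR0 mulr1 -!expRD ler_expR.
have e1 : 1 <= expR v by rewrite -[leLHS]expR0 ler_expR.
have := gap n nx; rewrite -subr_ge0 => h; have := mulr_ge0 h (_ : 0 <= expR v - 1).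
by rewrite subr_ge0 => /(_ e1); lra.
Qed.

Lemma psi_decay A x w k : A \in unitmx -> exists2 K : R, 0 <= K &
  forall v, 0 <= v -> normc (psi A x w v) <= K * expR (- (k * v)).
Proof.
move=> Au; have [K K0 hK] := pterm_decay x w k Au.
have [_ [S hS]] := nnsummable_edecay x 0 Au.
have S0 : 0 <= S by have := hS [::] isT; rewrite big_nil.
exists (S * K) => [|v v0]; first by rewrite mulr_ge0.
apply: normc_csum_le; first exact: csummable_pterm.
move=> J uJ; apply: (le_trans (ler_sum _ (fun n _ => hK n v v0))).
by rewrite -mulr_suml -mulrA ler_wpM2r ?mulr_ge0 ?expR_ge0// hS.
Qed.

Lemma rcontinuous_ofR (f : R -> R) t : {for t, continuous f} ->
  rcontinuous_at (fun t => (f t)%:C) t.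
Proof.
move=> /cvgrPdist_lt h e e0; have /nbhs_ballP[r r0 hr] := h e e0.
exists r => // u ut; rewrite -rmorphB normc_real distrC; apply: hr.
by rewrite /ball /= distrC.
Qed.

Lemma rcontinuous_pterm A x w n t : rcontinuous_at (pterm A x w ^~ n) t.
Proof.
rewrite /pterm; case: eqP => _; first by move=> e e0; exists 1 => // u _; rewrite subrr normc0.
set c := cis _.
have := rcontinuous_lin c 0 (rcontinuous_ofR (@continuous_edecay R (lat_r A x n) t))
  (rcontinuous_ofR (@continuous_edecay R (lat_r A x n) t)).
by under eq_fun do rewrite mul0r subr0 mulrC.
Qed.

Lemma edecay_mono r u v : 0 <= r -> u <= v -> edecay r v <= edecay r u :> R.
Proof. by move=> r0 uv; rewrite ler_expR lerN2 ler_wpM2l// ler_expR. Qed.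

Lemma rcontinuous_psi A x w t : A \in unitmx -> rcontinuous_at (psi A x w) t.
Proof.
move=> Au; apply: (@rcontinuous_csum _ _ (fun n v => pterm A x w v n)
  (fun n => edecay (lat_r A x n) (t - 1)) t 1) => //.
- exact: nnsummable_edecay.
- by move=> n; exact: rcontinuous_pterm.
- move=> n u; rewrite ltr_norml => /andP[h _]; apply: (le_trans (normc_pterm_le _ _ _ _ _)).
  by apply: edecay_mono; [exact: lat_r_ge0|move: h; lra].
Qed.

Lemma rcontinuousN (f : R -> C) : (forall t, rcontinuous_at f t) ->
  forall t, rcontinuous_at (fun t => f (- t)) t.
Proof.
move=> cf t e e0; have [r r0 h] := cf (- t) e e0; exists r => // u ut; apply: h.
by rewrite -opprD normrN.
Qed.

Lemma cmeasurable_psi A x w : A \in unitmx -> cmeasurable (psi A x w).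
Proof. by move=> Au; apply: rcontinuous_cmeasurable => t; exact: rcontinuous_psi. Qed.

Lemma cmeasurable_psiN A x w : A \in unitmx -> cmeasurable (fun v => psi A x w (- v)).
Proof.
by move=> Au; apply: rcontinuous_cmeasurable; apply: rcontinuousN => t; exact: rcontinuous_psi.
Qed.

End Punctured.

(** * The Mellin transform *)

Section Mellin.
Variables (R : realType) (d : nat).
Local Notation C := R[i].
Local Notation mu := (@lebesgue_measure R).
Local Notation D0 := (`[0%R, +oo[%classic : set (measurableTypeR R)).
Implicit Types (A : 'M[R]_d) (x y w : 'cV[R]_d).

Lemma normc_lat_cst A x w : normc (lat_cst A x w) <= 1.
Proof. by rewrite /lat_cst; case: ifP => _; rewrite ?normc_cis// normc0. Qed.

(** With frequency 0 all terms are nonnegative, so partial sums are below [psi], and [psi_dual]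
    shows that [psi] grows like t^(-d/2) as t = e^(-v) tends to 0. *)
Lemma pterm_sum_growth A x : A \in unitmx -> exists2 K : R, 0 <= K &
  forall v J, 0 <= v -> uniq J ->
    \sum_(n <- J) normc (pterm A x 0 (- v) n) <= K * expR (d%:R / 2 * v).
Proof.
move=> Au; have Bu := reciprocal_unitmx Au.
have [K K0 hK] := psi_decay 0 x 0 Bu.
exists (normc (theta_cst A x 0) * (K + 1) + 1) => [|v J v0 uJ].
  by rewrite addr_ge0// mulr_ge0 ?normc_ge0// addr_ge0.
have E n : pterm A x 0 (- v) n = (normc (pterm A x 0 (- v) n))%:C.
  rewrite /pterm; case: eqP => _; first by rewrite normc0.
  by rewrite dotp0l mulr0 cis0 mulr1 normc_real ger0_norm ?edecay_ge0.
have hs : has_csum (fun n => (normc (pterm A x 0 (- v) n))%:C) (psi A x 0 (- v)).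
  by under eq_fun do rewrite -E; apply/csummable_has_csum/csummable_pterm.
apply: (le_trans (has_csum_ge (fun n => normc_ge0 _) hs uJ)).
apply: (le_trans (ler_norm _)); apply: (le_trans (normr_Re_le _)).
have e1 : 1 <= expR (d%:R / 2 * v).
  by rewrite -[leLHS]expR0 ler_expR mulr_ge0// divr_ge0.
have := psi_dual x 0 v Au; rewrite oppr0 => ->.
apply: (le_trans (normcB _ _)); rewrite mulrDl mul1r; apply: lerD; last first.
  exact: le_trans (normc_lat_cst _ _ _) e1.
rewrite normcM (normcM (theta_cst A x 0)) normc_real ger0_norm ?expR_ge0// mulrAC.
rewrite ler_wpM2r ?expR_ge0// ler_wpM2l ?normc_ge0//.
apply: (le_trans (normcD _ _)); apply: lerD (normc_lat_cst _ _ _).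
by have := hK v v0; rewrite mul0r oppr0 expR0 mulr1.
Qed.

Lemma cpow_real (r N : R) : cpow r (- N%:C) = (expR (- (N * ln r)))%:C.
Proof. by rewrite /cpow -rmorphN -rmorphM cexp_real mulNr. Qed.

Lemma cint0 : cint D0 (fun=> 0 : C) = 0.
Proof.
have mD := @measurableD0 R; have := cintZ (0 : C) mD (cintegrable0 mD).
by rewrite !mul0r.
Qed.

(* The theta series is [O (t^(-d/2))] at [0], so its Mellin integral at [N] converges,
   and this integral is the sum up to the factor Gamma(N). *)
Lemma nnsummable_lat_pow A x (N : R) : A \in unitmx -> d%:R / 2 < N ->
  nnsummable (fun n => if lattice_pt A n == x then 0 else expR (- (N * ln (lat_r A x n)))).
Proof.
move=> Au dN; have mD := @measurableD0 R.
have d20 : 0 <= d%:R / 2 :> R by rewrite divr_ge0.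
have N0 : 0 < N by exact: le_lt_trans dN.
have NC : 0 < complex.Re (N%:C : C) by [].
split=> [n|]; first by case: ifP => _; rewrite ?expR_ge0.
have [K1 K10 h1] := pterm_decay x 0 (2 * N) Au.
have [S0 [S hS]] := nnsummable_edecay x 0 Au.
have S0' : 0 <= S by have := hS [::] isT; rewrite big_nil.
have [K2 K20 h2] := pterm_sum_growth x Au.
pose k := N - d%:R / 2; have k0 : 0 < k by rewrite subr_gt0.
pose H v := (S * K1 + K2) * expR (- (k * v)).
exists (normc (rGamma (N%:C : C)) * (2 * \int[mu]_(v in D0) H v)) => J uJ.
pose F n v : C := if lattice_pt A n == x then 0 else gker (lat_r A x n) N%:C v.
have iF n : cintegrable D0 (F n).
  rewrite /F; case: eqP => [_|/eqP nx]; first exact: cintegrable0.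
  by apply: cintegrable_gker => //; exact: lat_r_gt0.
have FE n : rGamma (N%:C : C) * cint D0 (F n) =
    (if lattice_pt A n == x then 0 else expR (- (N * ln (lat_r A x n))))%:C.
  rewrite /F; case: eqP => [_|/eqP nx]; last by rewrite -cpow_real -gint_cpow// lat_r_gt0.
  by rewrite cint0 mulr0.
set T := \sum_(n <- J) _.
have T0 : 0 <= T by apply: sumr_ge0 => n _; case: ifP => _; rewrite ?expR_ge0.
have -> : T = normc (rGamma (N%:C : C) * cint D0 (fun v => \sum_(n <- J) F n v)).
  rewrite cint_sum// mulr_sumr (eq_bigr _ (fun n _ => FE n)) -rmorph_sum normc_real.
  by rewrite ger0_norm.
rewrite normcM ler_wpM2l ?normc_ge0//; apply: (normc_cint_le mD).
- exact: cintegrable_sum.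
- exact: integrable_KexpRN.
move=> v; rewrite /= in_itv /= andbT => v0.
apply: (le_trans (normc_sum _ _ _)).
have FB n : normc (F n v) <= expR (N * v) * normc (pterm A x 0 v n) +
    expR (- (N * v)) * normc (pterm A x 0 (- v) n).
  rewrite /F /pterm; case: eqP => _; first by rewrite normc0 !mulr0 addr0.
  rewrite dotp0l mulr0 cis0 !mulr1 !normc_real !ger0_norm ?edecay_ge0//.
  apply: (le_trans (normcD _ _)).
  rewrite (normc_cexpMr N%:C) (normc_cexpMr (- N%:C)) ReN /= mulNr.
  by rewrite (ger0_norm (edecay_ge0 _ v)) (ger0_norm (edecay_ge0 _ (- v))).
have FS := @ler_sum _ _ J xpredT _ _ (fun n _ => FB n).
apply: (le_trans FS); rewrite big_split -!mulr_sumr.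
have b2 := h2 v J v0 uJ.
have b1 : \sum_(n <- J) normc (pterm A x 0 v n) <= S * (K1 * expR (- (2 * N * v))).
  apply: (le_trans (ler_sum _ (fun n _ => h1 n v v0))).
  by rewrite -mulr_suml ler_wpM2r ?mulr_ge0 ?expR_ge0// hS.
rewrite /H mulrDl; apply: lerD.
  apply: (le_trans (ler_wpM2l (expR_ge0 _) b1)).
  rewrite [leLHS]mulrC -!mulrA 2?ler_wpM2l// -expRD ler_expR.
  by move: (mulr_ge0 d20 v0); rewrite /k mulrBl; clear; lra.
apply: (le_trans (ler_wpM2l (expR_ge0 _) b2)).
by rewrite mulrCA ler_wpM2l// -expRD ler_expR /k mulrBl opprB addrC.
Qed.

(** The inequality u^N e^(-u) <= N^N e^(-N) at u = r e^(-v). It trades the exponential, which gives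
    little near t = 0, for the power r^(-N), which is summable over the lattice. *)
Lemma edecay_pow (r N v : R) : 0 < r -> 0 < N ->
  edecay r (- v) <= expR (- (N * ln r)) * (expR (N * ln N - N) * expR (N * v)).
Proof.
move=> r0 N0; pose u := ln r - v - ln N.
have E : r * expR (- v) = N * expR u.
  rewrite /u 2!expRD !expRN !lnK ?posrE//; field; rewrite gt_eqF//=.
  by rewrite gt_eqF// expR_gt0.
rewrite /edecay E -!expRD ler_expR.
have := ler_wpM2l (ltW N0) (expR_ge1Dx u); rewrite /u.
by rewrite mulrDr mulr1 2!mulrBr; lra.
Qed.

Lemma has_csum_gint A x w (a : C) : A \in unitmx -> d%:R / 2 < complex.Re a ->
  has_csum (fun n => if lattice_pt A n == x then 0 else
      gint (lat_r A x n) a * cis (2 * pi * dotp w (lattice_pt A n)))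
    (laplace (psi A x w) a + laplace (fun v => psi A x w (- v)) (- a)).
Proof.
move=> Au da; have mD := @measurableD0 R.
have d20 : 0 <= d%:R / 2 :> R by rewrite divr_ge0.
have a0 : 0 < complex.Re a by exact: le_lt_trans da.
(* Strictly between d / 2 and Re a: the first inequality makes r^(-N) summable, the second leaves a
   decaying exponential in [v] for the part t <= 1. *)
pose N := (complex.Re a + d%:R / 2) / 2.
have Na : N < complex.Re a by rewrite /N ltr_pdivrMr//; lra.
have dN : d%:R / 2 < N by rewrite /N ltr_pdivlMr//; lra.
have N0 : 0 < N by exact: le_lt_trans dN.
have [K1 K10 h1] := pterm_decay x w (complex.Re a + 1) Au.
pose F n v := cexp (a * v%:C) * pterm A x w v n.
pose F' n v := cexp (- a * v%:C) * pterm A x w (- v) n.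
have mF n : cmeasurable (F n).
  apply: cmeasurableM; first exact: cmeasurable_cexp.
  by apply: rcontinuous_cmeasurable => t; exact: rcontinuous_pterm.
have mF' n : cmeasurable (F' n).
  apply: cmeasurableM; first exact: cmeasurable_cexp.
  apply: rcontinuous_cmeasurable; apply: (rcontinuousN (f := pterm A x w ^~ n)) => t.
  exact: rcontinuous_pterm.
have b1 n v : 0 <= v -> normc (F n v) <= edecay (lat_r A x n) 0 * (K1 * expR (- (1 * v))).
  move=> v0; rewrite normcM normc_cexpM.
  apply: (le_trans (ler_wpM2l (expR_ge0 _) (h1 n v v0))).
  rewrite mulrCA ler_wpM2l ?edecay_ge0// mulrCA ler_wpM2l// -expRD ler_expR.
  by rewrite mulrDl; lra.
pose G n := if lattice_pt A n == x then 0 else expR (- (N * ln (lat_r A x n))).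
pose K2 := expR (N * ln N - N).
have b2 n v : 0 <= v -> normc (F' n v) <= G n * (K2 * expR (- ((complex.Re a - N) * v))).
  move=> v0; rewrite /F' /G; have [nx|nx] := eqVneq (lattice_pt A n) x.
    by rewrite /pterm nx eqxx mulr0 normc0 mul0r.
  rewrite normcM normc_cexpM ReN mulNr.
  apply: (le_trans (ler_wpM2l (expR_ge0 _) (normc_pterm_le _ _ _ _ _))).
  apply: (le_trans (ler_wpM2l (expR_ge0 _) (edecay_pow v (lat_r_gt0 nx) N0))).
  rewrite mulrCA ler_wpM2l ?expR_ge0// mulrCA ler_wpM2l ?expR_ge0// -expRD ler_expR.
  by rewrite mulrBl; lra.
have E1 : (fun v => csum (F ^~ v)) = (fun v => cexp (a * v%:C) * psi A x w v).
  by apply/funext => v; rewrite /F csumZ//; exact: csummable_pterm.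
have E2 : (fun v => csum (F' ^~ v)) = (fun v => cexp (- a * v%:C) * psi A x w (- v)).
  by apply/funext => v; rewrite /F' csumZ//; exact: csummable_pterm.
have s1 : has_csum (fun n => cint D0 (F n)) (laplace (psi A x w) a).
  have := @has_csum_cint _ _ F _ K1 1 K10 ltr01 (nnsummable_edecay x 0 Au) mF _ b1.
  rewrite E1; apply; apply: cmeasurableM; first exact: cmeasurable_cexp.
  exact: cmeasurable_psi.
have aN : 0 < complex.Re a - N by rewrite subr_gt0.
have s2 : has_csum (fun n => cint D0 (F' n)) (laplace (fun v => psi A x w (- v)) (- a)).
  have := @has_csum_cint _ _ F' G K2 _ (expR_ge0 _) aN (nnsummable_lat_pow x Au dN) mF' _ b2.
  rewrite E2; apply; apply: cmeasurableM; first exact: cmeasurable_cexp.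
  exact: cmeasurable_psiN.
have := has_csumD s1 s2; congr has_csum; apply/funext => n.
have i1 : cintegrable D0 (F n).
  apply: (@cintegrable_D0 _ _ (edecay (lat_r A x n) 0 * K1) 1 ltr01 (mF n)) => v v0.
  by rewrite -mulrA; exact: b1.
have i2 : cintegrable D0 (F' n).
  apply: (@cintegrable_D0 _ _ (G n * K2) _ aN (mF' n)) => v v0.
  by rewrite -mulrA; exact: b2.
rewrite -(cintD mD i1 i2) /F /F' /pterm; case: eqP => [_|/eqP nx].
  rewrite -[RHS]cint0.
  by apply: eq_cint => v _; rewrite !mulr0 addr0.
rewrite [RHS]mulrC /gint -cintZ//; last by apply: cintegrable_gker => //; exact: lat_r_gt0.
by apply: eq_cint => v _; rewrite /gker; move: (cis _) (cexp _) (cexp _) => p q r; ring.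
Qed.

Lemma cint_cexp (b : C) : complex.Re b < 0 ->
  cintegrable D0 (fun v => cexp (b * v%:C)) /\ cint D0 (fun v => cexp (b * v%:C)) = - b^-1.
Proof.
move=> b0; have b0' : 0 < - complex.Re b by rewrite oppr_gt0.
have bn : b != 0 by apply: contraTneq b0 => ->; rewrite ltxx.
have bd t : 0 <= t -> normc (cexp (b * t%:C)) <= 1 * expR (- (- complex.Re b * t)).
  by move=> _; rewrite normc_cexpM mulNr opprK mul1r.
have i0 : cintegrable D0 (fun v => cexp (b * v%:C)).
  exact: (cintegrable_D0 b0' (cmeasurable_cexp _) bd).
split=> //; apply: (mulfI bn); rewrite mulrN mulfV// -(cintZ b (@measurableD0 R) i0).
rewrite (@cint_halfline_FTC R (fun v => cexp (b * v%:C)) _ (normc b + 1) _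
  (fun t => proj1 (cder_cexp b t)) (fun t => proj2 (cder_cexp b t)) _ b0').
- by rewrite mulr0 cexp0.
- move=> t; have := rcontinuous_lin b 0 (@rcontinuous_cexp R b t) (@rcontinuous_cexp R b t).
  by under eq_fun do rewrite mul0r subr0.
- move=> t t0; rewrite normcM mulrDl ler_wpDr ?mul1r ?expR_ge0//.
  by rewrite ler_wpM2l ?normc_ge0//; have := bd t t0; rewrite mul1r.
- move=> t t0; apply: (le_trans (bd t t0)).
  by rewrite ler_wpM2r ?expR_ge0// lerDr normc_ge0.
Qed.

(** The completed zeta function pi^(-s/2) Gamma(s/2) Z at a = s / 2. The Laplace transforms come
    from t >= 1 on either side of the duality; the two fractions come from the omitted terms and
    carry the possible poles at a = 0 and a = d / 2. *)
Definition xi A x y (a : C) : C :=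
  laplace (psi A x (- y)) a + theta_cst A x y * laplace (psi (reciprocal A) y x) ((d%:R / 2)%:C - a) -
  lat_cst A x (- y) / a + theta_cst A x y * lat_cst (reciprocal A) y x / (a - (d%:R / 2)%:C).

Lemma laplace_psiN A x y (a : C) : A \in unitmx -> d%:R / 2 < complex.Re a ->
  laplace (psi A x (- y)) a + laplace (fun v => psi A x (- y) (- v)) (- a) = xi A x y a.
Proof.
move=> Au da; have mD := @measurableD0 R; have Bu := reciprocal_unitmx Au.
have d20 : 0 <= d%:R / 2 :> R by rewrite divr_ge0.
have a0 : 0 < complex.Re a by exact: le_lt_trans da.
set D := d%:R / 2 in da d20 *.
have r1 : complex.Re (D%:C - a) < 0 by rewrite ReD ReN /= subr_lt0.
have r2 : complex.Re (- a) < 0 by rewrite ReN oppr_lt0.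
have [i1 c1] := cint_cexp r1; have [i2 c2] := cint_cexp r2.
have [K K0 hK] := psi_decay y x 0 Bu.
have i3 : cintegrable D0 (fun v => cexp ((D%:C - a) * v%:C) * psi (reciprocal A) y x v).
  apply: (@cintegrable_laplace _ _ K 0 _ _ hK r1); exact: cmeasurable_psi.
rewrite /xi -!addrA; congr (_ + _); rewrite {1}/laplace.
set B := reciprocal A in i3 hK *; set T := theta_cst A x y.
rewrite (@eq_cint _ _ _ (fun v => (T * (cexp ((D%:C - a) * v%:C) * psi B y x v) +
   (T * lat_cst B y x) * cexp ((D%:C - a) * v%:C)) - lat_cst A x (- y) * cexp (- a * v%:C))); last first.
  move=> v _; rewrite psi_dual// mulrDl (cexpD (D%:C * _)) -rmorphM cexp_real.
  by rewrite -/T -/B -/D; move: (cexp (- a * _)) (expR (D * v))%:C => p q; ring.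
rewrite cintB//; last 2 first.
- by apply: cintegrableD => //; exact: cintegrableZ.
- exact: cintegrableZ.
rewrite cintD//; try exact: cintegrableZ.
rewrite !cintZ// c1 c2 -/(laplace _ _) -[a - D%:C]opprB !invrN.
by move: (laplace _ _) (_^-1) (a^-1) => p q r; ring.
Qed.

End Mellin.

(** * The meromorphic continuation *)

Section Continuation.
Variables (R : realType) (d : nat).
Local Notation C := R[i].
Local Notation C' := (R[i]^o).
Implicit Types (A : 'M[R]_d) (x y w : 'cV[R]_d).

Lemma sum_has_csum (K : choiceType) (F : K -> C') (s : C) :
  has_csum F s -> summability.sum F = s.
Proof.
move=> hs; have FK := @summability.totally_filter K.
apply: (cvg_lim (@C_hausdorff R)); apply/cvgcP => e e0.
have [J0 h] := hs e e0.
exists (finmap.seq_fset tt J0) => // B /finmap.fsubsetP sub.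
have E : summability.partial_sum F B = \sum_(i <- finmap.enum_fset B) F i.
  exact/esym/finmap.big_seq_fsetE.
rewrite /= E; apply: h.
  exact: finmap.fset_uniq.
by move=> i iJ; apply: sub; rewrite finmap.seq_fsetE.
Qed.

Lemma cpow_enorm A x n (s : C) : lattice_pt A n != x ->
  cpow pi (s / 2) * cpow (lat_r A x n) (- (s / 2)) =
  (cpow (enorm (x - lattice_pt A n)) s)^-1.
Proof.
move=> nx; rewrite -cpowN /cpow -cexpD; congr cexp.
have q0 : 0 < dotp (lattice_pt A n - x) (lattice_pt A n - x) by rewrite dotp_gt0// subr_eq0.
rewrite /lat_r lnM ?posrE ?pi_gt0//.
have -> : enorm (x - lattice_pt A n) =
    Num.sqrt (dotp (lattice_pt A n - x) (lattice_pt A n - x)).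
  by rewrite /enorm -opprB dotpNl dotpNr opprK.
move: q0; move: (dotp _ _) => q q0.
have -> : ln q = 2 * ln (Num.sqrt q).
  by rewrite -{1}(sqr_sqrtr (ltW q0)) lnXn ?sqrtr_gt0// mulr_natl.
move: (ln pi) (ln (Num.sqrt q)) => p l; rewrite rmorphD rmorphM rmorph_nat /=.
by field.
Qed.

Lemma half_Re (s : C) : complex.Re (s / 2) = complex.Re s / 2.
Proof.
have -> : (2 : C)^-1 = (2^-1)%:C by rewrite fmorphV rmorph_nat.
by rewrite ReM /= mulr0 subr0.
Qed.

Lemma epstein_sum_xi A x y (s : C) : A \in unitmx -> d%:R < complex.Re s ->
  epstein_sum (lattice A) x y s = cpow pi (s / 2) * (rGamma (s / 2) * xi A x y (s / 2)).
Proof.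
move=> Au ds; have da : d%:R / 2 < complex.Re (s / 2) by rewrite half_Re ltr_pM2r.
have d20 : 0 <= d%:R / 2 :> R by rewrite divr_ge0.
have a0 : 0 < complex.Re (s / 2) by exact: le_lt_trans da.
rewrite /epstein_sum; apply: sum_has_csum.
have := has_csum_gint x (- y) Au da; rewrite laplace_psiN// => H.
have {}H := has_csumZ (cpow pi (s / 2)) (has_csumZ (rGamma (s / 2)) H).
apply: (has_csum_extend (lattice_pt_inj Au) _ _ H) => [n|z hz]; last first.
  rewrite ifN// negb_and; apply/orP; left; rewrite notin_setE => -[n _ nz].
  by apply: (hz n); rewrite -nz.
have -> : lattice_pt A n \in lattice A by rewrite inE; exists n.
have [nx|nx] /= := eqVneq (lattice_pt A n) x; first by rewrite !mulr0.
rewrite -cpow_enorm// (mulrA (rGamma _)) gint_cpow//; last exact: lat_r_gt0.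
rewrite [LHS]mulrC -[LHS]mulrA; congr (_ * (_ * _)).
by rewrite cis_cexp; congr (cexp (0 +i* _)); rewrite dotpNl; ring.
Qed.

(** The fraction of [xi] with denominator s / 2 appears here as [rGamma (s / 2 + 1)], which is 1 /
    Gamma(s/2) divided by s / 2; in this form the part without the pole at d is entire, including s
    = 0. *)
Definition epstein_entire A x y (s : C) : C :=
  cpow pi (s / 2) * (rGamma (s / 2) * (laplace (psi A x (- y)) (s / 2) +
     theta_cst A x y * laplace (psi (reciprocal A) y x) ((d%:R / 2)%:C - s / 2)) -
  lat_cst A x (- y) * rGamma (s / 2 + 1)).

(** The numerator of the polar part; its value at s = d is the residue there. *)
Definition epstein_residue A x y (s : C) : C :=
  2 * (theta_cst A x y * lat_cst (reciprocal A) y x) * (cpow pi (s / 2) * rGamma (s / 2)).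

Definition epstein_cont A x y (s : C) : C :=
  epstein_entire A x y s + epstein_residue A x y s * (s - d%:R)^-1.

Lemma half_nat (n : nat) : (n%:R / 2)%:C = n%:R / 2 :> C.
Proof. by rewrite rmorphM fmorphV !rmorph_nat. Qed.

Lemma half_sub (n : nat) (s : C) : (s / 2 - (n%:R / 2)%:C)^-1 = 2 * (s - n%:R)^-1.
Proof. by rewrite half_nat -mulrBl invfM invrK mulrC. Qed.

(** At s = 0 with [x] in the lattice the division in [xi] returns 0 and loses the term that
    [rGamma (s / 2 + 1)] keeps, hence the case condition. At s = d both sides share the convention
    that the inverse of 0 is 0. *)
Lemma epstein_cont_xi A x y (s : C) : s <> 0 \/ ~ lattice A x ->
  epstein_cont A x y s = cpow pi (s / 2) * (rGamma (s / 2) * xi A x y (s / 2)).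
Proof.
have alg (p g l1 t l2 c1 c2 q : C) : p * (g * (l1 + t * l2) - g * c1) + 2 * (t * c2) * (p * g) * q =
    p * (g * (l1 + t * l2 - c1 + t * c2 * (2 * q))) by ring.
move=> s0; rewrite /epstein_cont /epstein_entire /epstein_residue /xi half_sub.
have -> : lat_cst A x (- y) * rGamma (s / 2 + 1) = rGamma (s / 2) * (lat_cst A x (- y) / (s / 2)).
  rewrite [rGamma (s / 2)]rGamma_rec; case: s0 => [s0|nx].
    have h0 : s / 2 != 0 by rewrite mulf_neq0 ?invr_eq0 ?pnatr_eq0//; apply/eqP.
    by rewrite [RHS]mulrC mulrA divfK.
  by rewrite /lat_cst; case: asboolP => // _; rewrite !mul0r mulr0.
exact (alg _ _ _ _ _ _ _ _).
Qed.

Lemma derivable_half (s : C') : derivable ((fun s => s / 2) : C' -> C') s 1.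
Proof. exact (@derivableM_c _ _ _ _ (@derivable_id_c _ s) (@derivable_cst_c _ (2^-1) s)). Qed.

Lemma derivable_laplace_psi A x w (a : C') : A \in unitmx ->
  derivable (laplace (psi A x w) : C' -> C') a 1.
Proof.
move=> Au; have [K K0 hK] := psi_decay x w (complex.Re a + 1) Au.
apply: (derivable_laplace (cmeasurable_psi x w Au) hK).
by rewrite ltrDl.
Qed.

Lemma derivable_pi_Gamma (s : C') :
  derivable ((fun s => cpow pi (s / 2) * rGamma (s / 2)) : C' -> C') s 1.
Proof.
have dh := @derivable_half s.
exact (@derivableM_c _ _ _ _ (@derivable_comp_c _ _ _ _ dh (@derivable_cpow _ pi (s / 2)))
  (@derivable_comp_c _ _ _ _ dh (@derivable_rGamma _ (s / 2)))).
Qed.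

Lemma derivable_residue A x y (s : C') : derivable (epstein_residue A x y : C' -> C') s 1.
Proof. exact (@derivableM_c _ _ _ _ (@derivable_cst_c _ _ s) (@derivable_pi_Gamma s)). Qed.

Lemma derivable_entire A x y (s : C') : A \in unitmx ->
  derivable (epstein_entire A x y : C' -> C') s 1.
Proof.
move=> Au; have Bu := reciprocal_unitmx Au; have dh := @derivable_half s.
have d1 := @derivable_comp_c _ _ _ _ dh (@derivable_cpow _ pi (s / 2)).
have d2 := @derivable_comp_c _ _ _ _ dh (@derivable_rGamma _ (s / 2)).
have d3 := @derivable_comp_c _ _ _ _ dh (@derivable_laplace_psi A x (- y) (s / 2) Au).
have dh' := @derivableB_c _ _ _ _ (@derivable_cst_c _ (d%:R / 2)%:C s) dh.
have d4 := @derivable_comp_c _ _ _ _ dh' (@derivable_laplace_psi _ y x ((d%:R / 2)%:C - s / 2) Bu).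
have d5 := @derivableD_c _ _ _ _ d3 (@derivableM_c _ _ _ _ (@derivable_cst_c _ (theta_cst A x y) s) d4).
have dh1 := @derivableD_c _ _ _ _ dh (@derivable_cst_c _ 1 s).
have d6 := @derivable_comp_c _ _ _ _ dh1 (@derivable_rGamma _ (s / 2 + 1)).
have d7 := @derivableM_c _ _ _ _ (@derivable_cst_c _ (lat_cst A x (- y)) s) d6.
exact (@derivableM_c _ _ _ _ d1 (@derivableB_c _ _ _ _ (@derivableM_c _ _ _ _ d2 d5) d7)).
Qed.

Lemma derivable_cont A x y (s : C') : A \in unitmx -> s <> d%:R \/ ~ lattice (reciprocal A) y ->
  derivable (epstein_cont A x y : C' -> C') s 1.
Proof.
move=> Au [sd|ny].
  have s0 : (s : C) - d%:R != 0 by rewrite subr_eq0; apply/eqP.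
  have dB : derivable ((fun w : C => w - d%:R) : C' -> C') s 1.
    exact (@derivableB_c _ _ _ _ (@derivable_id_c _ s) (@derivable_cst_c _ d%:R s)).
  have di := @derivable_inv_c _ ((fun w : C => w - d%:R) : C' -> C') s s0 dB.
  exact (@derivableD_c _ _ _ _ (@derivable_entire A x y s Au)
    (@derivableM_c _ _ _ _ (@derivable_residue A x y s) di)).
apply: (derivable_near _ (@derivable_entire A x y s Au)); apply/nbhscP; exists 1 => // w _.
rewrite /epstein_cont /epstein_residue /lat_cst.
by case: asboolP => // _; rewrite !mulr0 !mul0r addr0.
Qed.

End Continuation.

(** * The functional equation *)

Section Functional.
Variables (R : realType) (d : nat).
Hypothesis d0 : (0 < d)%N.
Local Notation C := R[i].
Local Notation C' := (R[i]^o).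
Implicit Types (A : 'M[R]_d) (x y w : 'cV[R]_d).

Lemma covolume_gt0 A : A \in unitmx -> 0 < covolume A.
Proof. by rewrite unitmxE unitfE /covolume normr_gt0. Qed.

Lemma theta_cst_neq0 A x y : A \in unitmx -> theta_cst A x y != 0.
Proof.
move=> Au; rewrite -normc_eq0 /theta_cst normcM normc_cis mulr1 normc_real.
by rewrite normr_eq0 invr_eq0 gt_eqF// covolume_gt0.
Qed.

(** Ensures a true pole at s = d, as [meromorphic] demands where [epstein_cont] is not holomorphic.
    The gamma factor is nonzero because d / 2 > 0. *)
Lemma residue_neq0 A x y : A \in unitmx -> lattice (reciprocal A) y ->
  epstein_residue A x y d%:R != 0.
Proof.
move=> Au yB; rewrite /epstein_residue /lat_cst asboolT//.
have g0 : rGamma (d%:R / 2 : C) != 0.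
  by apply: rGamma_neq0; rewrite half_Re Re_nat divr_gt0// ltr0n.
apply: mulf_neq0; apply: mulf_neq0 => //; last exact: cpow_neq0.
by apply: mulf_neq0; [exact: theta_cst_neq0|exact: cis_neq0].
Qed.

Lemma meromorphic_cont A x y : A \in unitmx -> meromorphic (epstein_cont A x y).
Proof.
move=> Au s; split.
  have [sd|sd] := eqVneq (s : C) d%:R.
    apply/dnbhscP; exists 1; first exact: ltr01.
    move=> w /eqP; rewrite sd => wd _; exact (@derivable_cont _ _ A x y w Au (or_introl wd)).
  apply/dnbhscP; exists (normc (d%:R - s)).
    by rewrite normc_gt0 subr_eq0 eq_sym.
  move=> w _ h; have wd : w <> d%:R by move=> wd; move: h; rewrite wd ltxx.
  exact (@derivable_cont _ _ A x y w Au (or_introl wd)).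
have [yB|yB] := pselect (lattice (reciprocal A) y); last first.
  by left; exact (@derivable_cont _ _ A x y s Au (or_intror yB)).
have [->|sd] := eqVneq (s : C) d%:R; last first.
  by left; exact (@derivable_cont _ _ A x y s Au (or_introl (elimN eqP sd))).
right; set f := epstein_cont A x y.
have q0 := residue_neq0 x Au yB; set Q := epstein_residue A x y in q0.
set E := epstein_entire A x y.
have q0' : 0 < normc (Q d%:R) by rewrite normc_gt0.
have q2 : 0 < normc (Q d%:R) / 2 by rewrite divr_gt0.
have [r1 r10 h1] := derivable_ccontinuous (@derivable_residue _ _ A x y d%:R) q2.
have [r2 r20 h2] := derivable_ccontinuous (@derivable_entire _ _ A x y d%:R Au) (ltr01 : 0 < 1 :> R).
move=> P [M [Mr hM]].
(* Chosen so that a polar part larger than [m] still exceeds [M] in modulus after subtracting the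
   entire part, which near d is at most its value at d plus 1. *)
pose m := `|complex.Re M| + normc (E d%:R) + 1 + 1.
have m0 : 0 < m by rewrite ltr_wpDl// !addr_ge0 ?normc_ge0.
apply/dnbhscP; exists (Num.min r1 (Num.min r2 (normc (Q d%:R) / 2 / m))).
  by rewrite !lt_min r10 r20 divr_gt0.
move=> w wd; rewrite !lt_min => /and3P[/h1 w1 /h2 w2 w3]; apply: hM.
suff h : complex.Re M < normc (f w).
  by rewrite -(RRe_real Mr) normr_normc ltcR.
have wd0 : 0 < normc (w - d%:R) by rewrite normc_gt0 subr_eq0.
have b1 : normc (Q d%:R) / 2 <= normc (Q w).
  have := normcD (Q w) (Q d%:R - Q w); rewrite addrC subrK (normc_distC (Q d%:R)).
  by move: w1; rewrite -/Q; lra.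
have b2 : normc (E w) <= normc (E d%:R) + 1.
  have := normcD (E d%:R) (E w - E d%:R); rewrite addrC subrK.
  by move: w2; rewrite -/E; lra.
have b3 : m < normc (Q w * (w - d%:R)^-1).
  rewrite normcM normcV ltr_pdivlMr//; apply: lt_le_trans b1.
  by rewrite mulrC -ltr_pdivlMr.
have := normcB (f w) (E w); rewrite /f /epstein_cont -/E -/Q addrC addKr.
by move: b2 b3 (ler_norm (complex.Re M)); rewrite /m; lra.
Qed.

(** [epstein_cont] itself shows that the choice in [epstein_zeta] is made from a nonempty set; the
    chosen function then equals it wherever [epstein_cont] is holomorphic. *)
Lemma epstein_zeta_cont A x y (s : C) : A \in unitmx ->
  s <> d%:R \/ ~ lattice (reciprocal A) y ->
  epstein_zeta (lattice A) s x y = epstein_cont A x y s.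
Proof.
move=> Au hs; rewrite /epstein_zeta.
set P := [set f : C' -> C' | _].
have agree z : d%:R < complex.Re z -> epstein_cont A x y z = epstein_sum (lattice A) x y z.
  move=> dz; rewrite epstein_sum_xi// epstein_cont_xi//; left => z0.
  by move: dz; rewrite z0 /= ltrn0.
have Pc : P (epstein_cont A x y) by split => //; exact: meromorphic_cont.
case: xgetP => [f _ [mf hf]|/(_ _ Pc)//].
apply: (meromorphic_unique mf (meromorphic_cont x y Au) (d := d%:R)).
  by move=> z dz; rewrite hf// agree.
exact: derivable_cont.
Qed.

Lemma reciprocalK A : A \in unitmx -> reciprocal (reciprocal A) = A.
Proof. by move=> Au; rewrite /reciprocal -trmx_inv invmxK trmxK. Qed.

Lemma covolume_reciprocal A : covolume (reciprocal A) = (covolume A)^-1.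
Proof. by rewrite /covolume /reciprocal det_tr det_inv normfV. Qed.

Lemma lattice_ptN A n : lattice_pt A (- n) = - lattice_pt A n.
Proof.
rewrite /lattice_pt -mulmxN; congr (_ *m _).
by apply/matrixP => i j; rewrite !mxE mulrNz.
Qed.

Lemma latticeN A x : lattice A x -> lattice A (- x).
Proof. by move=> [n _ <-]; exists (- n) => //; exact: lattice_ptN. Qed.

Lemma psi_opp A x w : A \in unitmx -> psi A (- x) (- w) = psi A x w.
Proof.
move=> Au; apply/funext => v; rewrite /psi.
rewrite -(csum_reindex (@opprK _) (@opprK _) (csummable_pterm (- x) (- w) v Au)).
congr csum; apply/funext => n; rewrite /pterm /lat_r lattice_ptN eqr_opp -opprD.
by rewrite !dotpNl !dotpNr !opprK.
Qed.

Lemma lat_cst_opp A x w : lat_cst A (- x) (- w) = lat_cst A x w.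
Proof.
rewrite /lat_cst dotpNl dotpNr opprK.
have -> // : `[< lattice A (- x) >] = `[< lattice A x >].
by apply: asbool_equiv_eq; split=> /latticeN; rewrite ?opprK.
Qed.

(** The duality exchanges the two Laplace transforms and the two fractions in [xi]. Central symmetry
    of the lattice, through [psi_opp] and [lat_cst_opp], absorbs the sign in [- x]; half of the
    phase in [theta_cst] goes to each side. *)
Lemma xi_dual A x y (a : C) : A \in unitmx ->
  cis (pi * dotp x y) * xi A x y a =
  ((covolume A)^-1)%:C * cis (- (pi * dotp x y)) *
    xi (reciprocal A) y (- x) ((d%:R / 2)%:C - a).
Proof.
move=> Au; rewrite /xi reciprocalK// !opprK.
have -> : psi A (- x) y = psi A x (- y) by have := psi_opp x (- y) Au; rewrite opprK.
have -> : lat_cst A (- x) y = lat_cst A x (- y) by have := lat_cst_opp A x (- y); rewrite opprK.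
rewrite /theta_cst covolume_reciprocal invrK dotpNr (dotpC y x).
have V0 := covolume_gt0 Au.
have VC : ((covolume A)^-1)%:C * (covolume A)%:C = 1 :> C by rewrite -rmorphM mulVf ?gt_eqF.
have e1 : cis (- (2 * pi * dotp x y)) = cis (- (pi * dotp x y)) * cis (- (pi * dotp x y)) :> C.
  by rewrite -cisD; congr cis; ring.
have e2 : cis (- (2 * pi * - dotp x y)) = cis (pi * dotp x y) * cis (pi * dotp x y) :> C.
  by rewrite -cisD; congr cis; ring.
have e3 : cis (- (pi * dotp x y)) * cis (pi * dotp x y) = 1 :> C.
  by rewrite -cisD addNr cis0.
rewrite e1 e2 [(d%:R / 2)%:C - (_ - a)]subKr.
have -> : (d%:R / 2)%:C - a - (d%:R / 2)%:C = - a by rewrite addrAC subrr add0r.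
rewrite -[a - _]opprB !invrN.
have alg (p q V W l1 l2 c1 c2 a1 b1 : C) : W * V = 1 -> q * p = 1 ->
    p * (l1 + W * (q * q) * l2 - c1 * a1 + W * (q * q) * c2 * - b1) =
    W * q * (l2 + V * (p * p) * l1 - c2 * b1 + V * (p * p) * c1 * - a1).
  move=> WV qp.
  transitivity (p * (l1 - c1 * a1) + W * q * (q * p) * (l2 - c2 * b1)); first by ring.
  transitivity ((W * V) * (q * p) * p * (l1 - c1 * a1) + W * q * (l2 - c2 * b1)); last by ring.
  by rewrite WV qp !mul1r !mulr1.
exact: alg.
Qed.

(** The power of pi in the prefactor cancels the one in [epstein_cont_xi], so that only V^(s/d) is
    left to compare. *)
Lemma cpow_pref (V : R) (s : C) : 0 < V ->
  cpow (V `^ (2 / d%:R) / pi) (s / 2) * cpow pi (s / 2) = cpow V (s / d%:R).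
Proof.
move=> V0; have dC : (d%:R : C) != 0 by exact: natC_neq0.
rewrite /cpow -cexpD; congr cexp.
rewrite ln_div ?posrE ?powR_gt0 ?pi_gt0// ln_powR.
move: (ln pi) (ln V) => p l; rewrite rmorphB !rmorphM fmorphV !rmorph_nat /=.
by field.
Qed.

Lemma cpow_inv (V : R) (s : C) : 0 < V ->
  cpow V^-1 ((d%:R - s) / d%:R) = (V^-1)%:C * cpow V (s / d%:R).
Proof.
move=> V0; have dC : (d%:R : C) != 0 by exact: natC_neq0.
have -> : (V^-1)%:C = cexp (- (ln V)%:C).
  by rewrite -rmorphN cexp_real expRN lnK ?posrE.
rewrite /cpow -cexpD; congr cexp; rewrite lnV ?posrE// rmorphN /=.
by field.
Qed.

(** Written through [xi], the gamma factors of the two sides agree and the claim is [xi_dual] up to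
    powers of the covolume. The two case conditions keep each zeta function away from its pole. *)
Lemma functional_equation A x y (s : C) : A \in unitmx ->
  s <> 0 \/ ~ lattice A x -> s <> d%:R \/ ~ lattice (reciprocal A) y ->
  cpow (covolume A `^ (2 / d%:R) / pi) (s / 2) * rGamma ((d%:R - s) / 2) *
    cexp (0 +i* (pi * dotp x y)) * epstein_zeta (lattice A) s x y =
  cpow (covolume (reciprocal A) `^ (2 / d%:R) / pi) ((d%:R - s) / 2) * rGamma (s / 2) *
    cexp (0 +i* (- (pi * dotp x y))) *
    epstein_zeta (lattice (reciprocal A)) (d%:R - s) y (- x).
Proof.
move=> Au s0 sd; have Bu := reciprocal_unitmx Au.
rewrite epstein_zeta_cont// epstein_zeta_cont//; last first.
  rewrite reciprocalK//; case: s0 => [s0|nx]; [left|right].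
    by move=> h; apply: s0; rewrite -(subKr d%:R s) h subrr.
  by move=> /latticeN; rewrite opprK.
rewrite epstein_cont_xi// epstein_cont_xi//; last first.
  by case: sd => [sd|]; [left => h; apply: sd; rewrite -(subKr d%:R s) h subr0|right].
rewrite -!cis_cexp.
have V0 := covolume_gt0 Au; have VB0 := covolume_gt0 Bu.
have := xi_dual x y (s / 2) Au.
have -> : (d%:R / 2)%:C - s / 2 = (d%:R - s) / 2 by rewrite half_nat mulrBl.
have := cpow_pref s V0; have := cpow_pref (d%:R - s) VB0.
rewrite covolume_reciprocal cpow_inv//.
have alg (a a' b b' c g g' e e' f f' W : C) : b * b' = W * c -> a * a' = c ->
    e * f = W * e' * f' ->
    a * g * e * (a' * (g' * f)) = b * g' * e' * (b' * (g * f')).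
  move=> h1 h2 h3; transitivity ((a * a') * g * g' * (e * f)); first by ring.
  transitivity ((b * b') * g * g' * e' * f'); last by ring.
  by rewrite h1 h2 h3; ring.
exact: alg.
Qed.

(** Serves the exceptional case s = 0 with [x] in the lattice, where the right-hand side is a limit:
    the left-hand side is continuous there. *)
Lemma lhs_derivable A x y (k : C) (s : C') : A \in unitmx ->
  s <> d%:R \/ ~ lattice (reciprocal A) y ->
  derivable ((fun s => cpow (covolume A `^ (2 / d%:R) / pi) (s / 2) * rGamma ((d%:R - s) / 2) *
    k * epstein_cont A x y s) : C' -> C') s 1.
Proof.
move=> Au hs; have dh := @derivable_half _ s.
have d1 := @derivable_comp_c _ _ _ _ dh (@derivable_cpow _ (covolume A `^ (2 / d%:R) / pi) (s / 2)).
have dB := @derivableB_c _ _ _ _ (@derivable_cst_c _ d%:R s) (@derivable_id_c _ s).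
have dh' := @derivableM_c _ _ _ _ dB (@derivable_cst_c _ (2^-1) s).
have d2 := @derivable_comp_c _ _ _ _ dh' (@derivable_rGamma _ ((d%:R - s) / 2)).
have d3 := @derivableM_c _ _ _ _ (@derivableM_c _ _ _ _ d1 d2) (@derivable_cst_c _ k s).
exact (@derivableM_c _ _ _ _ d3 (@derivable_cont _ _ A x y s Au hs)).
Qed.

End Functional.

Theorem corollary2p13 (R : realType) (d : nat) (hd : (0 < d)%N)
    (A : 'M[R]_d) (hA : A \in unitmx) (x y : 'cV[R]_d) (nu : R[i])
    (hnu : lattice (reciprocal A) y -> nu <> d%:R) :
  let B := reciprocal A in
  let lhs (s : R[i]^o) : R[i]^o :=
    cpow (covolume A `^ (2 / d%:R) / pi) (s / 2) * rGamma ((d%:R - s) / 2) *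
    cexp (0 +i* (pi * dotp x y)) * epstein_zeta (lattice A) s x y in
  let rhs (s : R[i]^o) : R[i]^o :=
    cpow (covolume B `^ (2 / d%:R) / pi) ((d%:R - s) / 2) * rGamma (s / 2) *
    cexp (0 +i* (- (pi * dotp x y))) *
    epstein_zeta (lattice B) (d%:R - s) y (- x) in
  (~ (nu = 0 /\ lattice A x) -> lhs nu = rhs nu) /\
  (nu = 0 /\ lattice A x -> rhs s @[s --> (0 : R[i]^o)^'] --> lhs nu).
Proof.
move=> B lhs rhs.
have hnu' : nu <> d%:R \/ ~ lattice (reciprocal A) y.
  by have [/hnu|] := pselect (lattice (reciprocal A) y); [left|right].
split=> [h|[nu0 xA]].
  apply: functional_equation => //.
  have [xA|] := pselect (lattice A x); last by right.
  by left => nu0; apply: h.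
rewrite nu0 in hnu' *; apply/cvgcP => e e0.
have [r r0 hr] := derivable_ccontinuous
  (@lhs_derivable R d A x y (cexp (0 +i* (pi * dotp x y))) 0 hA hnu') e0.
have dp : 0 < d%:R :> R by rewrite ltr0n.
(* Within distance d of 0 the point d is avoided as well, so at every w other than 0 the functional
   equation applies and the limit of [rhs] is that of the continuous [lhs]. *)
apply/dnbhscP; exists (Num.min r d%:R); first by rewrite lt_min r0.
move=> w w0; rewrite lt_min => /andP[/hr wr wd].
have wd' : w <> d%:R.
  by move=> E; move: wd; rewrite E subr0 -(rmorph_nat (real_complex R)) normc_real ger0_norm// ltxx.
have -> : rhs w = lhs w by apply/esym/functional_equation => //; left => //; exact/eqP.
by move: wr; rewrite normc_distC /lhs !epstein_zeta_cont//; left.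
Qed.
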